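(* Let $\phi$ be a Drinfeld $A[\underline{t}_s]$-module over $\mathbb{T}_s$ with $\phi_\theta=\theta + A_1\tau + \dots + A_r\tau^r$ such that (i) $A_r\in \mathbb{T}_s^{\times}$, and (ii) $\Lambda_{\phi}$ is a free and finitely generated $A[\underline{t}_s]$-module of rank $r$. Then the de Rham map \[ \mathrm{DR} \colon H_{\mathrm{DR}}^*(\phi) \to \operatorname{Hom}_{A[\underline{t}_s]}(\Lambda_{\phi},\mathbb{T}_s),\qquad \mathrm{DR}([\eta])=F_{\eta}|_{\Lambda_{\phi}}, \] is an isomorphism of left $\mathbb{T}_s$-modules.
   Context: Let $\mathbb{F}_q$ be a finite field with $q$ elements, and $\theta, t_1,\dots,t_s$ ($s\ge 1$) independent variables; $A=\mathbb{F}_q[\theta]$, $A[\underline{t}_s]=\mathbb{F}_q[\theta,t_1,\dots,t_s]$, $\mathbb{F}_q[\underline{t}_s]=\mathbb{F}_q[t_1,\dots,t_s]$. Let $\mathbb{C}_\infty$ be the completion of an algebraic closure of $\mathbb{F}_q((1/\theta))$ with absolute value $|\cdot|_\infty$, $|\theta|_\infty=q$. $\mathbb{T}_s$ is the Tate algebra of power series $\sum_\nu a_\nu t_1^{\nu_1}\cdots t_s^{\nu_s}$ with $a_\nu\in\mathbb{C}_\infty$, $|a_\nu|_\infty\to 0$ as $\nu_1+\dots+\nu_s\to\infty$, with Gauss norm $\|f\|_\infty=\sup_\nu|a_\nu|_\infty$. The automorphism $\tau$ of $\mathbb{T}_s$ raises each coefficient $a_\nu$ to its $q$-th power; $f^{(n)}=\tau^n(f)$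 for $n\in\mathbb{Z}$. $\mathbb{T}_s[\tau]$ (resp. $\mathbb{T}_s[[\tau]]$) is the twisted polynomial (power series) ring with $\tau f=f^{(1)}\tau$; $\sum a_i\tau^i$ acts on $f\in\mathbb{T}_s$ by $\sum a_i f^{(i)}$ whenever this converges. A Drinfeld $A[\underline{t}_s]$-module of rank $r$ is an $\mathbb{F}_q[\underline{t}_s]$-algebra homomorphism $\phi: A[\underline{t}_s]\to\mathbb{T}_s[\tau]$, $a\mapsto\phi_a$, with $\phi_\theta=\theta+A_1\tau+\dots+A_r\tau^r$, $A_i\in\mathbb{T}_s$, $A_r\neq0$. Its exponential is the unique $\exp_\phi=\sum_{i\ge0}\alpha_i\tau^i\in\mathbb{T}_s[[\tau]]$ with $\alpha_0=1$ and $\exp_\phi a=\phi_a\exp_\phi$ for all $a\in A[\underline{t}_s]$; the series $\sum\alpha_i f^{(i)}$ converges for all $f\in\mathbb{T}_s$, giving an $\mathbb{F}_q[\underline{t}_s]$-linear map $\exp_\phi:\mathbb{T}_s\to\mathbb{T}_s$, and $\Lambda_\phi=\ker\exp_\phi$ is an $A[\underline{t}_s]$-submodule of $\mathbb{T}_s$. A biderivation is an $\mathbb{F}_q[\underline{t}_s]$-linear map $\eta:A[\underline{t}_s]\to\tau\mathbb{T}_s[\tau]$ with $\eta_{ab}=a\eta_b+\eta_a\phi_b$ for all $a,b$; the set $\mathrm{Der}(\phi)$ of biderivations is a left $\mathbb{T}_s$-module via $(f\eta)_a=f\eta_a$. For $m\in\tau\mathbb{T}_s[\tau]$, the strictly inner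 biderivation $\eta^{\{m\}}$ is $\eta^{\{m\}}_a=m\phi_a-am$; these form a submodule $\mathrm{Der}_{si}(\phi)$, and $H^*_{\mathrm{DR}}(\phi)=\mathrm{Der}(\phi)/\mathrm{Der}_{si}(\phi)$. For $\eta\in\mathrm{Der}(\phi)$, the quasi-periodic operator $F_\eta$ is the unique element of $\tau\mathbb{T}_s[[\tau]]$ with $F_\eta\theta-\theta F_\eta=\eta_\theta\exp_\phi$; it converges on every element of $\mathbb{T}_s$, its restriction to $\Lambda_\phi$ is $A[\underline{t}_s]$-linear, and $\mathrm{DR}$ is a well-defined $\mathbb{T}_s$-linear map, where $\operatorname{Hom}_{A[\underline{t}_s]}(\Lambda_\phi,\mathbb{T}_s)$ is a left $\mathbb{T}_s$-module by $(f\Omega)(\lambda)=f\Omega(\lambda)$. *)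

(* Defs.v *)
From HB Require Import structures.
From mathcomp Require Import all_boot all_order all_algebra.
From mathcomp Require Import reals.
From mathcomp Require Import mpoly.

Set Implicit Arguments.
Unset Strict Implicit.
Unset Printing Implicit Defensive.

Import Order.TTheory GRing.Theory Num.Theory.
Local Open Scope ring_scope.

(* Fq is F_q (q = #|Fq|), Kc is C_oo, iota : F_q -> C_oo, theta in C_oo, and *)
(* absv the absolute value |.|_oo (valued in a real type Rv).  The axioms     *)
(* characterise C_oo up to isometric isomorphism as the completion of an      *)
(* algebraic closure of F_q((1/theta)): Kc is algebraically closed, complete  *)
(* for an ultrametric absolute value with |theta| = q, and the elements of Kc *)
(* algebraic over F_q(theta) are dense in Kc.                                *)

Definition Fqtheta_val (F : finFieldType) (K : fieldType)
  (iota : {rmorphism F -> K}) (theta : K) (c : {poly F}) : K :=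
  (map_poly iota c).[theta].

Record CinfSetting := {
  Fq : finFieldType;
  Kc : closedFieldType;
  Rv : realType;
  iota : {rmorphism Fq -> Kc};
  theta : Kc;
  absv : Kc -> Rv;
  absv0 : absv 0 = 0;
  absv_gt0 : forall x : Kc, x != 0 -> 0 < absv x;
  absvM : forall x y : Kc, absv (x * y) = absv x * absv y;
  absv_ultra : forall x y : Kc, absv (x + y) <= Num.max (absv x) (absv y);
  absv_theta : absv theta = (#|Fq|)%:R;
  absv_complete : forall u : nat -> Kc,
    (forall eps : Rv, 0 < eps -> exists N : nat, forall m n : nat,
        (N <= m)%N -> (N <= n)%N -> absv (u m - u n) < eps) ->
    exists l : Kc, forall eps : Rv, 0 < eps -> exists N : nat, forall n : nat,
        (N <= n)%N -> absv (u n - l) < eps;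
  alg_dense : forall (x : Kc) (eps : Rv), 0 < eps ->
    exists y : Kc,
      (exists p : {poly {poly Fq}},
         map_poly (Fqtheta_val iota theta) p != 0 /\
         root (map_poly (Fqtheta_val iota theta) p) y) /\
      absv (x - y) < eps
}.

Definition qq (C : CinfSetting) : nat := #|Fq C|.

(* The Tate algebra T_s: elements are coefficient functions on monomials     *)
(* t^nu (nu : 'X_{1..s}) whose coefficients tend to 0 as |nu| -> oo.         *)

Definition Tfun (C : CinfSetting) (s : nat) := 'X_{1..s} -> Kc C.

Definition tate (C : CinfSetting) (s : nat) (f : Tfun C s) : Prop :=
  forall eps : Rv C, 0 < eps -> exists N : nat, forall nu : 'X_{1..s},
    (N <= mdeg nu)%N -> absv (f nu) < eps.

Definition tzero (C : CinfSetting) (s : nat) : Tfun C s := fun _ => 0.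
Arguments tzero C s _ : clear implicits.

Definition tcst (C : CinfSetting) (s : nat) (c : Kc C) : Tfun C s :=
  fun nu => if nu == 0%MM then c else 0.
Arguments tcst {C} s c _.

Definition tadd (C : CinfSetting) (s : nat) (f g : Tfun C s) : Tfun C s :=
  fun nu => f nu + g nu.

Definition tmul (C : CinfSetting) (s : nat) (f g : Tfun C s) : Tfun C s :=
  fun nu => \sum_(mu : 'X_{1..s < (mdeg nu).+1} | (bmnm mu <= nu)%MM)
              f (bmnm mu) * g (nu - bmnm mu)%MM.

Definition tunit (C : CinfSetting) (s : nat) (f : Tfun C s) : Prop :=
  exists g : Tfun C s, tate g /\ tmul f g = tcst s 1.

Definition tfrob (C : CinfSetting) (s : nat) (i : nat) (f : Tfun C s) : Tfun C s :=
  fun nu => f nu ^+ (qq C ^ i).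

Definition tconv (C : CinfSetting) (s : nat) (u : nat -> Tfun C s) (l : Tfun C s) : Prop :=
  forall eps : Rv C, 0 < eps -> exists N : nat, forall n : nat, (N <= n)%N ->
    forall nu : 'X_{1..s}, absv (u n nu - l nu) < eps.

(* Twisted power series T_s[[tau]] : sequences of coefficients (i |-> a_i),  *)
(* with (sum a_i tau^i)(sum b_j tau^j) = sum_k (sum_{i+j=k} a_i b_j^{(i)}) tau^k *)

Definition TS (C : CinfSetting) (s : nat) := nat -> Tfun C s.

Definition ts_tate (C : CinfSetting) (s : nat) (S : TS C s) : Prop :=
  forall i, tate (S i).

Definition ts_poly (C : CinfSetting) (s : nat) (S : TS C s) : Prop :=
  exists d : nat, forall i : nat, (d < i)%N -> S i = tzero C s.

Definition ts_tau0 (C : CinfSetting) (s : nat) (S : TS C s) : Prop :=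
  S 0%N = tzero C s.

Definition ts_const (C : CinfSetting) (s : nat) (f : Tfun C s) : TS C s :=
  fun i => if i == 0%N then f else tzero C s.

Definition tsmul (C : CinfSetting) (s : nat) (S U : TS C s) : TS C s :=
  fun k nu => \sum_(i < k.+1) tmul (S i) (tfrob i (U (k - i)%N)) nu.

Fixpoint tspow (C : CinfSetting) (s : nat) (P : TS C s) (j : nat) : TS C s :=
  match j with
  | 0%N => ts_const (tcst s 1)
  | j'.+1 => tsmul P (tspow P j')
  end.

Definition tpsum (C : CinfSetting) (s : nat) (S : TS C s) (f : Tfun C s) (n : nat) : Tfun C s :=
  fun nu => \sum_(i < n) tmul (S i) (tfrob i f) nu.

Definition tapp (C : CinfSetting) (s : nat) (S : TS C s) (f g : Tfun C s) : Prop :=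
  tconv (tpsum S f) g.

(* A[t_s] = F_q[t_1..t_s][theta], as {poly {mpoly F_q[s]}} (theta = 'X),     *)
(* and its embedding into T_s.                                               *)

Definition Apoly (C : CinfSetting) (s : nat) := {poly {mpoly (Fq C)[s]}}.

Definition embc (C : CinfSetting) (s : nat) (c : {mpoly (Fq C)[s]}) : Tfun C s :=
  fun nu => iota C (c@_nu).

Definition emb (C : CinfSetting) (s : nat) (a : Apoly C s) : Tfun C s :=
  fun nu => \sum_(j < size a) iota C ((a`_j)@_nu) * theta C ^+ j.

(* The Drinfeld module phi with phi_theta = sum_i Acoef i tau^i             *)
(* (Acoef 0 = theta), extended F_q[t_s]-algebra-homomorphically:            *)
(* phi_a = sum_j c_j (phi_theta)^j for a = sum_j c_j theta^j.               *)

Definition phi (C : CinfSetting) (s : nat) (Acoef : TS C s) (a : Apoly C s) : TS C s :=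
  fun i nu => \sum_(j < size a) tmul (embc (a`_j)) (tspow Acoef j i) nu.

Definition is_exp (C : CinfSetting) (s : nat) (Acoef : TS C s) (E : TS C s) : Prop :=
  ts_tate E /\ E 0%N = tcst s 1 /\
  forall a : Apoly C s, tsmul E (ts_const (emb a)) = tsmul (phi Acoef a) E.

Definition Lambda (C : CinfSetting) (s : nat) (E : TS C s) (f : Tfun C s) : Prop :=
  tate f /\ tapp E f (tzero C s).

Definition lattice_free_rank (C : CinfSetting) (s : nat) (E : TS C s) (r : nat) : Prop :=
  exists b : 'I_r -> Tfun C s,
    (forall i, Lambda E (b i)) /\
    (forall l, Lambda E l -> exists c : 'I_r -> Apoly C s,
        l = (fun nu => \sum_(i < r) tmul (emb (c i)) (b i) nu)) /\
    (forall c c' : 'I_r -> Apoly C s,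
        (fun nu => \sum_(i < r) tmul (emb (c i)) (b i) nu) =
        (fun nu => \sum_(i < r) tmul (emb (c' i)) (b i) nu) -> c = c').

Definition is_bider (C : CinfSetting) (s : nat) (Acoef : TS C s)
    (eta : Apoly C s -> TS C s) : Prop :=
  (forall a, ts_tate (eta a) /\ ts_poly (eta a) /\ ts_tau0 (eta a)) /\
  (forall (c : {mpoly (Fq C)[s]}) (a b : Apoly C s),
      eta (c%:P * a + b) = (fun i nu => tmul (embc c) (eta a i) nu + eta b i nu)) /\
  (forall a b : Apoly C s,
      eta (a * b) = (fun i nu => tmul (emb a) (eta b i) nu
                                 + tsmul (eta a) (phi Acoef b) i nu)).

Definition strictly_inner (C : CinfSetting) (s : nat) (Acoef : TS C s)
    (eta : Apoly C s -> TS C s) : Prop :=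
  exists m : TS C s, ts_tate m /\ ts_poly m /\ ts_tau0 m /\
    forall a : Apoly C s,
      eta a = (fun i nu => tsmul m (phi Acoef a) i nu - tmul (emb a) (m i) nu).

Definition is_quasi_periodic (C : CinfSetting) (s : nat) (E : TS C s)
    (eta : Apoly C s -> TS C s) (F : TS C s) : Prop :=
  ts_tate F /\ ts_tau0 F /\
  (fun i nu => tsmul F (ts_const (tcst s (theta C))) i nu
               - tmul (tcst s (theta C)) (F i) nu) = tsmul (eta 'X) E.

Definition is_Ahom (C : CinfSetting) (s : nat) (E : TS C s)
    (Om : Tfun C s -> Tfun C s) : Prop :=
  (forall l, Lambda E l -> tate (Om l)) /\
  (forall l m, Lambda E l -> Lambda E m -> Om (tadd l m) = tadd (Om l) (Om m)) /\
  (forall (a : Apoly C s) l, Lambda E l -> Om (tmul (emb a) l) = tmul (emb a) (Om l)).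

(* Main.v *)
(* Let T = T_s and let T' = T_(s+1) have the additional variable t.  Since exp is an isometry near
   0, l |-> f_l = sum_n exp(l / theta^(n+1)) t^n (the Anderson generating function) identifies
   Lambda with the solutions in T' of phi_theta(f) = t f, theta acting on Lambda as t.  For a basis
   (l_i), Upsilon = (tau^j f_(l_i)) satisfies Upsilon^(1) = Phi Upsilon, where Phi is the companion
   matrix and det Phi = +-(t - theta) / A_r is a unit of T'.

   Upsilon is invertible over T'.  Indeed, a unit of T' is dominated by its constant term, so det
   Upsilon times a nonzero factor is fixed by tau, hence is a polynomial g over F_q, nonzero by
   linear independence of the l_i.  The T'-module of the x with Upsilon x in g T'^r is closed and
   tau-stable.  If it were larger than g T'^r it would contain a nonzero remainder modulo g;
   because the residue field of C_oo is algebraic over F_q, iterating tau on such a remainder of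
   norm 1 converges to a remainder with coefficients algebraic over F_q, from which one over F_q
   is extracted.  But x in F_q[t_s, t]^r with Upsilon x = g y makes y a solution, so y = Upsilon a
   and x = g a, contradicting that x is a remainder.

   The equation Z = Z^(1) Phi for Z = Upsilon^-1 forces Z to be entire in t, so
   Upsilon^(1) can be inverted at t = theta.  Its value there is the matrix of DR with respect to
   the classes of theta |-> tau^j (1 <= j <= r), because
   F_eta(l) = sum_n theta^n eta_theta(exp(l / theta^(n+1))).  Since A_r is a unit, every eta_theta
   is congruent to a combination of tau, ..., tau^r modulo strictly inner biderivations. *)

From HB Require Import structures.
From mathcomp Require Import all_boot all_order all_algebra.
From mathcomp Require Import fingroup pgroup abelian finfield.
From mathcomp Require Import reals boolp.
From mathcomp Require Import mpoly.
From mathcomp Require Import lra ring zify.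
Require Import Defs.
Set Implicit Arguments.
Unset Strict Implicit.
Unset Printing Implicit Defensive.
Import Order.TTheory GRing.Theory Num.Theory.
Local Open Scope ring_scope.

(** * The field C_oo *)

(** The obstacle is that [T'] is not a field. A nonconstant polynomial over [F_q] has norm 1 without
    being a unit, so [det Upsilon != 0], which independence of the basis provides, does not make
    [Upsilon] invertible. That the basis also generates [Lambda] is what excludes a kernel of
    [Upsilon] modulo a polynomial [g] over [F_q].

    The matrix is evaluated at [t = theta] only after a Frobenius twist: the coefficient of [t^k] in
    the generating function of [l] has norm [|l| q^-(k+1)] for large [k], so the function itself
    does not converge there for [l != 0]. The rows of [Upsilon^(1)] carry [tau, ..., tau^r], the
    powers of [tau] left in a reduced biderivation.

    Biderivations are constructed by one device: for every [H] without constant term,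
    [m phi_theta - theta m = H] has a solution [m] in [T_s[[tau]]], because [theta^(q^k) - theta] is
    invertible for [k > 0]. A biderivation is therefore inner in the formal sense, with
    quasi-periodic operator [m exp], and it is strictly inner as soon as [m] can be taken
    polynomial. Surjectivity uses such an [m], which is usually infinite. *)

Section ConstantField.
Variable C : CinfSetting.
Implicit Types x y : Kc C.
Local Notation K := (Kc C).
Local Notation q := (qq C).

Lemma qq_gt1 : (1 < q)%N.
Proof. exact: card_finNzRing_gt1. Qed.

Lemma qq_gt0 : (0 < q)%N.
Proof. exact: ltnW qq_gt1. Qed.

Lemma qqX_gt0 i : (0 < q ^ i)%N.
Proof. by rewrite expn_gt0 qq_gt0. Qed.

Lemma ltn_qqX i : (i < q ^ i)%N.
Proof. exact: ltn_expl qq_gt1. Qed.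

Lemma absv_ge0 x : 0 <= absv x.
Proof.
have [->|nx] := eqVneq x 0; first by rewrite absv0.
exact/ltW/absv_gt0.
Qed.

Lemma absv_eq0 x : (absv x == 0) = (x == 0).
Proof.
have [->|nx] := eqVneq x 0; first by rewrite absv0 eqxx.
by apply/negbTE; rewrite gt_eqF ?absv_gt0.
Qed.

Lemma absv1 : absv (1 : K) = 1.
Proof.
have h : absv (1 : K) != 0 by rewrite absv_eq0 oner_neq0.
by apply: (mulfI h); rewrite -absvM !mulr1.
Qed.

Lemma absvX x n : absv (x ^+ n) = absv x ^+ n.
Proof. by elim: n => [|n IH]; rewrite ?expr0 ?absv1 // !exprS absvM IH. Qed.

Lemma absv_expr_eq1 x n : (0 < n)%N -> x ^+ n = 1 -> absv x = 1.
Proof.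
move=> n0 h; apply/eqP; rewrite -(@pexpr_eq1 _ _ n) ?absv_ge0 //.
by rewrite -absvX h absv1.
Qed.

Lemma absvN x : absv (- x) = absv x.
Proof.
rewrite -mulN1r absvM (@absv_expr_eq1 (-1) 2) ?mul1r //.
by rewrite sqrrN expr1n.
Qed.

Lemma absvV x : absv (x^-1) = (absv x)^-1.
Proof.
have [->|nx] := eqVneq x 0; first by rewrite invr0 absv0 invr0.
have h : absv x != 0 by rewrite absv_eq0.
by apply: (mulfI h); rewrite -absvM !mulfV // absv1.
Qed.

Lemma absv_leD x y c : absv x <= c -> absv y <= c -> absv (x + y) <= c.
Proof. by move=> hx hy; apply: le_trans (absv_ultra _ _) _; rewrite ge_max hx. Qed.

Lemma absv_ltD x y c : absv x < c -> absv y < c -> absv (x + y) < c.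
Proof. by move=> hx hy; apply: le_lt_trans (absv_ultra _ _) _; rewrite gt_max hx. Qed.

Lemma absv_sum_le I (r : seq I) (P : pred I) (F : I -> K) c : 0 <= c ->
  (forall i, P i -> absv (F i) <= c) -> absv (\sum_(i <- r | P i) F i) <= c.
Proof.
move=> c0 h; elim/big_ind: _ => //; first by rewrite absv0.
by move=> x y; apply: absv_leD.
Qed.

Lemma absv_sum_lt I (r : seq I) (P : pred I) (F : I -> K) c : 0 < c ->
  (forall i, P i -> absv (F i) < c) -> absv (\sum_(i <- r | P i) F i) < c.
Proof.
move=> c0 h; elim/big_ind: _ => //; first by rewrite absv0.
by move=> x y; apply: absv_ltD.
Qed.

Lemma absvDr x y : absv y < absv x -> absv (x + y) = absv x.
Proof.
move=> h; apply/eqP; rewrite eq_le absv_leD ?(ltW h) //=.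
rewrite leNgt; apply/negP => h1.
have : absv ((x + y) - y) < absv x by apply: absv_ltD; rewrite ?absvN.
by rewrite addrK ltxx.
Qed.

Lemma q_pnat : [pchar K].-nat q.
Proof.
have [p p_pr pchF] := finPcharP (Fq C).
have pG : pgroup p [set: Fq C] by apply: abelem_pgroup (fin_ring_pchar_abelem pchF).
have pn : p.-nat q by rewrite /qq -cardsT; exact: pG.
apply: sub_in_pnat pn => l _; rewrite inE => /eqP ->.
by rewrite (fmorph_pchar (iota C)).
Qed.

Lemma qX_pnat i : [pchar K].-nat (q ^ i)%N.
Proof. by rewrite pnatX q_pnat. Qed.

Lemma frobD i x y : (x + y) ^+ (q ^ i) = x ^+ (q ^ i) + y ^+ (q ^ i).
Proof. exact: exprDn_pchar (qX_pnat i). Qed.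

Lemma frob0 i : (0 : K) ^+ (q ^ i) = 0.
Proof. by rewrite expr0n gtn_eqF ?qqX_gt0. Qed.
Hint Resolve frob0 : core.

Lemma frobN i x : (- x) ^+ (q ^ i) = - x ^+ (q ^ i).
Proof. by apply/eqP; rewrite -addr_eq0 -frobD addNr frob0. Qed.

Lemma frob_sum i I (r : seq I) (P : pred I) (F : I -> K) :
  (\sum_(j <- r | P j) F j) ^+ (q ^ i) = \sum_(j <- r | P j) F j ^+ (q ^ i).
Proof.
by apply: (big_morph (fun x : K => x ^+ (q ^ i))) => [x y|]; [exact: frobD | exact: frob0].
Qed.

Lemma iotaX (a : Fq C) i : iota C a ^+ (q ^ i) = iota C a.
Proof.
elim: i => [|i IH]; first by rewrite expn0 expr1.
by rewrite expnS mulnC exprM IH -rmorphXn /= expf_card.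
Qed.

(** [X^q - X] is the product of the [X - a] over [a] in [F_q], so all its roots in [K] come from
    [F_q]. *)
Lemma frob_fixed x : x ^+ q = x -> exists a, x = iota C a.
Proof.
move=> h; have: map_poly (iota C) (\prod_a ('X - a%:P)) = 'X^q - 'X.
  by rewrite -finField_genPoly rmorphB /= map_polyXn map_polyX.
move=> /(congr1 (fun p : {poly K} => p.[x])).
rewrite !hornerE h subrr rmorph_prod horner_prod => /eqP.
rewrite prodf_seq_eq0 => /hasP [a _ /=].
rewrite rmorphB /= map_polyX map_polyC !hornerE subr_eq0 => /eqP ->.
by exists a.
Qed.

Lemma absv_iota (a : Fq C) : a != 0 -> absv (iota C a) = 1.
Proof.
move=> na; apply: (@absv_expr_eq1 _ q.-1); first by rewrite -ltnS prednK ?qq_gt1 ?qq_gt0.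
have h : iota C a != 0 by rewrite fmorph_eq0.
apply: (mulfI h); rewrite -exprS prednK ?qq_gt0 // mulr1.
by have := iotaX a 1; rewrite expn1.
Qed.

Lemma absv_iota_le (a : Fq C) : absv (iota C a) <= 1.
Proof.
have [->|na] := eqVneq a 0; first by rewrite rmorph0 absv0 ler01.
by rewrite absv_iota.
Qed.

Lemma absv_thetaq : absv (theta C) = q%:R.
Proof. exact: absv_theta. Qed.

Lemma qR_gt1 : 1 < q%:R :> Rv C.
Proof. by rewrite ltr1n qq_gt1. Qed.

Lemma qR_gt0 : 0 < q%:R :> Rv C.
Proof. exact: lt_trans ltr01 qR_gt1. Qed.

Lemma theta_neq0 : theta C != 0.
Proof. by rewrite -absv_eq0 absv_thetaq gt_eqF ?qR_gt0. Qed.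

Lemma absv_thetaXB i : (0 < i)%N ->
  absv (theta C ^+ (q ^ i) - theta C) = q%:R ^+ (q ^ i).
Proof.
move=> i0; rewrite absvDr absvX absv_thetaq // absvN absv_thetaq.
rewrite -[X in X < _]expr1 ltr_eXn2l ?qR_gt1 //.
by rewrite -(expn0 q) ltn_exp2l ?qq_gt1.
Qed.

Lemma thetaXB_neq0 i : (0 < i)%N -> theta C ^+ (q ^ i) - theta C != 0.
Proof.
by move=> i0; rewrite -absv_eq0 absv_thetaXB // expf_eq0 gt_eqF ?qR_gt0 ?andbF.
Qed.

(** The coefficient of index [n.-1] may vanish: one [n] has to serve for all coefficients of a
    polynomial over [F_q[theta]] at once. The other terms are smaller by a factor [q]. *)
Lemma absv_Fqtheta_le (c : {poly Fq C}) n : (size c <= n)%N ->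
  absv (Fqtheta_val (iota C) (theta C) c - iota C c`_n.-1 * theta C ^+ n.-1)
   <= q%:R ^+ n.-1 / q%:R.
Proof.
have qp := qR_gt0; have q1 := qR_gt1.
move=> h; rewrite /Fqtheta_val (@horner_coef_wide _ n); last first.
  exact: leq_trans (size_poly _ _) h.
case: n h => [|n] h /=.
  rewrite big_ord0 nth_default // rmorph0 mul0r subr0 absv0.
  by rewrite divr_ge0 ?exprn_ge0 // ltW.
rewrite big_ord_recr /= coef_map addrK.
apply: absv_sum_le; first by rewrite divr_ge0 ?exprn_ge0 ?ltW.
move=> i _; rewrite coef_map absvM absvX absv_thetaq.
apply: le_trans (_ : q%:R ^+ i <= _).
  by rewrite -[leRHS]mul1r ler_wpM2r ?absv_iota_le ?exprn_ge0 ?ltW.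
rewrite ler_pdivlMr // -exprSr ler_eXn2l //.
Qed.

(** The [q]-power map sends roots of a polynomial over [F_q] to roots. There are finitely many, so
    two iterates of [z] coincide, and injectivity of Frobenius cancels the common part. *)
Lemma Fq_algebraic_frob (Q : {poly Fq C}) z : Q != 0 -> root (map_poly (iota C) Q) z ->
  exists2 d, (0 < d)%N & z ^+ (q ^ d) = z.
Proof.
move=> nQ rz; set P := map_poly (iota C) Q in rz *.
have nP : P != 0 by rewrite map_poly_eq0.
have rP i : root P (z ^+ (q ^ i)).
  suff e : P.[z ^+ (q ^ i)] = P.[z] ^+ (q ^ i) by rewrite /root e (eqP rz) frob0.
  rewrite [in RHS]horner_coef frob_sum horner_coef; apply: eq_bigr => j _.
  by rewrite exprMn coef_map iotaX -!exprM mulnC.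
have : ~~ uniq (mkseq (fun i => z ^+ (q ^ i)) (size P)).
  apply/negP => U; have := max_poly_roots nP _ U.
  rewrite size_mkseq ltnn => h; apply/notF/h.
  by apply/allP => w /mapP [i _ ->].
case/(uniqPn 0) => i [j [ij]]; rewrite size_mkseq => js.
rewrite !nth_mkseq ?(ltn_trans ij) // => e.
exists (j - i)%N; first by rewrite subn_gt0.
apply/eqP; rewrite -subr_eq0.
have : (z ^+ (q ^ (j - i)) - z) ^+ (q ^ i) = 0.
  by rewrite frobD frobN -exprM -expnD subnK ?(ltnW ij) // -e subrr.
by move/eqP; rewrite expf_eq0 => /andP [].
Qed.

(* The coefficients of [Q] are the coefficients of [theta ^+ n.-1] in those of [P], where
   [n.-1] is the degree of [P] in [theta]. *)
Lemma alg_residue y (P : {poly {poly Fq C}}) :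
  map_poly (Fqtheta_val (iota C) (theta C)) P != 0 ->
  root (map_poly (Fqtheta_val (iota C) (theta C)) P) y -> absv y <= 1 ->
  exists2 Q : {poly Fq C}, Q != 0 & absv (map_poly (iota C) Q).[y] < 1.
Proof.
move=> nP0 rP y1; have qp := qR_gt0; have q1 := qR_gt1.
have nP : P != 0 by apply: contraNneq nP0 => ->; rewrite map_polyE polyseq0.
pose n := \max_(i < size P) size (P`_i)%R.
have sP i : (size (P`_i)%R <= n)%N.
  case: (ltnP i (size P)) => iP; last by rewrite nth_default ?size_poly0.
  exact: (leq_bigmax (Ordinal iP)).
pose Q := \poly_(i < size P) (P`_i)`_n.-1.
have n0 : (0 < n)%N.
  by apply: leq_trans (sP (size P).-1); rewrite size_poly_gt0 -/(lead_coef P) lead_coef_eq0.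
have nQ : Q != 0.
  have [|i hi] := @bigop.eq_bigmax 'I_(size P) (fun i => size (P`_i)%R).
    by rewrite card_ord size_poly_gt0.
  apply/negP => /eqP /(congr1 (fun p : {poly Fq C} => p`_i)).
  rewrite coef_poly ltn_ord coef0 /n hi -/(lead_coef (P`_i)) => /eqP.
  by rewrite lead_coef_eq0 -size_poly_eq0 -hi -/n; case: (n) n0.
exists Q => //; rewrite -(ltr_pM2r (exprn_gt0 n.-1 qp)) mul1r.
rewrite -{1}absv_thetaq -absvX -absvM.
apply: le_lt_trans (_ : q%:R ^+ n.-1 / q%:R < _); last first.
  by rewrite ltr_pdivrMr // ltr_pMr ?exprn_gt0.
have -> : (map_poly (iota C) Q).[y] * theta C ^+ n.-1 =
   - \sum_(i < size P) (Fqtheta_val (iota C) (theta C) P`_i -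
       iota C (P`_i)`_n.-1 * theta C ^+ n.-1) * y ^+ i.
  move/eqP: rP; rewrite /map_poly horner_poly => rP.
  under eq_bigr do rewrite mulrBl; rewrite big_split /= rP add0r sumrN opprK.
  rewrite /map_poly horner_poly mulr_suml.
  rewrite (big_ord_widen _ (fun i => iota C Q`_i * y ^+ i * theta C ^+ n.-1) (size_poly _ _)).
  rewrite big_mkcond; apply: eq_bigr => i _.
  have -> : Q`_i = (P`_i)`_n.-1 by rewrite coef_poly ltn_ord.
  case: ltnP => [_|h]; first by rewrite mulrAC.
  have : Q`_i = 0 by rewrite nth_default.
  by rewrite coef_poly ltn_ord => ->; rewrite rmorph0 !mul0r.
rewrite absvN; apply: absv_sum_le; first by rewrite divr_ge0 ?exprn_ge0 ?ltW.
move=> i _; rewrite absvM absvX -[leRHS]mulr1 ler_pM ?absv_ge0 ?exprn_ge0 ?absv_ge0 //.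
  exact: absv_Fqtheta_le.
by rewrite exprn_ile1 ?absv_ge0.
Qed.

(** By density [x] may be replaced by an element [y] algebraic over [F_q(theta)], for which
    [|Q(y)| < 1] with some nonzero [Q] over [F_q]. Since [Q] splits and its leading coefficient has
    absolute value 1, some factor [|y - z|] is less than 1. *)
Lemma residue_algebraic x : absv x <= 1 ->
  exists2 z : K, absv (x - z) < 1 & exists2 d, (0 < d)%N & z ^+ (q ^ d) = z.
Proof.
move=> x1; have [y [[P [nP rP]]] xy] := @alg_dense C x 1 ltr01.
have y1 : absv y <= 1.
  rewrite -[y](subrK x) absv_leD // -opprB absvN; exact: ltW.
have [Q nQ Qy] := alg_residue nP rP y1.
have [r hr] := closed_field_poly_normal (map_poly (iota C) Q).
suff [z zr yz] : exists2 z, z \in r & absv (y - z) < 1.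
  exists z; first by rewrite -[x](subrK y) -addrA absv_ltD.
  apply: (Fq_algebraic_frob nQ); rewrite hr rootZ ?lead_coef_eq0 ?map_poly_eq0 //.
  by rewrite root_prod_XsubC.
apply: contrapT => nz; move: Qy; rewrite hr hornerZ horner_prod absvM.
rewrite lead_coef_map absv_iota ?lead_coef_eq0 // mul1r ltNge => /negP; apply.
have: forall z, z \in r -> 1 <= absv (y - z).
  by move=> z zr; rewrite leNgt; apply/negP => h; apply: nz; exists z.
elim: (r) => [|z r' IH] h; first by rewrite big_nil absv1.
rewrite big_cons absvM hornerXsubC mulr_ege1 ?h ?mem_head //.
by apply: IH => w hw; apply: h; rewrite inE hw orbT.
Qed.

End ConstantField.

(** * The Tate algebra as a normed domain *)

Section PowerSeries.
Variables (C : CinfSetting) (n : nat).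
Local Notation K := (Kc C).
Implicit Types (f g h : Tfun C n) (p : {mpoly (Kc C)[n]}) (m nu : 'X_{1..n}).

(* The ring axioms are transported from polynomials with the same low-degree coefficients. *)
Definition agree N f p := forall m, (mdeg m < N)%N -> f m = p@_m.

Lemma agree_trunc N f : agree N f (\sum_(m : 'X_{1..n < N}) f m *: 'X_[m]).
Proof. by move=> m hm; rewrite mcoeff_mpoly. Qed.

Lemma agreeM N f g p p' : agree N f p -> agree N g p' -> agree N (tmul f g) (p * p').
Proof.
move=> hf hg m hm; rewrite (mcoeff_poly_mul_lin _ _ (ltnSn (mdeg m))).
apply: eq_bigr => k hk; rewrite hf ?hg //.
  by apply: leq_ltn_trans hm; rewrite mdegB.
by apply: leq_ltn_trans hm; rewrite -ltnS bmdeg.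
Qed.

Lemma agree1 N : agree N (tcst n 1) 1.
Proof. by move=> m _; rewrite mcoeff1 /tcst; case: eqP. Qed.

Lemma tmulA f g h : tmul f (tmul g h) = tmul (tmul f g) h.
Proof.
apply/funext => m; pose N := (mdeg m).+1.
have [F G H] := And3 (@agree_trunc N f) (@agree_trunc N g) (@agree_trunc N h).
rewrite (agreeM F (agreeM G H) (ltnSn _)) mulrA.
by rewrite (agreeM (agreeM F G) H (ltnSn _)).
Qed.

Lemma tmulC f g : tmul f g = tmul g f.
Proof.
apply/funext => m; pose N := (mdeg m).+1.
have [F G] := conj (@agree_trunc N f) (@agree_trunc N g).
by rewrite (agreeM F G (ltnSn _)) mulrC (agreeM G F (ltnSn _)).
Qed.

Lemma tmul1f f : tmul (tcst n 1) f = f.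
Proof.
apply/funext => m; pose N := (mdeg m).+1; have F := @agree_trunc N f.
by rewrite (agreeM (@agree1 _) F (ltnSn _)) mul1r -(F _ (ltnSn _)).
Qed.

Lemma tmulDl f g h : tmul (tadd f g) h = tadd (tmul f h) (tmul g h).
Proof.
apply/funext => m; rewrite /tadd /tmul -big_split; apply: eq_bigr => k _.
by rewrite mulrDl.
Qed.

Lemma tmul_cst c f m : tmul (tcst n c) f m = c * f m.
Proof.
have F := @agree_trunc (mdeg m).+1 f.
have hc : agree (mdeg m).+1 (tcst n c) c%:MP.
  by move=> k _; rewrite mcoeffC /tcst; case: eqP; rewrite ?mulr1 ?mulr0.
by rewrite (agreeM hc F (ltnSn _)) mcoeffCM -(F _ (ltnSn _)).
Qed.

Lemma tfrobM i f g : tfrob i (tmul f g) = tmul (tfrob i f) (tfrob i g).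
Proof.
apply/funext => m; rewrite /tfrob /tmul frob_sum; apply: eq_bigr => k _.
by rewrite exprMn.
Qed.

Lemma tate_bound f : tate f -> exists2 B, 0 < B & forall m, absv (f m) <= B.
Proof.
move=> /(_ 1 ltr01) [N hN].
have s0 : 0 <= \sum_(k : 'X_{1..n < N}) absv (f k) by rewrite sumr_ge0 // => k _; apply: absv_ge0.
exists (1 + \sum_(k : 'X_{1..n < N}) absv (f k)); first by rewrite ltr_wpDr.
move=> m; case: (ltnP (mdeg m) N) => hm; last first.
  by apply/ltW/(lt_le_trans (hN _ hm)); rewrite lerDl.
apply: ler_wpDl => //; rewrite (bigD1 (BMultinom hm)) //= lerDl.
by rewrite sumr_ge0 // => k _; apply: absv_ge0.
Qed.

Lemma tate_add f g : tate f -> tate g -> tate (tadd f g).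
Proof.
move=> hf hg e e0; have [[N hN] [M hM]] := conj (hf e e0) (hg e e0).
exists (maxn N M) => m; rewrite geq_max => /andP [h1 h2].
by rewrite absv_ltD ?hN ?hM.
Qed.

Lemma tate_mul f g : tate f -> tate g -> tate (tmul f g).
Proof.
move=> hf hg e e0.
have [[A A0 hA] [B B0 hB]] := conj (tate_bound hf) (tate_bound hg).
have [N hN] := hf (e / B) (divr_gt0 e0 B0).
have [M hM] := hg (e / A) (divr_gt0 e0 A0).
exists (N + M)%N => m hm; apply: absv_sum_lt => // k km; rewrite absvM.
case: (leqP N (mdeg k)) => hk.
  by apply: le_lt_trans (ler_wpM2l (absv_ge0 _) (hB _)) _; rewrite -ltr_pdivlMr // hN.
apply: le_lt_trans (ler_wpM2r (absv_ge0 _) (hA _)) _.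
rewrite mulrC -ltr_pdivlMr // hM //.
have := mdegD (m - k) k; rewrite submK //; lia.
Qed.

Lemma tate_cst c : tate (tcst n c : Tfun C n).
Proof.
move=> e e0; exists 1%N => m hm; rewrite /tcst; case: eqP => [h|_]; last by rewrite absv0.
by move: hm; rewrite h mdeg0.
Qed.

Lemma tate_opp f : tate f -> tate (fun nu => - f nu).
Proof. by move=> hf e e0; have [N hN] := hf e e0; exists N => m hm; rewrite absvN hN. Qed.

Lemma tate_frob i f : tate f -> tate (tfrob i f).
Proof.
move=> hf e e0; have [|N hN] := hf (Num.min e 1); first by rewrite lt_min e0 ltr01.
exists N => m /hN; rewrite lt_min => /andP [h1 h2]; rewrite /tfrob absvX.
apply: le_lt_trans h1; rewrite -[leRHS]expr1 ler_wiXn2l ?absv_ge0 ?qqX_gt0 ?ltW //.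
Qed.

(** Only finitely many coefficients of a nonzero [f] can attain the maximum; the largest of their
    exponents in the monomial order plays the role of a leading exponent. Strictness above it is
    what makes the Gauss norm multiplicative. *)
Lemma tate_max f : tate f -> exists mu, forall nu, absv (f nu) <= absv (f mu) /\
  (f mu != 0 -> (mu < nu)%O -> absv (f nu) < absv (f mu)).
Proof.
move=> hf; case: (pselect (exists m, f m != 0)) => [[m0 h0]|nf]; last first.
  have z m : f m = 0 by apply/eqP/negPn/negP => h; apply: nf; exists m.
  by exists 0%MM => nu; rewrite !z eqxx.
have [N hN] := hf _ (absv_gt0 h0).
have m0N : (mdeg m0 < N)%N by rewrite ltnNge; apply/negP => /hN; rewrite ltxx.
have [/= mu _ hmu] := @arg_maxP _ _ _ (BMultinom m0N) xpredT (fun k => absv (f k)) isT.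
pose P (k : 'X_{1..n < N}) := absv (f k) == absv (f mu).
have [/= k kP hk] := @arg_maxP _ _ _ mu P (fun k => bmnm k) (eqxx _).
exists k => nu; rewrite (eqP kP).
have m0mu : absv (f m0) <= absv (f mu) := hmu (BMultinom m0N) isT.
have hle : absv (f nu) <= absv (f mu).
  case: (ltnP (mdeg nu) N) => hnu; first exact: (hmu (BMultinom hnu)).
  exact: le_trans (ltW (hN _ hnu)) _.
split=> // _ knu; rewrite lt_neqAle hle andbT; apply/negP => e.
case: (ltnP (mdeg nu) N) => hnu.
  by have := hk (BMultinom hnu) e; rewrite leNgt knu.
by have := lt_le_trans (hN _ hnu) m0mu; rewrite (eqP e) ltxx.
Qed.

End PowerSeries.

Record tate_alg (C : CinfSetting) (n : nat) :=
  TateAlg { tfun :> 'X_{1..n} -> Kc C; tfunP : @tate C n tfun }.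
Arguments TateAlg {C n tfun}.

Section TateRing.
Variables (C : CinfSetting) (n : nat).
Local Notation K := (Kc C).
Local Notation T := (tate_alg C n).
Implicit Types f g h : T.

Lemma tateE f g : (forall m, f m = g m) -> f = g.
Proof.
case: f g => [f hf] [g hg] /= /funext e; case: _ / e hg => hg.
by rewrite (Prop_irrelevance hf hg).
Qed.

HB.instance Definition _ := gen_eqMixin T.
HB.instance Definition _ := gen_choiceMixin T.

Definition taddT f g : T := TateAlg (tate_add (tfunP f) (tfunP g)).
Definition toppT f : T := TateAlg (tate_opp (tfunP f)).
Definition tmulT f g : T := TateAlg (tate_mul (tfunP f) (tfunP g)).
Definition cst (c : K) : T := TateAlg (@tate_cst C n c).

Lemma taddTA : associative taddT.
Proof. by move=> f g h; apply: tateE => m; rewrite /= /tadd addrA. Qed.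
Lemma taddTC : commutative taddT.
Proof. by move=> f g; apply: tateE => m; rewrite /= /tadd addrC. Qed.
Lemma tadd0T : left_id (cst 0) taddT.
Proof. by move=> f; apply: tateE => m; rewrite /= /tadd /tcst; case: eqP; rewrite add0r. Qed.
Lemma taddNT : left_inverse (cst 0) toppT taddT.
Proof. by move=> f; apply: tateE => m; rewrite /= /tadd addNr /tcst; case: eqP. Qed.

HB.instance Definition _ := GRing.isZmodule.Build T taddTA taddTC tadd0T taddNT.

Lemma tmulTA : associative tmulT.
Proof. by move=> f g h; apply: tateE => m; rewrite /= tmulA. Qed.
Lemma tmulTC : commutative tmulT.
Proof. by move=> f g; apply: tateE => m; rewrite /= tmulC. Qed.
Lemma tmul1T : left_id (cst 1) tmulT.
Proof. by move=> f; apply: tateE => m; rewrite /= tmul1f. Qed.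
Lemma tmulTDl : left_distributive tmulT +%R.
Proof. by move=> f g h; apply: tateE => m; rewrite /= tmulDl. Qed.
Lemma cst1_neq0 : cst 1 != 0.
Proof.
apply/eqP => /(congr1 (fun f : T => f 0%MM)) /=; rewrite /tcst eqxx.
by apply/eqP/oner_neq0.
Qed.

HB.instance Definition _ :=
  GRing.Zmodule_isComNzRing.Build T tmulTA tmulTC tmul1T tmulTDl cst1_neq0.

Lemma coefT0 m : (0 : T) m = 0.
Proof. by rewrite /= /tcst; case: eqP. Qed.
Lemma coefTD f g m : (f + g) m = f m + g m.
Proof. by []. Qed.
Lemma coefTN f m : (- f) m = - f m.
Proof. by []. Qed.
Lemma coefTB f g m : (f - g) m = f m - g m.
Proof. by []. Qed.
Lemma coefTM f g m : (f * g) m = tmul f g m.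
Proof. by []. Qed.
Lemma coefTcst c m : cst c m = if m == 0%MM then c else 0.
Proof. by []. Qed.
Lemma coefT_sum I (r : seq I) (P : pred I) (F : I -> T) m :
  (\sum_(i <- r | P i) F i) m = \sum_(i <- r | P i) F i m.
Proof. by apply: (big_morph (fun f : T => f m)); [move=> f g|rewrite coefT0]. Qed.
Lemma coefTcstM c f m : (cst c * f) m = c * f m.
Proof. exact: tmul_cst. Qed.

Lemma cst_is_zmod : zmod_morphism cst.
Proof.
by move=> a b; apply: tateE => m; rewrite coefTB !coefTcst; case: eqP; rewrite ?subr0.
Qed.
Lemma cst_is_monoid : monoid_morphism cst.
Proof.
by split=> // a b; apply: tateE => m; rewrite coefTcstM !coefTcst; case: eqP; rewrite ?mulr0.
Qed.
HB.instance Definition _ := GRing.isZmodMorphism.Build K T cst cst_is_zmod.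
HB.instance Definition _ := GRing.isMonoidMorphism.Build K T cst cst_is_monoid.

Definition frob i f : T := TateAlg (tate_frob i (tfunP f)).
Lemma coefT_frob i f m : frob i f m = f m ^+ (qq C ^ i).
Proof. by []. Qed.

Lemma frob_is_zmod i : zmod_morphism (frob i).
Proof. by move=> f g; apply: tateE => m; rewrite coefT_frob !coefTB frobD frobN. Qed.
Lemma frob_is_monoid i : monoid_morphism (frob i).
Proof.
split; first by apply: tateE => m; rewrite coefT_frob coefTcst; case: eqP; rewrite ?expr1n ?frob0.
by move=> f g; apply: tateE => m; rewrite /= tfrobM.
Qed.
HB.instance Definition _ i := GRing.isZmodMorphism.Build T T (frob i) (@frob_is_zmod i).
HB.instance Definition _ i := GRing.isMonoidMorphism.Build T T (frob i) (@frob_is_monoid i).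

Lemma frob_comp i j f : frob i (frob j f) = frob (i + j) f.
Proof. by apply: tateE => m; rewrite !coefT_frob -exprM -expnD addnC. Qed.
Lemma frob_id f : frob 0 f = f.
Proof. by apply: tateE => m; rewrite coefT_frob expn0. Qed.
Lemma frob_cst i c : frob i (cst c) = cst (c ^+ (qq C ^ i)).
Proof. by apply: tateE => m; rewrite coefT_frob !coefTcst; case: eqP; rewrite ?frob0. Qed.

(** The supremum of the coefficients is attained, so the Gauss norm is read off at a chosen dominant
    exponent. *)
Definition norm f : Rv C := absv (f (sval (cid (tate_max (tfunP f))))).

Lemma norm_coef f m : absv (f m) <= norm f.
Proof. by rewrite /norm; case: cid => mu /= /(_ m) []. Qed.

Lemma norm_dominant f : f != 0 -> exists mu, [/\ absv (f mu) = norm f, f mu != 0 &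
  forall nu, (mu < nu)%O -> absv (f nu) < norm f].
Proof.
move=> nf; rewrite /norm; case: cid => mu /= h; exists mu.
have nmu : f mu != 0.
  apply: contraNneq nf => z; apply/eqP/tateE => m; rewrite coefT0.
  by apply/eqP; rewrite -absv_eq0 eq_le absv_ge0 andbT -(absv0 C) -z; case: (h m).
by split=> // nu mn; case: (h nu) => _; apply.
Qed.

Lemma norm_att f : exists mu, absv (f mu) = norm f.
Proof. by rewrite /norm; case: cid => mu h; exists mu. Qed.

Lemma norm_le f c : (forall m, absv (f m) <= c) -> norm f <= c.
Proof. by have [mu <-] := norm_att f. Qed.

Lemma norm_lt f c : (forall m, absv (f m) < c) -> norm f < c.
Proof. by have [mu <-] := norm_att f. Qed.

Lemma norm_ge0 f : 0 <= norm f.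
Proof. exact: absv_ge0. Qed.

Lemma norm0 : norm 0 = 0.
Proof. by rewrite /norm coefT0 absv0. Qed.

Lemma norm_eq0 f : (norm f == 0) = (f == 0).
Proof.
apply/eqP/eqP => [h|->]; last exact: norm0.
apply: tateE => m; rewrite coefT0; apply/eqP.
by rewrite -absv_eq0 eq_le absv_ge0 andbT -h norm_coef.
Qed.

Lemma norm_gt0 f : (0 < norm f) = (f != 0).
Proof. by rewrite lt_def norm_ge0 andbT norm_eq0. Qed.

Lemma normN f : norm (- f) = norm f.
Proof.
by apply/eqP; rewrite eq_le !norm_le // => m;
  [rewrite -absvN -coefTN | rewrite coefTN absvN]; exact: norm_coef.
Qed.

Lemma norm_cst c : norm (cst c) = absv c.
Proof.
apply/eqP; rewrite eq_le norm_le ?andTb; last first.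
  by move=> m; rewrite coefTcst; case: eqP => _; rewrite ?absv0 ?absv_ge0.
by rewrite (le_trans _ (norm_coef _ 0%MM)) // coefTcst eqxx.
Qed.

Lemma norm1 : norm 1 = 1.
Proof. by rewrite -(rmorph1 cst) norm_cst absv1. Qed.

Lemma norm_leD f g c : norm f <= c -> norm g <= c -> norm (f + g) <= c.
Proof.
move=> hf hg; apply: norm_le => m; rewrite coefTD absv_leD //.
  exact: le_trans (norm_coef _ _) hf.
exact: le_trans (norm_coef _ _) hg.
Qed.

Lemma norm_leB f g c : norm f <= c -> norm g <= c -> norm (f - g) <= c.
Proof. by move=> hf hg; rewrite norm_leD ?normN. Qed.

Lemma norm_ltD f g c : norm f < c -> norm g < c -> norm (f + g) < c.
Proof.
move=> hf hg; apply: norm_lt => m; rewrite coefTD absv_ltD //.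
  exact: le_lt_trans (norm_coef _ _) hf.
exact: le_lt_trans (norm_coef _ _) hg.
Qed.

Lemma norm_ltB f g c : norm f < c -> norm g < c -> norm (f - g) < c.
Proof. by move=> hf hg; rewrite norm_ltD ?normN. Qed.

Lemma norm_sum_le I (r : seq I) (P : pred I) (F : I -> T) c : 0 <= c ->
  (forall i, P i -> norm (F i) <= c) -> norm (\sum_(i <- r | P i) F i) <= c.
Proof.
move=> c0 h; elim/big_ind: _ => //; first by rewrite norm0.
by move=> x y; apply: norm_leD.
Qed.

Lemma norm_sum_lt I (r : seq I) (P : pred I) (F : I -> T) c : 0 < c ->
  (forall i, P i -> norm (F i) < c) -> norm (\sum_(i <- r | P i) F i) < c.
Proof.
move=> c0 h; elim/big_ind: _ => //; first by rewrite norm0.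
by move=> x y; apply: norm_ltD.
Qed.

Lemma normDr f g : norm g < norm f -> norm (f + g) = norm f.
Proof.
move=> h; apply/eqP; rewrite eq_le norm_leD ?(ltW h) //=.
rewrite leNgt; apply/negP => h1.
by have := norm_ltB h1 h; rewrite addrK ltxx.
Qed.

Lemma norm_frob i f : norm (frob i f) = norm f ^+ (qq C ^ i).
Proof.
apply/eqP; rewrite eq_le norm_le /=; last first.
  by move=> m; rewrite /tfrob absvX lerXn2r ?nnegrE ?absv_ge0 ?norm_ge0 ?norm_coef.
have [mu <-] := norm_att f; rewrite -absvX -coefT_frob; exact: norm_coef.
Qed.

(** In the convolution at [mu + nu], every pair of exponents other than [(mu, nu)] has its first
    member above [mu] or its second above [nu]. Its contribution is strictly smaller, and the
    ultrametric inequality leaves the term at [(mu, nu)]. *)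
Lemma norm_dominantM f g mu nu : f mu != 0 -> g nu != 0 ->
  absv (f mu) = norm f -> absv (g nu) = norm g ->
  (forall m, (mu < m)%O -> absv (f m) < norm f) ->
  (forall m, (nu < m)%O -> absv (g m) < norm g) ->
  absv ((f * g) (mu + nu)%MM) = norm f * norm g.
Proof.
move=> nf ng fmu gnu fd gd; have f0 : 0 < norm f by rewrite -fmu absv_gt0.
have g0 : 0 < norm g by rewrite -gnu absv_gt0.
have hmu : (mdeg mu < (mdeg (mu + nu)%MM).+1)%N by rewrite ltnS mdegD leq_addr.
rewrite coefTM /tmul (bigD1 (BMultinom hmu)) /=; last first.
  by apply/mnm_lepP => i; rewrite mnmDE leq_addr.
have -> : (mu + nu - mu)%MM = nu by rewrite addmC addmK.
rewrite absvDr absvM fmu gnu //; apply: absv_sum_lt; first exact: mulr_gt0.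
move=> k /andP [kle kmu]; rewrite absvM.
have e : (k + (mu + nu - k))%MM = (mu + nu)%MM by rewrite addmC submK.
have [kl|kg|ke] := ltgtP (bmnm k) mu; last by move: kmu; rewrite bmeqP /= ke eqxx.
  apply: le_lt_trans (ler_wpM2r (absv_ge0 _) (norm_coef f _)) _.
  rewrite ltr_pM2l // gd // ltNge; apply/negP => h.
  by have := lemc_lt_add h kl; rewrite addmC e addmC ltxx.
apply: le_lt_trans (ler_wpM2l (absv_ge0 _) (norm_coef g _)) _.
by rewrite ltr_pM2r // fd.
Qed.

Lemma normM f g : norm (f * g) = norm f * norm g.
Proof.
have [->|nf] := eqVneq f 0; first by rewrite mul0r norm0 mul0r.
have [->|ng] := eqVneq g 0; first by rewrite mulr0 norm0 mulr0.
have [mu [fmu f0 fd]] := norm_dominant nf.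
have [nu [gnu g0 gd]] := norm_dominant ng.
apply/eqP; rewrite eq_le -{2}(norm_dominantM f0 g0 fmu gnu fd gd) norm_coef andbT.
apply: norm_le => m; rewrite coefTM /tmul; apply: absv_sum_le => [|k _].
  by rewrite mulr_ge0 ?norm_ge0.
by rewrite absvM ler_pM ?absv_ge0 ?norm_coef.
Qed.

Lemma tate_integral f g : f * g = 0 -> (f == 0) || (g == 0).
Proof. by move=> /(congr1 norm); rewrite normM norm0 => /eqP; rewrite mulf_eq0 !norm_eq0. Qed.

Definition tate_unit : {pred T} := fun f => `[< exists g, g * f = 1 >].
Definition tate_inv f : T :=
  if pselect (exists g, g * f = 1) is left e then sval (cid e) else f.

Lemma tate_mulVx : {in tate_unit, left_inverse 1 tate_inv *%R}.
Proof.
move=> f /asboolP h; rewrite /tate_inv; case: pselect => // e.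
by case: cid.
Qed.
Lemma tate_unitPl f g : g * f = 1 -> f \in tate_unit.
Proof. by move=> h; apply/asboolP; exists g. Qed.
Lemma tate_inv_out : {in [predC tate_unit], tate_inv =1 id}.
Proof.
move=> f; rewrite inE /= => /asboolP h; rewrite /tate_inv.
by case: pselect.
Qed.

HB.instance Definition _ :=
  GRing.ComNzRing_hasMulInverse.Build T tate_mulVx tate_unitPl tate_inv_out.
HB.instance Definition _ := GRing.ComUnitRing_isIntegral.Build T tate_integral.

(* The product of the leading terms of a unit and of its inverse is the leading term of 1. *)
Lemma unit_dominant_const f g : f * g = 1 ->
  exists2 a : K, a != 0 & norm (f - cst a) < absv a.
Proof.
move=> fg.
have nf : f != 0 by apply: contraPneq fg => ->; rewrite mul0r => /eqP; rewrite eq_sym oner_eq0.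
have ng : g != 0 by apply: contraPneq fg => ->; rewrite mulr0 => /eqP; rewrite eq_sym oner_eq0.
have [mu [fmu f0 fd]] := norm_dominant nf.
have [nu [gnu g0 gd]] := norm_dominant ng.
have := norm_dominantM f0 g0 fmu gnu fd gd.
rewrite fg -(rmorph1 cst) coefTcst; case: eqP => [h _|_ /eqP]; last first.
  by rewrite absv0 eq_sym mulf_eq0 !norm_eq0 (negbTE nf) (negbTE ng).
have mu0 : mu = 0%MM.
  by apply/eqP; rewrite -mdeg_eq0 -leqn0; have := congr1 mdeg h; rewrite mdegD mdeg0; lia.
exists (f mu) => //; apply: norm_lt => m; rewrite coefTB coefTcst.
have [->|nm] := eqVneq m 0%MM; first by rewrite mu0 subrr absv0 -mu0 absv_gt0.
by rewrite subr0 fmu fd // mu0 lt_neqAle eq_sym nm le0m.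
Qed.

End TateRing.
Arguments norm {C n}.
Arguments cst {C} n c.
Arguments frob {C n} i f.

(** * Limits *)

Section Limits.
Variables (C : CinfSetting) (n : nat).
Local Notation K := (Kc C).
Local Notation T := (tate_alg C n).
Local Notation R := (Rv C).
Implicit Types (f g l : T) (u v : nat -> T) (a : nat -> R).

(** A one-sided form of convergence to 0, meant for sequences of nonnegative reals such as norms. *)
Definition null a := forall e : R, 0 < e -> exists N, forall k, (N <= k)%N -> a k < e.
Definition tends u l := null (fun k => norm (u k - l)).

Lemma null_le a b : (exists N, forall k, (N <= k)%N -> a k <= b k) -> null b -> null a.
Proof.
move=> [M hM] hb e e0; have [N hN] := hb e e0.
exists (maxn N M) => k; rewrite geq_max => /andP [h1 h2].
exact: le_lt_trans (hM _ h2) (hN _ h1).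
Qed.

Lemma null_max a b : null a -> null b -> null (fun k => Num.max (a k) (b k)).
Proof.
move=> ha hb e e0; have [[N hN] [M hM]] := conj (ha e e0) (hb e e0).
exists (maxn N M) => k; rewrite geq_max => /andP [h1 h2].
by rewrite gt_max hN ?hM.
Qed.

Lemma null_cM (c : R) a : 0 <= c -> (forall k, 0 <= a k) -> null a -> null (fun k => c * a k).
Proof.
move=> c0 a0 ha e e0; have c1 : 0 < c + 1 by rewrite ltr_wpDl.
have [N hN] := ha (e / (c + 1)) (divr_gt0 e0 c1); exists N => k /hN.
rewrite ltr_pdivlMr // mulrC; apply: le_lt_trans.
by rewrite ler_wpM2r // lerDl.
Qed.

Lemma null0 : null (fun _ => 0).
Proof. by move=> e e0; exists 0%N. Qed.

Lemma null_shift a N : null a -> null (fun k => a (k + N)%N).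
Proof.
move=> ha e e0; have [M hM] := ha e e0; exists M => k hk; apply: hM.
exact: leq_trans (leq_addr _ _).
Qed.

Lemma null_geom (x : R) : 0 <= x -> x < 1 -> null (fun k => x ^+ k).
Proof.
move=> x0 x1 e e0; have [->|nx] := eqVneq x 0.
  by exists 1%N => -[|k] // _; rewrite expr0n.
have xp : 0 < x by rewrite lt_def nx.
have d0 : 0 < x^-1 - 1 by rewrite subr_gt0 invf_gt1.
have [N hN] : exists N, (e * (x^-1 - 1))^-1 < N%:R.
  by exists (Num.trunc (e * (x^-1 - 1))^-1).+1; rewrite truncnS_gt.
exists N => k hk; have bern : forall j, 1 + j%:R * (x^-1 - 1) <= x^-1 ^+ j.
  elim=> [|j IH]; first by rewrite mul0r addr0 expr0.
  rewrite exprS; apply: le_trans (ler_wpM2l _ IH); last by rewrite invr_ge0.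
  have hj : 0 <= j%:R * (x^-1 - 1) * (x^-1 - 1) by rewrite !mulr_ge0 ?ler0n ?ltW.
  rewrite -natr1; nra.
rewrite -[x ^+ k]invrK -exprVn invf_plt ?posrE ?exprn_gt0 ?invr_gt0 //.
apply: lt_le_trans (bern k); apply: lt_trans (_ : k%:R * (x^-1 - 1) < _); last by rewrite ltrDr.
move: hN; rewrite invfM -ltr_pdivlMr ?invr_gt0 // invrK => hN; apply: lt_le_trans hN _.
by rewrite ler_wpM2r ?ler_nat // ltW.
Qed.

Lemma null_expq a (c : R) : c < 1 -> (forall k, 0 <= a k) -> (forall k, a k <= c ^+ (qq C ^ k)) ->
  null a.
Proof.
move=> c1 a0 h; have c0 : 0 <= c by apply: le_trans (a0 0%N) _; have := h 0%N; rewrite expn0 expr1.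
apply: null_le (null_geom c0 c1); exists 0%N => k _; apply: le_trans (h k) _.
by rewrite ler_wiXn2l ?(ltW c1) // ltnW // ltn_qqX.
Qed.

Lemma tends_cst l : tends (fun _ => l) l.
Proof. by apply: null_le null0; exists 0%N => k _; rewrite subrr norm0. Qed.

Lemma tends_eq u v l : (exists N, forall k, (N <= k)%N -> u k = v k) -> tends u l -> tends v l.
Proof. by move=> [N hN]; apply: null_le; exists N => k /hN ->. Qed.

Lemma tendsD u v l l' : tends u l -> tends v l' -> tends (fun k => u k + v k) (l + l').
Proof.
move=> h h'; apply: null_le (null_max h h'); exists 0%N => k _.
rewrite opprD addrACA; apply: norm_leD; rewrite le_max ?lexx ?orbT //.
Qed.

Lemma tendsMl c u l : tends u l -> tends (fun k => c * u k) (c * l).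
Proof.
move=> h; apply: null_le (null_cM (norm_ge0 c) _ h); last by move=> k; apply: norm_ge0.
by exists 0%N => k _; rewrite -mulrBr normM.
Qed.

Lemma tendsN u l : tends u l -> tends (fun k => - u k) (- l).
Proof. by apply: null_le; exists 0%N => k _; rewrite -opprD normN. Qed.

Lemma tendsB u v l l' : tends u l -> tends v l' -> tends (fun k => u k - v k) (l - l').
Proof. by move=> h /tendsN; apply: tendsD. Qed.

Lemma tends_frob i u l : tends u l -> tends (fun k => frob i (u k)) (frob i l).
Proof.
move=> h e e0; have [|N hN] := h (Num.min e 1); first by rewrite lt_min e0 ltr01.
exists N => k /hN; rewrite lt_min => /andP [h1 h2]; rewrite -rmorphB norm_frob.
apply: le_lt_trans h1; rewrite -[leRHS]expr1 ler_wiXn2l ?norm_ge0 ?qqX_gt0 ?ltW //.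
Qed.

Lemma tends_sum I (r : seq I) (P : pred I) (F : I -> nat -> T) (L : I -> T) :
  (forall i, P i -> tends (F i) (L i)) ->
  tends (fun k => \sum_(i <- r | P i) F i k) (\sum_(i <- r | P i) L i).
Proof.
move=> h; elim: r => [|i r IH].
  by rewrite big_nil; apply: tends_eq (tends_cst 0); exists 0%N => k _; rewrite big_nil.
rewrite big_cons; case: ifP => Pi.
  by apply: tends_eq (tendsD (h i Pi) IH); exists 0%N => k _; rewrite big_cons Pi.
by apply: tends_eq IH; exists 0%N => k _; rewrite big_cons Pi.
Qed.

Lemma tends_shift N u l : tends u l -> tends (fun k => u (k + N)%N) l.
Proof. exact: null_shift. Qed.

Lemma tends_norm_le u l c : (exists N, forall k, (N <= k)%N -> norm (u k) <= c) -> tends u l ->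
  norm l <= c.
Proof.
move=> [M hM] h; rewrite leNgt; apply/negP => hc.
have lp : 0 < norm l by apply: le_lt_trans hc; apply: le_trans (hM M (leqnn _)); apply: norm_ge0.
have [N hN] := h _ lp; have := hN _ (leq_maxl N M).
rewrite -normN opprB => h1; have := normDr (f := l) (g := - (l - u (maxn N M))).
rewrite normN => /(_ h1); rewrite opprB addrC subrK => e.
by have := hM _ (leq_maxr N M); rewrite e leNgt hc.
Qed.

Lemma tends_uniq u l l' : tends u l -> tends u l' -> l = l'.
Proof.
move=> h h'; apply/eqP; rewrite -subr_eq0 -norm_eq0 eq_le norm_ge0 andbT.
apply: tends_norm_le (tendsB h h'); exists 0%N => k _.
by rewrite subrr norm0.
Qed.

Lemma tends0P u : tends u 0 <-> null (fun k => norm (u k)).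
Proof. by split; apply: null_le; exists 0%N => k _; rewrite subr0. Qed.

(** Over an ultrametric norm, consecutive differences tending to 0 already make a Cauchy sequence.
    Coefficientwise limits exist in [K], and uniformity in the exponent makes the limit a Tate
    series. *)
Lemma tate_complete u : null (fun k => norm (u k.+1 - u k)) -> exists l, tends u l.
Proof.
move=> hu.
have cauchy e : 0 < e -> exists N, forall j k, (N <= j)%N -> (N <= k)%N -> norm (u j - u k) < e.
  move=> e0; have [N hN] := hu e e0; exists N.
  have aux j : (N <= j)%N -> norm (u j - u N) < e.
    elim: j => [|j IH]; first by rewrite leqn0 => /eqP ->; rewrite subrr norm0.
    rewrite leq_eqVlt => /orP [/eqP ->|]; first by rewrite subrr norm0.
    move=> Nj; rewrite -[u j.+1](subrK (u j)) -addrA; apply: norm_ltD; first exact: hN.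
    exact: IH.
  move=> j k /aux hj /aux hk; rewrite -[u j](subrK (u N)) -addrA norm_ltD //.
  by rewrite -opprB normN.
have /choice [l hl] : forall m, exists l : K, forall e : R, 0 < e -> exists N : nat,
    forall k, (N <= k)%N -> absv (u k m - l) < e.
  move=> m; apply: absv_complete => e e0; have [N hN] := cauchy e e0; exists N => j k hj hk.
  exact: le_lt_trans (norm_coef (u j - u k) m) (hN _ _ hj hk).
have unif e : 0 < e -> exists N, forall k m, (N <= k)%N -> absv (u k m - l m) < e.
  move=> e0; have [N hN] := cauchy e e0; exists N => k m hk.
  have [M hM] := hl m e e0; have := hM _ (leq_maxr N M).
  rewrite -[u k m](subrK (u (maxn N M) m)) -addrA => h; apply: absv_ltD h.
  by apply: le_lt_trans (norm_coef (_ - _) m) _; rewrite hN // leq_maxl.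
have tl : tate l.
  move=> e e0; have [N hN] := unif e e0; have [M hM] := tfunP (u N) e0.
  exists M => m hm; rewrite -[l m](subrK (u N m)) absv_ltD ?hM //.
  by rewrite -opprB absvN hN.
exists (TateAlg tl) => e e0; have [N hN] := unif e e0; exists N => k hk.
by apply: norm_lt => m; apply: hN.
Qed.

Lemma series_conv u : null (fun k => norm (u k)) -> exists l, tends (fun N => \sum_(i < N) u i) l.
Proof.
move=> h; apply: tate_complete; apply: null_le h; exists 0%N => k _.
by rewrite big_ord_recr /= addrAC subrr add0r.
Qed.

Lemma tconvP u l : tconv (fun k => u k) l <-> tends u l.
Proof.
split=> h e e0; have [N hN] := h e e0; exists N => k hk; first by apply: norm_lt => m; apply: hN.
by move=> m; apply: le_lt_trans (norm_coef (u k - l) m) _; apply: hN.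
Qed.

End Limits.

(** * Twisted power series *)

Section Twisted.
Variables (C : CinfSetting) (n : nat).
Local Notation K := (Kc C).
Local Notation T := (tate_alg C n).

Definition twist : Type := nat -> T.
Implicit Types (S U V : twist) (f : T).

HB.instance Definition _ := gen_eqMixin twist.
HB.instance Definition _ := gen_choiceMixin twist.

Definition twist_add S U : twist := fun i => S i + U i.
Definition twist_opp S : twist := fun i => - S i.
Definition twist_const f : twist := fun i => if i == 0%N then f else 0.
Definition twist_mul S U : twist := fun k => \sum_(i < k.+1) S i * frob i (U (k - i)%N).

Lemma twist_addA : associative twist_add.
Proof. by move=> S U V; apply/funext => i; rewrite /twist_add addrA. Qed.
Lemma twist_addC : commutative twist_add.
Proof. by move=> S U; apply/funext => i; rewrite /twist_add addrC. Qed.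
Lemma twist_add0 : left_id (fun _ => 0) twist_add.
Proof. by move=> S; apply/funext => i; rewrite /twist_add add0r. Qed.
Lemma twist_addN : left_inverse (fun _ => 0) twist_opp twist_add.
Proof. by move=> S; apply/funext => i; rewrite /twist_add addNr. Qed.
HB.instance Definition _ := GRing.isZmodule.Build twist twist_addA twist_addC twist_add0 twist_addN.

Lemma twist_mul_rev S U k :
  twist_mul S U k = \sum_(i < k.+1) S (k - i)%N * frob (k - i) (U i).
Proof.
rewrite /twist_mul (reindex_inj rev_ord_inj) /=; apply: eq_bigr => i _.
by rewrite subSS subKn // -ltnS.
Qed.

Lemma twist_mulA : associative twist_mul.
Proof.
move=> S U V; apply/funext => i; rewrite [RHS]twist_mul_rev.
pose c j k := S j * (frob j (U (i - j - k)%N) * frob (i - k) (V k)).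
transitivity (\sum_(j < i.+1) \sum_(k < i.+1 | (k <= i - j)%N) c j k).
  apply: eq_bigr => /= j _; rewrite twist_mul_rev rmorph_sum big_distrr /=.
  rewrite (big_ord_narrow_leq (leq_subr _ _)); apply: eq_bigr => k _ /=.
  rewrite /c rmorphM /= frob_comp; congr (_ * (_ * frob _ _)).
  have := ltn_ord k; have := ltn_ord j; lia.
rewrite (exchange_big_dep predT) //=; apply: eq_bigr => k _.
transitivity (\sum_(j < i.+1 | (j <= i - k)%N) c j k).
  by apply: eq_bigl => j; have := ltn_ord j; have := ltn_ord k; lia.
rewrite (big_ord_narrow_leq (leq_subr _ _)) big_distrl /=.
by apply: eq_bigr => j _; rewrite /c mulrA; congr (_ * frob _ (U _) * _); lia.
Qed.

Lemma twist_constM f S k : twist_mul (twist_const f) S k = f * S k.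
Proof.
rewrite /twist_mul big_ord_recl /= subn0 frob_id big1 ?addr0 // => i _.
by rewrite /twist_const /= mul0r.
Qed.

Lemma twist_Mconst f S k : twist_mul S (twist_const f) k = S k * frob k f.
Proof.
rewrite twist_mul_rev big_ord_recl /= subn0 big1 ?addr0 // => i _.
by rewrite /twist_const /= rmorph0 mulr0.
Qed.

Lemma twist_1mul : left_id (twist_const 1) twist_mul.
Proof. by move=> S; apply/funext => k; rewrite twist_constM mul1r. Qed.
Lemma twist_mul1 : right_id (twist_const 1) twist_mul.
Proof. by move=> S; apply/funext => k; rewrite twist_Mconst rmorph1 mulr1. Qed.
Lemma twist_mulDl : left_distributive twist_mul twist_add.
Proof.
move=> S U V; apply/funext => k; rewrite /twist_mul /twist_add -big_split.
by apply: eq_bigr => i _; rewrite mulrDl.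
Qed.
Lemma twist_mulDr : right_distributive twist_mul twist_add.
Proof.
move=> S U V; apply/funext => k; rewrite /twist_mul /twist_add -big_split.
by apply: eq_bigr => i _; rewrite rmorphD mulrDr.
Qed.
Lemma twist1_neq0 : twist_const 1 != 0.
Proof.
by apply/eqP => /(congr1 (fun S : twist => S 0%N)) /eqP; rewrite /twist_const eqxx oner_eq0.
Qed.
HB.instance Definition _ := GRing.Zmodule_isNzRing.Build twist
  twist_mulA twist_1mul twist_mul1 twist_mulDl twist_mulDr twist1_neq0.

Lemma coefSD S U i : (S + U) i = S i + U i. Proof. by []. Qed.
Lemma coefSN S i : (- S) i = - S i. Proof. by []. Qed.
Lemma coefSB S U i : (S - U) i = S i - U i. Proof. by []. Qed.
Lemma coefSM S U k : (S * U) k = \sum_(i < k.+1) S i * frob i (U (k - i)%N). Proof. by []. Qed.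
Lemma coefScM f S k : (twist_const f * S) k = f * S k. Proof. exact: twist_constM. Qed.
Lemma coefSMc f S k : (S * twist_const f) k = S k * frob k f. Proof. exact: twist_Mconst. Qed.
Lemma coefS_sum I (r : seq I) (P : pred I) (F : I -> twist) k :
  (\sum_(i <- r | P i) F i) k = \sum_(i <- r | P i) F i k.
Proof. by apply: (big_morph (fun S : twist => S k)). Qed.

Lemma twist_const_is_zmod : zmod_morphism twist_const.
Proof.
by move=> f g; apply/funext => i; rewrite coefSB /twist_const; case: eqP; rewrite ?subr0.
Qed.
Lemma twist_const_is_monoid : monoid_morphism twist_const.
Proof.
split=> // f g; apply/funext => i; rewrite coefScM /twist_const.
by case: eqP => // _; rewrite mulr0.
Qed.
HB.instance Definition _ := GRing.isZmodMorphism.Build T twist twist_const twist_const_is_zmod.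
HB.instance Definition _ := GRing.isMonoidMorphism.Build T twist twist_const twist_const_is_monoid.

(** Forgets the convergence proofs, giving the series of coefficient functions used in the statement
    of the theorem. *)
Definition raw S : TS C n := fun i => tfun (S i).

Lemma raw_inj S U : raw S = raw U -> S = U.
Proof. by move=> h; apply/funext => i; apply: tateE => m; rewrite -[LHS]/(raw S i m) h. Qed.

Lemma raw_tate S : ts_tate (raw S).
Proof. by move=> i; apply: tfunP. Qed.

Lemma rawP (S : TS C n) : ts_tate S -> exists S', S = raw S'.
Proof. by move=> h; exists (fun i => TateAlg (h i)). Qed.

Lemma raw_mul S U : tsmul (raw S) (raw U) = raw (S * U).
Proof. by apply/funext => k; apply/funext => m; rewrite /raw coefSM coefT_sum. Qed.

Lemma raw_const f : ts_const f = raw (twist_const f).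
Proof.
apply/funext => k; apply/funext => m; rewrite /ts_const /raw /twist_const.
by case: eqP => //; rewrite coefT0.
Qed.

Lemma raw_pow S j : tspow (raw S) j = raw (S ^+ j).
Proof.
elim: j => [|j IH] /=; last by rewrite IH raw_mul exprS.
by rewrite expr0 -(raw_const 1).
Qed.

Lemma embc_tate (c : {mpoly (Fq C)[n]}) : tate (embc c).
Proof.
move=> e e0; exists (msize c) => m hm.
by rewrite /embc memN_msupp_eq0 ?rmorph0 ?absv0 // msize_mdeg_ge.
Qed.
Definition embcT (c : {mpoly (Fq C)[n]}) : T := TateAlg (embc_tate c).
Lemma coefT_embc c m : embcT c m = iota C c@_m. Proof. by []. Qed.

Lemma embcT_is_zmod : zmod_morphism embcT.
Proof. by move=> c d; apply: tateE => m; rewrite coefTB !coefT_embc mcoeffB rmorphB. Qed.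
Lemma embcT_is_monoid : monoid_morphism embcT.
Proof.
split.
  apply: tateE => m; rewrite coefT_embc -(rmorph1 (@cst C n)) coefTcst mcoeff1.
  by case: eqP; rewrite ?rmorph1 ?rmorph0.
have ag N c : agree N (embcT c) (map_mpoly (iota C) c).
  by move=> m _; rewrite mcoeff_map_mpoly.
move=> c d; apply: tateE => m; rewrite coefTM (agreeM (ag _ c) (ag _ d) (ltnSn _)).
by rewrite -rmorphM mcoeff_map_mpoly.
Qed.
HB.instance Definition _ := GRing.isZmodMorphism.Build _ T embcT embcT_is_zmod.
HB.instance Definition _ := GRing.isMonoidMorphism.Build _ T embcT embcT_is_monoid.

Lemma frob_embc i c : frob i (embcT c) = embcT c.
Proof. by apply: tateE => m; rewrite coefT_frob coefT_embc iotaX. Qed.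

Lemma embcT_inj : injective embcT.
Proof.
move=> c d h; apply/mpolyP => m; apply: (fmorph_inj (iota C)).
by rewrite -!coefT_embc h.
Qed.

Definition thetaT : T := cst n (theta C).

Lemma norm_theta : norm thetaT = (qq C)%:R.
Proof. by rewrite norm_cst absv_thetaq. Qed.

Lemma norm_cstM c f : norm (cst n c * f) = absv c * norm f.
Proof. by rewrite normM norm_cst. Qed.

Lemma embcT_comm : commr_rmorph embcT thetaT.
Proof. by move=> c; apply: mulrC. Qed.
Definition embT (a : Apoly C n) : T := (map_poly embcT a).[thetaT].
HB.instance Definition _ := GRing.RMorphism.copy embT (horner_morph embcT_comm).

Lemma raw_emb a : emb a = embT a.
Proof.
apply/funext => m; rewrite /embT (@horner_coef_wide _ (size a)); last exact: size_poly.
rewrite coefT_sum; apply: eq_bigr => j _.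
by rewrite coef_map /thetaT -rmorphXn mulrC [in RHS]mulrC coefTcstM.
Qed.

Lemma embTX : embT 'X = thetaT.
Proof. exact: (horner_morphX embcT_comm). Qed.
Lemma embTC c : embT c%:P = embcT c.
Proof. exact: (horner_morphC embcT_comm). Qed.

Definition twist_emb c := twist_const (embcT c).
Lemma twist_emb_zmod : zmod_morphism twist_emb.
Proof. by move=> c d; rewrite /twist_emb !rmorphB. Qed.
Lemma twist_emb_monoid : monoid_morphism twist_emb.
Proof. by split=> [|c d]; rewrite /twist_emb ?rmorph1 ?rmorphM. Qed.
HB.instance Definition _ := GRing.isZmodMorphism.Build _ twist twist_emb twist_emb_zmod.
HB.instance Definition _ := GRing.isMonoidMorphism.Build _ twist twist_emb twist_emb_monoid.

Variable A : twist.

(** Elements of [F_q[t_s]] are fixed by [tau], hence central among twisted series. This turns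
    [a |-> phi_a] into evaluation of [a] at [phi_theta], and so into a ring morphism. *)
Lemma phi_comm : commr_rmorph twist_emb A.
Proof.
move=> c; apply/funext => k.
by rewrite coefScM coefSMc frob_embc mulrC.
Qed.
Definition phiT (a : Apoly C n) : twist := (map_poly twist_emb a).[A].
HB.instance Definition _ := GRing.RMorphism.copy phiT (horner_morph phi_comm).

Lemma raw_phi a : phi (raw A) a = raw (phiT a).
Proof.
apply/funext => k; apply/funext => m.
rewrite /phiT /raw (@horner_coef_wide _ (size a)); last exact: size_poly.
rewrite coefS_sum coefT_sum; apply: eq_bigr => j _.
by rewrite coef_map coefScM coefTM raw_pow.
Qed.
Lemma phiTX : phiT 'X = A.
Proof. exact: (horner_morphX phi_comm). Qed.
Lemma phiTC c : phiT c%:P = twist_const (embcT c).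
Proof. exact: (horner_morphC phi_comm). Qed.

End Twisted.
Arguments twist_const {C n}.
Arguments thetaT {C n}.

(** * Operators attached to entire twisted power series *)

Section Operators.
Variables (C : CinfSetting) (n : nat).
Local Notation K := (Kc C).
Local Notation T := (tate_alg C n).
Local Notation S_ := (twist C n).
Local Notation R := (Rv C).
Local Notation q := (qq C).
Implicit Types (S U P : S_) (f g l : T) (u : nat -> T).

Lemma expr_unbounded (b c : R) : 1 < b -> exists N, forall k, (N <= k)%N -> c <= b ^+ k.
Proof.
move=> b1; have b0 : 0 < b by apply: lt_trans b1.
have c0 : 0 < `|c| + 1 by rewrite ltr_wpDl.
have bi0 : 0 <= b^-1 by rewrite invr_ge0 ltW.
have bi1 : b^-1 < 1 by rewrite invf_lt1.
have ci : 0 < (`|c| + 1)^-1 by rewrite invr_gt0.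
have [N hN] := null_geom bi0 bi1 ci.
exists N => k /hN; rewrite exprVn ltf_pV2 ?posrE ?exprn_gt0 // => h.
by apply: le_trans (ltW h); apply: le_trans (ler_norm c) _; rewrite lerDl.
Qed.

Lemma expq_unbounded (b c : R) : 1 < b -> exists N, forall k, (N <= k)%N -> c <= b ^+ (q ^ k).
Proof.
move=> b1; have [N hN] := expr_unbounded c b1; exists N => k hk.
by apply: hN; apply: leq_trans hk _; rewrite ltnW ?ltn_qqX.
Qed.

Lemma qq_expr_le (x : R) i : 1 <= x -> x <= x ^+ (q ^ i).
Proof. by move=> x1; rewrite -[leLHS]expr1 ler_weXn2l ?qqX_gt0. Qed.

(** This is [|S_i|^(1/q^i) -> 0] written without roots, the condition under which the series
    [S_i f^(i)] is summable for [f] of any norm. *)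
Definition entire S := forall d : R, 0 < d -> exists N, forall i, (N <= i)%N -> norm (S i) <= d ^+ (q ^ i).

Definition twist_psum S f N : T := \sum_(i < N) S i * frob i f.

(** Total by the default value 0 where the series diverges. *)
Definition op S f : T :=
  if pselect (exists l, tends (twist_psum S f) l) is left e then sval (cid e) else 0.

Lemma op_eq S f l : tends (twist_psum S f) l -> op S f = l.
Proof.
move=> h; rewrite /op; case: pselect => [e|]; last by case; exists l.
by case: cid => l' h' /=; exact: tends_uniq h' h.
Qed.

Lemma entire_conv S f : entire S -> null (fun i => norm (S i * frob i f)).
Proof.
move=> hS; have f1 : 0 < norm f + 1 by rewrite ltr_wpDl ?norm_ge0.
have d0 : 0 < (2 * (norm f + 1))^-1 by rewrite invr_gt0 mulr_gt0.
have [N hN] := hS _ d0.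
have n0 := norm_ge0 f.
have h2 : 0 <= 2^-1 :> R by rewrite invr_ge0.
have h3 : (2^-1 : R) < 1 by rewrite invf_lt1 // ltr1n.
apply: null_le (null_geom h2 h3); exists N => i hi.
rewrite normM norm_frob; apply: le_trans (ler_wpM2r _ (hN i hi)) _; first by rewrite exprn_ge0.
rewrite -exprMn; apply: (@le_trans _ _ (2^-1 ^+ (q ^ i))); last first.
  by rewrite ler_wiXn2l ?(ltW h3) // ltnW ?ltn_qqX.
rewrite lerXn2r ?nnegrE ?mulr_ge0 ?(ltW d0) // invfM -mulrA -[leRHS]mulr1.
by rewrite ler_wpM2l // mulrC ler_pdivrMr // mul1r lerDl.
Qed.

Lemma opP S f : entire S -> tends (twist_psum S f) (op S f).
Proof.
by move=> hS; have [l h] := series_conv (entire_conv f hS); rewrite (op_eq h).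
Qed.

Lemma op_tapp S f g : tapp (raw S) f g <-> tends (twist_psum S f) g.
Proof.
rewrite -tconvP /tapp; suff -> : tpsum (raw S) f = fun k => twist_psum S f k by [].
by apply/funext => N; apply/funext => m; rewrite coefT_sum.
Qed.

Lemma tapp_op S f g : entire S -> tapp (raw S) f g <-> op S f = g.
Proof. by move=> hS; rewrite op_tapp; split=> [/op_eq //|<-]; apply: opP. Qed.

Lemma opD S f g : entire S -> op S (f + g) = op S f + op S g.
Proof.
move=> hS; apply: op_eq; apply: tends_eq (tendsD (opP f hS) (opP g hS)).
exists 0%N => N _; rewrite /twist_psum -big_split; apply: eq_bigr => i _.
by rewrite rmorphD mulrDr.
Qed.

Lemma opN S f : entire S -> op S (- f) = - op S f.
Proof.
move=> hS; apply: op_eq; apply: tends_eq (tendsN (opP f hS)).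
exists 0%N => N _; rewrite /twist_psum -sumrN; apply: eq_bigr => i _.
by rewrite rmorphN mulrN.
Qed.

Lemma op0 S : op S 0 = 0.
Proof.
apply: op_eq; apply: tends_eq (tends_cst 0); exists 0%N => N _.
by rewrite /twist_psum big1 // => i _; rewrite rmorph0 mulr0.
Qed.

Lemma op_sum S I (r : seq I) (Q : pred I) (F : I -> T) : entire S ->
  op S (\sum_(i <- r | Q i) F i) = \sum_(i <- r | Q i) op S (F i).
Proof. by move=> hS; apply: (big_morph (op S)) => [f g|]; rewrite ?opD ?op0. Qed.

Lemma op_embc S c f : entire S -> op S (embcT c * f) = embcT c * op S f.
Proof.
move=> hS; apply: op_eq; apply: tends_eq (tendsMl (embcT c) (opP f hS)).
exists 0%N => N _; rewrite /twist_psum mulr_sumr; apply: eq_bigr => i _.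
by rewrite rmorphM /= frob_embc mulrCA.
Qed.

Lemma op_Mconst S c f : op (S * twist_const c) f = op S (c * f).
Proof.
have e : twist_psum (S * twist_const c) f = twist_psum S (c * f).
  by apply/funext => N; apply: eq_bigr => i _; rewrite coefSMc rmorphM mulrA.
by rewrite /op e.
Qed.

Lemma op_plus S U f : entire S -> entire U -> op (S + U) f = op S f + op U f.
Proof.
move=> hS hU; apply: op_eq; apply: tends_eq (tendsD (opP f hS) (opP f hU)).
exists 0%N => N _; rewrite /twist_psum -big_split; apply: eq_bigr => i _.
by rewrite coefSD mulrDl.
Qed.

Lemma op_constM S c f : entire S -> op (twist_const c * S) f = c * op S f.
Proof.
move=> hS; apply: op_eq; apply: tends_eq (tendsMl c (opP f hS)).
exists 0%N => N _; rewrite /twist_psum mulr_sumr; apply: eq_bigr => i _.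
by rewrite coefScM mulrA.
Qed.

Lemma op_opp S f : entire S -> op (- S) f = - op S f.
Proof.
move=> hS; apply: op_eq; apply: tends_eq (tendsN (opP f hS)).
exists 0%N => N _; rewrite /twist_psum -sumrN; apply: eq_bigr => i _.
by rewrite coefSN mulNr.
Qed.

Lemma entire_le S U : (exists N, forall i, (N <= i)%N -> norm (S i) <= norm (U i)) ->
  entire U -> entire S.
Proof.
move=> [N hN] hU d /hU [M hM]; exists (maxn N M) => i.
by rewrite geq_max => /andP [/hN h1 /hM]; apply: le_trans.
Qed.

Lemma entire_opp S : entire S -> entire (- S).
Proof. by apply: entire_le; exists 0%N => i _; rewrite coefSN normN. Qed.

Lemma entireD S U : entire S -> entire U -> entire (S + U).
Proof.
move=> hS hU d d0; have [[N hN] [M hM]] := conj (hS d d0) (hU d d0).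
exists (maxn N M) => i; rewrite geq_max => /andP [h1 h2].
by rewrite coefSD norm_leD ?hN ?hM.
Qed.

Definition twist_poly d S := forall i, (d < i)%N -> S i = 0.

Lemma entire_poly d S : twist_poly d S -> entire S.
Proof.
move=> hS e e0; exists d.+1 => i hi; rewrite hS // norm0 exprn_ge0 //; exact: ltW.
Qed.

Lemma op_poly d S f : twist_poly d S -> op S f = \sum_(i < d.+1) S i * frob i f.
Proof.
move=> hS; apply: op_eq; apply: tends_eq (tends_cst _); exists d.+1 => N hN.
rewrite /twist_psum (big_ord_widen _ (fun i => S i * frob i f) hN).
rewrite [RHS](bigID (fun i : 'I_N => (i < d.+1)%N)) /= [X in _ + X]big1 ?addr0 //.
by move=> i; rewrite -leqNgt => /hS ->; rewrite mul0r.
Qed.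

Lemma entire_mul d P S : twist_poly d P -> entire S -> entire (P * S).
Proof.
move=> hP hS e e0.
(* Aiming at [e / 2] for [S] leaves a factor [2^(q^k)], which eventually exceeds the bound [B] on
   the coefficients of [P]. *)
have e20 : 0 < e / 2 by rewrite divr_gt0.
have [N hN] := hS _ e20.
pose B := \sum_(j < d.+1) norm (P j).
have B0 : 0 <= B by rewrite sumr_ge0 // => j _; apply: norm_ge0.
have PB j : norm (P j) <= B.
  case: (ltnP d j) => hj; first by rewrite hP // norm0.
  rewrite /B (bigD1 (Ordinal (hj : (j < d.+1)%N))) //= lerDl sumr_ge0 // => k _; apply: norm_ge0.
have two1 : (1 : R) < 2 by rewrite ltr1n.
have [M hM] := expq_unbounded B two1.
exists (maxn M (N + d)) => k; rewrite geq_max => /andP [/hM hk1 hk2].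
rewrite coefSM; apply: norm_sum_le; first by rewrite exprn_ge0 ?ltW.
move=> j _; rewrite normM norm_frob.
case: (ltnP d j) => hj; first by rewrite hP // norm0 mul0r exprn_ge0 ?ltW.
have -> : e ^+ (q ^ k) = 2 ^+ (q ^ k) * (e / 2) ^+ (q ^ k).
  by rewrite -exprMn mulrCA mulfV ?mulr1 ?pnatr_eq0.
apply: ler_pM; rewrite ?norm_ge0 ?exprn_ge0 ?norm_ge0 //.
  exact: le_trans (PB j) hk1.
have -> : (q ^ k = q ^ (k - j) * q ^ j)%N.
  by rewrite -expnD subnK // -ltnS ltn_ord.
rewrite exprM lerXn2r ?nnegrE ?norm_ge0 ?exprn_ge0 ?(ltW e20) //.
by apply: hN; lia.
Qed.

Lemma sum_triangle (V : nmodType) (F : nat -> nat -> V) N :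
  \sum_(k < N) \sum_(j < k.+1) F j (k - j)%N = \sum_(j < N) \sum_(i < N - j) F j i.
Proof.
elim: N => [|N IH]; first by rewrite !big_ord0.
rewrite big_ord_recr /= IH.
transitivity (\sum_(j < N.+1) (\sum_(i < N - j) F j i + F j (N - j)%N)); last first.
  by apply: eq_bigr => j _; rewrite subSn ?big_ord_recr // -ltnS.
rewrite [RHS]big_split /=; congr (_ + _).
by rewrite [in RHS]big_ord_recr /= subnn big_ord0 addr0.
Qed.

Lemma tends_subn u l j : tends u l -> tends (fun N => u (N - j)%N) l.
Proof.
move=> h e e0; have [N hN] := h e e0; exists (N + j)%N => k hk; apply: hN; lia.
Qed.

(** As [P] is a polynomial, only finitely many limits are combined: the partial sum of length [N] of
    [P S] regroups into the terms [P_j tau^j] applied to the partial sums of length [N - j] of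
    [S]. *)
Lemma op_mul d P S f : twist_poly d P -> entire S -> op (P * S) f = op P (op S f).
Proof.
move=> hP hS; rewrite (op_poly _ hP); apply: op_eq.
have h j : tends (fun N => P j * frob j (twist_psum S f (N - j))) (P j * frob j (op S f)).
  by apply: tendsMl; apply: tends_frob; apply: tends_subn; apply: opP.
apply: tends_eq (tends_sum (index_enum 'I_d.+1) (P := xpredT) (fun i _ => h i)).
exists d.+1 => N hN; rewrite (big_ord_widen _ (fun j => P j * frob j (twist_psum S f (N - j))) hN).
transitivity (\sum_(j < N) P j * frob j (twist_psum S f (N - j))).
  rewrite [RHS](bigID (fun i : 'I_N => (i < d.+1)%N)) /= [X in _ = _ + X]big1 ?addr0 //.
  by move=> i; rewrite -leqNgt => /hP ->; rewrite mul0r.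
transitivity (\sum_(j < N) \sum_(i < N - j) P j * frob j (S i * frob i f)).
  by apply: eq_bigr => j _; rewrite rmorph_sum mulr_sumr.
rewrite -(sum_triangle (fun j i => P j * frob j (S i * frob i f))).
apply: eq_bigr => k _; rewrite coefSM mulr_suml; apply: eq_bigr => j _.
by rewrite rmorphM /= frob_comp mulrA subnKC // -ltnS.
Qed.

Lemma op_small S : entire S -> S 0%N = 0 ->
  exists2 B : R, 0 <= B & forall f, norm f <= 1 -> norm (op S f) <= B * norm f ^+ q.
Proof.
move=> hS S0; have [N hN] := hS 1 ltr01.
pose B := 1 + \sum_(i < N) norm (S i).
have s0 : 0 <= \sum_(i < N) norm (S i) by rewrite sumr_ge0 // => j _; apply: norm_ge0.
have SB i : norm (S i) <= B.
  case: (ltnP i N) => hi; last first.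
    by apply: le_trans (hN _ hi) _; rewrite expr1n lerDl.
  rewrite /B ler_wpDl // (bigD1 (Ordinal hi)) //= lerDl sumr_ge0 // => k _; apply: norm_ge0.
have B0 : 0 <= B by rewrite ler_wpDr.
exists B => // f f1; apply: tends_norm_le (opP f hS); exists 0%N => k _.
apply: norm_sum_le; first by rewrite mulr_ge0 ?exprn_ge0 ?norm_ge0.
move=> [[|i] hi] _ /=; first by rewrite S0 mul0r norm0 mulr_ge0 ?exprn_ge0 ?norm_ge0.
rewrite normM norm_frob ler_pM ?exprn_ge0 ?norm_ge0 //.
by rewrite ler_wiXn2l ?norm_ge0 // -[X in (X <= _)%N]expn1 leq_exp2l ?qq_gt1.
Qed.

Lemma op_near_id S : entire S -> S 0%N = 1 ->
  exists2 d : R, 0 < d & forall f, norm f <= d -> norm (op S f - f) <= norm f / 2.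
Proof.
move=> hS S1; pose S' : S_ := S - 1.
have e1 : entire 1 by apply: (@entire_poly 0) => -[|i].
have hS' : entire S' by apply: entireD hS (entire_opp e1).
have S'0 : S' 0%N = 0 by rewrite -[LHS]/(S 0%N - (1 : S_) 0%N) S1 subrr.
have [B B0 hB] := op_small hS' S'0.
have op1 f : op 1 f = f.
  by rewrite (@op_poly 0) => [|[|i]] //; rewrite big_ord1 frob_id mul1r.
have B10 : 0 < 2 * (B + 1) by rewrite mulr_gt0 // ltr_wpDl.
(* In this ball [|f| <= 1] and [B |f| <= 1/2], so the error, at most [B |f|^q <= B |f|^2], is at
   most [|f| / 2]. *)
exists (2 * (B + 1))^-1; first by rewrite invr_gt0.
move=> f hf; have n0 := norm_ge0 f.
have f1 : norm f <= 1.
  apply: le_trans hf _; rewrite invf_le1 //; nra.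
have -> : op S f - f = op S' f by rewrite [RHS](op_plus f hS (entire_opp e1)) op_opp // op1.
apply: le_trans (hB f f1) _.
apply: (@le_trans _ _ (B * norm f ^+ 2)).
  by rewrite ler_wpM2l // ler_wiXn2l ?qq_gt1.
move: hf; rewrite -[leRHS]mul1r ler_pdivlMr // => hf.
rewrite expr2; nra.
Qed.

Section NearIdentity.
Variables (S : S_) (d : R).
Hypotheses (hS : entire S) (d0 : 0 < d).
Hypothesis near : forall f, norm f <= d -> norm (op S f - f) <= norm f / 2.

Lemma op_isometry f : norm f <= d -> norm (op S f) = norm f.
Proof.
move=> hf; have [->|nf] := eqVneq f 0; first by rewrite op0 norm0.
rewrite -[op S f](subrK f) addrC normDr //.
have f0 : 0 < norm f by rewrite norm_gt0.
by apply: le_lt_trans (near hf) _; rewrite ltr_pdivrMr // ltr_pMr // ltr1n.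
Qed.

Lemma op_inj0 f : norm f <= d -> op S f = 0 -> f = 0.
Proof.
by move=> hf h; apply/eqP; rewrite -norm_eq0 -(op_isometry hf) h norm0.
Qed.

(** Successive approximation [y_(k+1) = y_k + (x - S(y_k))]: since [S] is close to the identity on
    the ball, each correction halves the error. *)
Lemma op_surj x : norm x <= d -> exists2 y, norm y <= d & op S y = x.
Proof.
move=> hx; pose y := fix y k := if k is k'.+1 then y k' + (x - op S (y k')) else 0.
have hy k : norm (y k) <= d /\ norm (x - op S (y k)) <= d / 2 ^+ k.
  elim: k => [|k [h1 h2]] /=; first by rewrite norm0 op0 subr0 expr0 divr1 (ltW d0) hx.
  have h3 : norm (x - op S (y k)) <= d.
    apply: le_trans h2 _; rewrite ler_pdivrMr ?exprn_gt0 // ler_pMr //.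
    by rewrite exprn_ege1 // ler1n.
  split; first exact: norm_leD.
  rewrite opD // opprD addrA -opprB normN; apply: le_trans (near h3) _.
  rewrite exprSr invfM mulrA ler_wpM2r ?invr_ge0 //.
have g : null (fun k => d * 2^-1 ^+ k).
  apply: null_cM (ltW d0) _ (null_geom _ _) => [k||]; rewrite ?exprn_ge0 ?invr_ge0 //.
  by rewrite invf_lt1 // ltr1n.
have [l hl] : exists l, tends y l.
  apply: tate_complete; apply: null_le g; exists 0%N => k _ /=.
  by rewrite addrAC subrr add0r exprVn; case: (hy k).
have ld : norm l <= d by apply: tends_norm_le hl; exists 0%N => k _; case: (hy k).
exists l => //; apply: (@tends_uniq _ _ (fun k => op S (y k))).
  have h : null (fun k => norm (y k - l)) by exact: hl.
  apply: null_le h; exists 0%N => k _; rewrite -opN // -opD // op_isometry //.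
  by apply: norm_leB => //; case: (hy k).
apply: null_le g; exists 0%N => k _.
by rewrite -normN opprB exprVn; case: (hy k).
Qed.
End NearIdentity.

Section ExpEntire.
Variables (A E : S_) (r : nat).
Hypotheses (hA : twist_poly r A) (A0 : A 0%N = thetaT).
Hypothesis hE : E * twist_const thetaT = A * E.

Lemma exp_rec i : (0 < i)%N ->
  cst n (theta C ^+ (q ^ i) - theta C) * E i =
  \sum_(j < i) A j.+1 * frob j.+1 (E (i - j.+1)%N).
Proof.
move=> i0; have := congr1 (fun S : S_ => S i) hE; rewrite coefSMc coefSM big_ord_recl /= A0.
rewrite subn0 frob_id frob_cst => h.
by rewrite rmorphB mulrBl -/thetaT mulrC h addrAC subrr add0r.
Qed.

(** In the recursion for [exp], the coefficient [E_i] is multiplied by [theta^(q^i) - theta], of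
    absolute value [q^(q^i) >= 2^(q^i)]. Only the [r] preceding coefficients occur on the other
    side. *)
Lemma exp_coef_bound (c M : R) i : (0 < i)%N -> 0 <= M -> 1 <= c -> (forall j, norm (A j) <= c) ->
  (forall j, (j < r)%N -> (j < i)%N -> norm (E (i - j.+1)%N) ^+ (q ^ j.+1) <= M) ->
  norm (E i) * 2 ^+ (q ^ i) <= c * M.
Proof.
move=> i0 M0 c1 cA hM; have c0 : 0 <= c by apply: le_trans c1.
apply: (@le_trans _ _ (norm (cst n (theta C ^+ (q ^ i) - theta C) * E i))).
  rewrite norm_cstM absv_thetaXB // mulrC ler_wpM2r ?norm_ge0 // lerXn2r ?nnegrE ?ler0n //.
  by rewrite ler_nat qq_gt1.
rewrite exp_rec //; apply: norm_sum_le; first exact: mulr_ge0.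
move=> j _; rewrite normM norm_frob; case: (ltnP j r) => hj.
  by rewrite ler_pM ?norm_ge0 ?exprn_ge0 ?norm_ge0 ?cA ?hM.
by rewrite hA ?norm0 ?mul0r ?mulr_ge0.
Qed.

(** A bound [|E_i| <= d^(q^i)] is obtained for some [d], and then the recursion is used to improve
    it indefinitely. Each pass gains [2^(q^i)] and loses the constant [c], which is at most
    [(4/3)^(q^i)] for large [i], so [d] may be replaced by [2d/3]. *)
Lemma exp_entire : entire E.
Proof.
pose c := 1 + \sum_(j < r.+1) norm (A j).
have s0 : 0 <= \sum_(j < r.+1) norm (A j) by rewrite sumr_ge0 // => j _; apply: norm_ge0.
have c1 : 1 <= c by rewrite lerDl.
have cA j : norm (A j) <= c.
  case: (ltnP r j) => hj; first by rewrite hA // norm0 (le_trans ler01).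
  rewrite /c ler_wpDl // (bigD1 (Ordinal (hj : (j < r.+1)%N))) //= lerDl sumr_ge0 // => k _.
  exact: norm_ge0.
have pw (d : R) i j : 0 <= d -> (j < i)%N -> norm (E (i - j.+1)%N) <= d ^+ (q ^ (i - j.+1)) ->
    norm (E (i - j.+1)%N) ^+ (q ^ j.+1) <= d ^+ (q ^ i).
  move=> d0 ji h; rewrite -{2}(subnK ji) expnD exprM lerXn2r ?nnegrE ?norm_ge0 ?exprn_ge0 //.
have [|N0 hN0] := expq_unbounded c (b := 2); first by rewrite ltr1n.
have [d d1 hd] : exists2 d : R, 1 <= d & forall i, norm (E i) <= d ^+ (q ^ i).
  have t0 : 0 <= \sum_(j < N0) norm (E j) by rewrite sumr_ge0 // => j _; apply: norm_ge0.
  have t1 : 0 <= norm (E 0%N) := norm_ge0 _.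
  exists (1 + norm (E 0%N) + \sum_(j < N0) norm (E j)); first by rewrite -addrA lerDl addr_ge0.
  set d := _ + _ + _; have d1 : 1 <= d by rewrite /d -addrA lerDl addr_ge0.
  elim/ltn_ind => i IH; case: (posnP i) => [->|i0].
    apply: le_trans (qq_expr_le 0 d1); rewrite /d; lra.
  case: (ltnP i N0) => hi.
    apply: le_trans (qq_expr_le i d1); rewrite /d ler_wpDl ?addr_ge0 //.
    rewrite (bigD1 (Ordinal hi)) //= lerDl sumr_ge0 // => k _; exact: norm_ge0.
  have dd : 0 <= d ^+ (q ^ i) by rewrite exprn_ge0 // (le_trans ler01).
  have := @exp_coef_bound c (d ^+ (q ^ i)) i i0 dd c1 cA.
  have h2 := hN0 _ hi; move=> H; have {}H : norm (E i) * 2 ^+ (q ^ i) <= c * d ^+ (q ^ i).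
    by apply: H => j _ ji; apply: pw ji (IH _ _); rewrite ?(le_trans ler01) //; lia.
  have p0 : 0 < 2 ^+ (q ^ i) :> R by rewrite exprn_gt0.
  rewrite -(ler_pM2r p0); apply: le_trans H _; rewrite mulrC ler_wpM2l //.
have [|N1 hN1] := expq_unbounded c (b := 4%:R / 3%:R); first by lra.
have step k : exists N, forall i, (N <= i)%N -> norm (E i) <= (d * (2 / 3%:R) ^+ k) ^+ (q ^ i).
  elim: k => [|k [N hN]]; first by exists 0%N => i _; rewrite expr0 mulr1.
  exists (maxn N1 (N + r).+1) => i; rewrite geq_max => /andP [hi1 hi2].
  set x := d * (2 / 3%:R) ^+ k in hN *.
  have x0 : 0 <= x.
    by apply: mulr_ge0; [exact: le_trans ler01 d1 | rewrite exprn_ge0 // divr_ge0].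
  have xx : 0 <= x ^+ (q ^ i) by rewrite exprn_ge0.
  have i0 : (0 < i)%N by lia.
  have H : norm (E i) * 2 ^+ (q ^ i) <= c * x ^+ (q ^ i).
    apply: exp_coef_bound => // j jr ji; apply: pw ji (hN _ _) => //; lia.
  have p0 : 0 < 2 ^+ (q ^ i) :> R by rewrite exprn_gt0.
  rewrite -(ler_pM2r p0); apply: le_trans H _.
  rewrite -exprMn.
  have -> : d * (2 / 3%:R) ^+ k.+1 * 2 = (4%:R / 3%:R) * x.
    by rewrite /x exprSr; set z := _ ^+ k; field.
  by rewrite [leRHS]exprMn ler_wpM2r ?hN1.
move=> e e0; have d0 : 0 < d by apply: lt_le_trans d1.
have t0 : 0 <= 2 / 3%:R :> R by rewrite divr_ge0.
have t1 : 2 / 3%:R < 1 :> R by lra.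
have [k hk] := null_geom t0 t1 (divr_gt0 e0 d0).
have [N hN] := step k; exists N => i /hN h; apply: le_trans h _.
have := hk k (leqnn k); rewrite ltr_pdivlMr // mulrC => /ltW h.
by rewrite lerXn2r ?nnegrE ?(ltW e0) ?mulr_ge0 ?exprn_ge0 ?divr_ge0 ?(ltW d0).
Qed.

Lemma op_expM f : op E (thetaT * f) = op A (op E f).
Proof. by rewrite -op_Mconst hE (op_mul _ hA) //; exact: exp_entire. Qed.

End ExpEntire.

(** Coefficientwise [H_i = (theta^(q^i) - theta) F_i], and for [i > 0] the factor has absolute value
    at least 1, so the decay of [H] passes to [F]. *)
Lemma quasi_periodic_entire (H F : S_) : F 0%N = 0 ->
  F * twist_const thetaT - twist_const thetaT * F = H -> entire H -> entire F.
Proof.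
move=> F0 hF; apply: entire_le; exists 1%N => i i1.
rewrite -hF coefSB coefSMc coefScM frob_cst [F i * _]mulrC -mulrBl -rmorphB norm_cstM.
rewrite absv_thetaXB // ler_peMl ?norm_ge0 // exprn_ege1 //; exact/ltW/qR_gt1.
Qed.

Lemma quasi_periodic_theta d (H E F : S_) f : twist_poly d H -> entire E -> entire F ->
  F * twist_const thetaT - twist_const thetaT * F = H * E ->
  op F (thetaT * f) = thetaT * op F f + op H (op E f).
Proof.
move=> hH hE hF e; rewrite -op_Mconst.
have -> : F * twist_const thetaT = twist_const thetaT * F + H * E by rewrite -e addrC subrK.
have hG : entire (twist_const thetaT * F) by apply: (@entire_mul 0) => // -[|k].
by rewrite op_plus ?op_constM ?(op_mul f hH hE) //; apply: entire_mul hH hE.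
Qed.

End Operators.

(** * Coefficients with respect to the last variable *)

Section Slices.
Variables (C : CinfSetting) (s : nat).
Local Notation K := (Kc C).
Local Notation T := (tate_alg C s).
Local Notation T' := (tate_alg C s.+1).
Local Notation R := (Rv C).
Implicit Types (j : nat) (m : 'X_{1..s.+1}) (nu : 'X_{1..s}) (f g : T') (a b : T).

(* [mnm_join j nu] is the exponent of [t^j] times the monomial [nu], [t] being the last variable. *)
Definition mnm_join j nu : 'X_{1..s.+1} :=
  [multinom (if unlift ord_max i is Some i' then nu i' else j) | i < s.+1].
Definition mnm_head m : 'X_{1..s} := [multinom m (widen_ord (leqnSn s) i) | i < s].

Lemma widen_lift (i : 'I_s) : widen_ord (leqnSn s) i = lift ord_max i.
Proof. by apply: val_inj; rewrite /= /bump leqNgt ltn_ord. Qed.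

Lemma mnm_join_max j nu : mnm_join j nu ord_max = j.
Proof. by rewrite mnmE unlift_none. Qed.

Lemma mnm_joinK j nu : mnm_head (mnm_join j nu) = nu.
Proof. by apply/mnmP => i; rewrite !mnmE widen_lift liftK. Qed.

Lemma mnm_headK m : mnm_join (m ord_max) (mnm_head m) = m.
Proof.
apply/mnmP => i; rewrite mnmE; case: unliftP => [i' ->|-> //].
by rewrite mnmE widen_lift.
Qed.

Lemma mdeg_join j nu : mdeg (mnm_join j nu) = (mdeg nu + j)%N.
Proof.
rewrite !mdegE big_ord_recr /= mnm_join_max; congr (_ + _)%N.
by apply: eq_bigr => i _; rewrite widen_lift mnmE liftK.
Qed.

Lemma mnm_join_eq m j nu : (m == mnm_join j nu) = (m ord_max == j) && (mnm_head m == nu).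
Proof.
apply/eqP/andP => [->|[/eqP <- /eqP <-]]; last by rewrite mnm_headK.
by rewrite mnm_join_max mnm_joinK.
Qed.

Lemma muni_coef (F : nzRingType) (p : {mpoly F[s.+1]}) j nu :
  (muni p)`_j@_nu = p@_(mnm_join j nu).
Proof.
rewrite muniE coef_sum raddf_sum /=; transitivity
  (\sum_(m <- msupp p) p@_m * (m == mnm_join j nu)%:R).
  apply: eq_bigr => m _; rewrite coefZ coefXn mnm_join_eq /mnm_head.
  rewrite eq_sym; case: eqP => _ /=; last by rewrite mulr0 mcoeff0 mulr0.
  by rewrite mulr1 mcoeffZ mcoeffX.
case: (boolP (mnm_join j nu \in msupp p)) => h.
  rewrite (bigD1_seq (mnm_join j nu)) //= eqxx mulr1 big1 ?addr0 // => m /negbTE ->.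
  by rewrite mulr0.
rewrite (memN_msupp_eq0 h) big_seq big1 // => m hm.
by case: eqP h => [<-|]; rewrite ?hm // mulr0.
Qed.

Lemma slice_tate f j : tate (fun nu => f (mnm_join j nu) : K).
Proof.
move=> e /(tfunP f) [N hN]; exists N => nu h; apply: hN; rewrite mdeg_join.
exact: leq_trans h (leq_addr _ _).
Qed.
Definition slice f j : T := TateAlg (slice_tate f j).

Lemma coef_slice f j nu : slice f j nu = f (mnm_join j nu). Proof. by []. Qed.
Lemma coef_slices f m : f m = slice f (m ord_max) (mnm_head m).
Proof. by rewrite coef_slice mnm_headK. Qed.

Lemma slice_inj f g : (forall j, slice f j = slice g j) -> f = g.
Proof. by move=> h; apply: tateE => m; rewrite !coef_slices h. Qed.

Lemma sliceD f g j : slice (f + g) j = slice f j + slice g j.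
Proof. exact: tateE. Qed.
Lemma sliceN f j : slice (- f) j = - slice f j.
Proof. exact: tateE. Qed.
Lemma slice0 j : slice 0 j = 0.
Proof. by apply: tateE => m; rewrite coef_slice !coefT0. Qed.
Lemma slice_frob i f j : slice (frob i f) j = frob i (slice f j).
Proof. exact: tateE. Qed.
Lemma slice_sum I (r : seq I) (P : pred I) (F : I -> T') j :
  slice (\sum_(i <- r | P i) F i) j = \sum_(i <- r | P i) slice (F i) j.
Proof. by apply: (big_morph (slice^~ j)) => [f g|]; [exact: sliceD | exact: slice0]. Qed.

Lemma sliceM f g j : slice (f * g) j = \sum_(i < j.+1) slice f i * slice g (j - i).
Proof.
apply: tateE => nu; rewrite coef_slice coefTM coefT_sum.
pose N := (mdeg nu + j).+1.
have F := @agree_trunc _ _ N f; have G := @agree_trunc _ _ N g.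
set P := \sum_m _ in F; set Q := \sum_m _ in G.
rewrite (agreeM F G) ?mdeg_join // -muni_coef muniM coefM raddf_sum.
apply: eq_bigr => i _; rewrite coefTM.
have ag k h p : agree N (tfun h) p -> (k <= j)%N -> agree (mdeg nu).+1 (tfun (slice h k)) (muni p)`_k.
  by move=> hp kj mu hmu; rewrite muni_coef coef_slice hp // mdeg_join /N; lia.
rewrite (agreeM (ag i f P F _) (ag (j - i)%N g Q G _) (ltnSn _)) ?leq_subr //.
by rewrite -ltnS.
Qed.

Lemma slice_null f : null (fun j => norm (slice f j)).
Proof.
move=> e /(tfunP f) [N hN]; exists N => j hj; apply: norm_lt => nu; apply: hN.
by rewrite mdeg_join; apply: leq_trans hj (leq_addl _ _).
Qed.

Lemma norm_slice_le f j : norm (slice f j) <= norm f.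
Proof. by apply: norm_le => nu; rewrite coef_slice norm_coef. Qed.

Lemma unslice_tate (x : nat -> T) : null (fun j => norm (x j)) ->
  tate (fun m => x (m ord_max) (mnm_head m) : K).
Proof.
move=> hx e e0; have [N hN] := hx e e0.
have /choice [M hM] : forall j, exists M, forall nu, (M <= mdeg nu)%N -> absv (x j nu) < e.
  by move=> j; apply: tfunP.
exists (N + \sum_(j < N) M j)%N => m; rewrite -{1}[m]mnm_headK mdeg_join => hm.
case: (ltnP (m ord_max) N) => h; last first.
  by apply: le_lt_trans (norm_coef _ _) (hN _ h).
apply: hM; have : (M (m ord_max) <= \sum_(j < N) M j)%N.
  by rewrite (bigD1 (Ordinal h)) //= leq_addr.
lia.
Qed.

(** Together with [slice_null] and [slice_inj], this identifies [T'] with the power series in [t]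
    whose coefficients in [T] tend to 0. *)
Lemma unslice (x : nat -> T) : null (fun j => norm (x j)) ->
  exists f, forall j, slice f j = x j.
Proof.
move=> hx; exists (TateAlg (unslice_tate hx)) => j.
by apply: tateE => nu; rewrite coef_slice /= mnm_join_max mnm_joinK.
Qed.

Lemma incl_null a : null (fun j => norm (if j == 0%N then a else 0)).
Proof. by move=> e e0; exists 1%N => -[|j] // _; rewrite norm0. Qed.
Definition incl a : T' := TateAlg (unslice_tate (incl_null a)).
Lemma slice_incl a j : slice (incl a) j = if j == 0%N then a else 0.
Proof. by apply: tateE => nu; rewrite coef_slice /= mnm_join_max mnm_joinK. Qed.

Lemma slice_inclM a f j : slice (incl a * f) j = a * slice f j.
Proof.
rewrite sliceM big_ord_recl /= slice_incl subn0 big1 ?addr0 // => i _.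
by rewrite slice_incl mul0r.
Qed.

Lemma incl_is_zmod : zmod_morphism incl.
Proof.
move=> a b; apply: slice_inj => j; rewrite sliceD sliceN !slice_incl.
by case: eqP; rewrite ?subr0.
Qed.
Lemma slice1 j : slice 1 j = if j == 0%N then 1 else 0.
Proof.
apply: tateE => nu; rewrite coef_slice -(rmorph1 (@cst C s.+1)) coefTcst.
case: j => [|j] /=; rewrite /tcst.
  by congr (if _ then _ else _); rewrite -[RHS]mdeg_eq0 -[LHS]mdeg_eq0 mdeg_join addn0.
by rewrite -mdeg_eq0 mdeg_join addnS /=; case: ifP.
Qed.
Lemma incl_is_monoid : monoid_morphism incl.
Proof.
split; first by apply: slice_inj => j; rewrite slice1 slice_incl.
move=> a b; apply: slice_inj => j; rewrite slice_inclM !slice_incl.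
by case: eqP; rewrite ?mulr0.
Qed.
HB.instance Definition _ := GRing.isZmodMorphism.Build T T' incl incl_is_zmod.
HB.instance Definition _ := GRing.isMonoidMorphism.Build T T' incl incl_is_monoid.

Lemma tvar_null : null (fun j => norm (if j == 1%N then 1 : T else 0)).
Proof. by move=> e e0; exists 2%N => -[|[|j]] // _; rewrite norm0. Qed.
Definition tvar : T' := TateAlg (unslice_tate tvar_null).
Lemma slice_tvar j : slice tvar j = if j == 1%N then 1 else 0.
Proof. by apply: tateE => nu; rewrite coef_slice /= mnm_join_max mnm_joinK. Qed.

Lemma slice_tvarMS f j : slice (tvar * f) j.+1 = slice f j.
Proof.
rewrite sliceM big_ord_recl big_ord_recl /= !slice_tvar /= mul0r add0r mul1r subSS subn0.
by rewrite big1 ?addr0 // => i _; rewrite slice_tvar mul0r.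
Qed.
Lemma slice_tvarM0 f : slice (tvar * f) 0 = 0.
Proof. by rewrite sliceM big_ord1 slice_tvar mul0r. Qed.
Lemma slice_tvarM f j : slice (tvar * f) j = if j is j'.+1 then slice f j' else 0.
Proof. by case: j => [|j]; rewrite ?slice_tvarM0 ?slice_tvarMS. Qed.

Definition incl_embc (c : {mpoly (Fq C)[s]}) : T' := incl (embcT c).
Lemma incl_embc_zmod : zmod_morphism incl_embc.
Proof. by move=> c d; rewrite /incl_embc !rmorphB. Qed.
Lemma incl_embc_monoid : monoid_morphism incl_embc.
Proof. by split=> [|c d]; rewrite /incl_embc ?rmorph1 ?rmorphM. Qed.
HB.instance Definition _ := GRing.isZmodMorphism.Build _ T' incl_embc incl_embc_zmod.
HB.instance Definition _ := GRing.isMonoidMorphism.Build _ T' incl_embc incl_embc_monoid.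
Lemma incl_embc_comm : commr_rmorph incl_embc tvar. Proof. by move=> c; apply: mulrC. Qed.

(* The image in [T'] of an element of [A[t_s]] under [theta |-> t]. *)
Definition embt (a : Apoly C s) : T' := (map_poly incl_embc a).[tvar].
HB.instance Definition _ := GRing.RMorphism.copy embt (horner_morph incl_embc_comm).
Lemma embtX : embt 'X = tvar. Proof. exact: (horner_morphX incl_embc_comm). Qed.
Lemma embtC c : embt c%:P = incl (embcT c). Proof. exact: (horner_morphC incl_embc_comm). Qed.

Lemma slice_tvarX i j : slice (tvar ^+ i) j = if j == i then 1 else 0.
Proof.
elim: i j => [|i IH] j; first by rewrite expr0 slice1.
by rewrite exprS slice_tvarM; case: j => [|j]; rewrite ?IH // eqSS IH.
Qed.

Lemma slice_embt (a : Apoly C s) j : slice (embt a) j = embcT a`_j.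
Proof.
rewrite /embt (@horner_coef_wide _ (size a)) ?size_poly // slice_sum.
under eq_bigr => i _ do rewrite coef_map slice_inclM slice_tvarX.
case: (ltnP j (size a)) => h.
  rewrite (bigD1 (Ordinal h)) //= eqxx mulr1 big1 ?addr0 // => i.
  by rewrite -val_eqE /= eq_sym => /negbTE ->; rewrite mulr0.
rewrite nth_default // rmorph0 big1 // => i _; case: eqP => e; last by rewrite mulr0.
by move: h; rewrite e leqNgt ltn_ord.
Qed.

Lemma frob_embt i (a : Apoly C s) : frob i (embt a) = embt a.
Proof. by apply: slice_inj => j; rewrite slice_frob slice_embt frob_embc. Qed.

Lemma embt_muni (c : {mpoly (Fq C)[s.+1]}) : embt (muni c) = embcT c.
Proof.
apply: slice_inj => j; rewrite slice_embt; apply: tateE => nu.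
by rewrite coef_slice !coefT_embc muni_coef.
Qed.

Lemma embt_rational (a : Apoly C s) m : exists x, embt a m = iota C x.
Proof. by rewrite coef_slices slice_embt coefT_embc; eexists. Qed.

End Slices.
Arguments tvar {C s}.

(** * Series with coefficients in [F_q] *)

Section Rational.
Variables (C : CinfSetting) (n : nat).
Local Notation T := (tate_alg C n).

(** Nonzero elements of [F_q] have absolute value 1, so a Tate series with coefficients in [F_q] has
    only finitely many nonzero ones. *)
Lemma rational_embc (f : T) : (forall m, exists x, f m = iota C x) -> exists c, f = embcT c.
Proof.
move=> /choice [x hx]; have [N hN] := tfunP f ltr01.
exists (\sum_(m : 'X_{1..n < N}) x m *: 'X_[m]); apply: tateE => m.
rewrite coefT_embc hx; case: (ltnP (mdeg m) N) => h; first by rewrite mcoeff_mpoly.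
have x0 : x m = 0.
  by apply/eqP; apply: contraT => /absv_iota e; have := hN m h; rewrite hx e ltxx.
rewrite x0 raddf_sum /= big1 ?rmorph0 // => k _.
rewrite mcoeffZ mcoeffX; case: eqP => [e|]; last by rewrite mulr0.
by have := bmdeg k; rewrite e ltnNge h.
Qed.

Lemma frob_fixed_embc (f : T) : frob 1 f = f -> exists c, f = embcT c.
Proof.
move=> h; apply: rational_embc => m; apply: frob_fixed.
by rewrite -{2}h coefT_frob expn1.
Qed.

(** All nonzero coefficients have absolute value 1, so the dominant exponent for the Gauss norm is
    the usual leading monomial. *)
Lemma embc_dominant (c : {mpoly (Fq C)[n]}) : c != 0 ->
  [/\ absv (embcT c (mlead c)) = norm (embcT c), embcT c (mlead c) != 0 &
      forall m, (mlead c < m)%O -> absv (embcT c m) < norm (embcT c)].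
Proof.
move=> nc; have lc : c@_(mlead c) != 0 by rewrite mleadc_eq0.
have n1 : norm (embcT c) = 1.
  apply/eqP; rewrite eq_le norm_le /=; last by move=> m; rewrite absv_iota_le.
  by rewrite -(absv_iota lc); exact: (norm_coef (embcT c)).
split; rewrite ?n1; first by rewrite coefT_embc absv_iota.
  by rewrite coefT_embc fmorph_eq0.
by move=> m /mcoeff_gt_mlead h; rewrite coefT_embc h rmorph0 absv0.
Qed.

Lemma norm_embc_le (c : {mpoly (Fq C)[n]}) : norm (embcT c) <= 1.
Proof. by apply: norm_le => m; rewrite absv_iota_le. Qed.

End Rational.

(** * Division with remainder and Frobenius descent *)

Section Division.
Variables (C : CinfSetting) (n : nat).
Local Notation T := (tate_alg C n).
Local Notation F := (Fq C).
Variable c : {mpoly F[n]}.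
Hypothesis c0 : c != 0.

Let mdiv (p : {mpoly F[n]}) := exists hr : {mpoly F[n]} * {mpoly F[n]},
  p = c * hr.1 + hr.2 /\ forall m, (mlead c <= m)%MM -> hr.2@_m = 0.

Let mdiv_lin (x : F) p p' : mdiv p -> mdiv p' -> mdiv (x *: p + p').
Proof.
move=> [[h r] /= [e hr]] [[h' r'] /= [e' hr']].
exists (x *: h + h', x *: r + r') => /=; split; last first.
  by move=> m hm; rewrite mcoeffD mcoeffZ hr // hr' // mulr0 addr0.
by rewrite e e' mulrDr scalerDr -scalerAr addrACA.
Qed.

(** If [mlead c] divides [X^m], a multiple of [c] with leading term [X^m] is subtracted. What is
    left involves smaller monomials only, and the monomial order is well-founded. *)
Lemma mpoly_division m : mdiv 'X_[m].
Proof.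
elim/(@ltmwf n): m => m IH; have mdiv0 : mdiv 0.
  by exists (0, 0); rewrite /= mulr0 addr0; split=> // k _; rewrite mcoeff0.
have mdiv_supp p : (forall k, k \in msupp p -> (k < m)%O) -> mdiv p.
  move=> hp; rewrite [p]mpolyE big_seq; apply: (big_ind mdiv) => // [x y hx hy|k hk].
    by rewrite -[x]scale1r; apply: mdiv_lin.
  by rewrite -[_ *: _]addr0; apply: mdiv_lin => //; apply: IH; apply: hp.
case: (boolP (mlead c <= m)%MM) => hm; last first.
  exists (0, 'X_[m]); rewrite /= mulr0 add0r; split=> // k hk.
  by rewrite mcoeffX; case: eqP => // e; rewrite e hk in hm.
pose a := (mleadc c)^-1; have la : mleadc c != 0 by rewrite mleadc_eq0.
pose d : {mpoly F[n]} := c * (a *: 'X_[m - mlead c]).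
have dX : mdiv d.
  exists (a *: 'X_[m - mlead c], 0); rewrite /= addr0; split=> // k _; exact: mcoeff0.
have nX : a *: 'X_[m - mlead c] != 0 :> {mpoly F[n]}.
  by rewrite -mleadc_eq0 mleadcZE mleadXm mcoeffX eqxx mulr1 invr_eq0.
have ld : mlead d = m.
  by rewrite mleadM // mleadZ ?invr_eq0 // mleadXm addmC submK.
have cd : d@_m = 1.
  have e : m = (mlead c + mlead (a *: 'X_[m - mlead c] : {mpoly F[n]}))%MM.
    by rewrite mleadZ ?invr_eq0 // mleadXm addmC submK.
  by rewrite [in X in _@_X]e mleadcM mleadcZE mleadXm mcoeffX eqxx mulr1 mulfV.
rewrite -['X_[m]](subrK d) -[_ - _]scale1r; apply: mdiv_lin => //.
apply: mdiv_supp => k; rewrite mcoeff_msupp mcoeffB mcoeffX.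
apply: contraNT; rewrite -leNgt le_eqVlt => /orP [/eqP <-|mk]; first by rewrite eqxx cd subrr.
by rewrite lt_eqF //= sub0r mcoeff_gt_mlead ?ld ?oppr0.
Qed.

Lemma tends_coef0 (u : nat -> T) l m : (forall k, u k m = 0) -> tends u l -> l m = 0.
Proof.
move=> h hl; apply/eqP; rewrite -absv_eq0 eq_le absv_ge0 andbT leNgt; apply/negP => lp.
have [N hN] := hl _ lp; have := hN N (leqnn N).
rewrite ltNge; apply/negP/negPn; rewrite -[absv (l m)]absvN -[- l m]add0r -(h N).
exact: norm_coef (u N - l) m.
Qed.

(* Division with remainder extends from monomials by continuity: quotients and remainders of
   monomials have norm at most 1, their coefficients being in [F_q]. *)
Lemma tate_division (f : T) : exists h r : T, f = embcT c * h + r /\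
  forall m, (mlead c <= m)%MM -> r m = 0.
Proof.
have /choice [hr hhr] := mpoly_division.
(* Grouping the monomials by total degree makes the expansion of [f] a series indexed by
   integers. *)
pose u (y : 'X_{1..n} -> {mpoly F[n]}) k : T :=
  \sum_(m : 'X_{1..n < k.+1} | mdeg m == k) cst n (f m) * embcT (y m).
have uc y : null (fun k => norm (u y k)).
  move=> e e0; have [N hN] := tfunP f e0; exists N => k hk.
  apply: norm_sum_lt => // m /eqP hm; rewrite norm_cstM.
  apply: le_lt_trans (hN m _); last by rewrite hm.
  by rewrite ler_piMr ?absv_ge0 ?norm_embc_le.
have [h hh] := series_conv (uc (fun m => (hr m).1)).
have [r hr'] := series_conv (uc (fun m => (hr m).2)).
have hf : tends (fun N => \sum_(k < N) u (fun m => 'X_[m]) k) f.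
  move=> e e0; have [N hN] := tfunP f e0; exists N => k hk.
  apply: norm_lt => m; rewrite coefTB coefT_sum.
  have hu j : u (fun m => 'X_[m]) j m = if j == mdeg m then f m else 0.
    rewrite coefT_sum; transitivity
      (\sum_(l : 'X_{1..n < j.+1} | (mdeg l == j) && (bmnm l == m)) f m).
      rewrite [RHS]big_mkcondr; apply: eq_bigr => l _.
      rewrite coefTcstM coefT_embc mcoeffX; case: eqP => [->|_].
        by rewrite rmorph1 mulr1.
      by rewrite rmorph0 mulr0.
    case: eqP => [e1|ne]; last first.
      by rewrite big_pred0 // => l; apply/negP => /andP [/eqP e2 /eqP e1]; apply: ne; rewrite -e1.
    have mj : (mdeg m < j.+1)%N by rewrite e1.
    rewrite (big_pred1 (BMultinom mj)) // => l; rewrite /= bmeqP /=.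
    by apply/andP/eqP => [[_ /eqP]|->]; rewrite ?e1.
  case: (ltnP (mdeg m) k) => hm.
    rewrite (bigD1 (Ordinal hm)) //= hu eqxx big1 ?addr0 ?subrr ?absv0 // => i.
    by rewrite -val_eqE /= hu => /negbTE ->.
  rewrite big1 ?sub0r ?absvN ?hN //; first exact: leq_trans hk hm.
  by move=> i _; rewrite hu ltn_eqF // (leq_trans (ltn_ord i)).
exists h, r; split.
  apply: tends_uniq hf _; apply: tends_eq (tendsD (tendsMl (embcT c) hh) hr').
  exists 0%N => N _; rewrite mulr_sumr -big_split; apply: eq_bigr => k _ /=.
  rewrite mulr_sumr -big_split; apply: eq_bigr => m _ /=.
  by rewrite mulrCA -mulrDr -rmorphM -rmorphD; case: (hhr m) => <-.
move=> m hm; apply: tends_coef0 hr' => N; rewrite coefT_sum big1 // => k _.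
rewrite coefT_sum big1 // => l _; rewrite coefTcstM coefT_embc.
by case: (hhr l) => _ ->; rewrite // rmorph0 mulr0.
Qed.

End Division.

(** * Vectors over [F_q] in closed Frobenius-stable spaces *)

Section Descent.
Variables (C : CinfSetting) (n r : nat).
Local Notation K := (Kc C).
Local Notation T := (tate_alg C n).
Local Notation V := 'cV[T]_r.
Local Notation q := (qq C).
Variables (N : V -> Prop) (S : 'X_{1..n} -> Prop).
Hypothesis ND : forall c d, N c -> N d -> N (c + d).
Hypothesis NZ : forall (a : K) c, N c -> N (cst n a *: c).
Hypothesis NF : forall c, N c -> N (map_mx (frob 1) c).
Hypothesis NL : forall (u : nat -> V) (l : V), (forall k, N (u k)) ->
  (forall i, tends (fun k => u k i 0) (l i 0)) -> N l.

Let supp (c : V) := forall i m, c i 0 m != 0 -> S m.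

Lemma vec_neq0P (c : V) : c != 0 -> exists i m, c i 0 m != 0.
Proof.
move=> nc; apply: contrapT => h; move/eqP: nc; apply; apply/matrixP => i j.
rewrite ord1 mxE; apply: tateE => m; rewrite coefT0; apply/eqP/negPn/negP => h1.
by apply: h; exists i, m.
Qed.

Lemma frob_iter_mem i c : N c -> N (map_mx (frob i) c).
Proof.
elim: i => [|i IH] hc.
  by rewrite (_ : map_mx _ _ = c) //; apply/matrixP => k l; rewrite mxE frob_id.
rewrite (_ : map_mx _ _ = map_mx (frob 1) (map_mx (frob i) c)); first exact/NF/IH.
by apply/matrixP => k l; rewrite !mxE frob_comp.
Qed.

(* Applying powers of Frobenius to a vector of norm 1 makes its small coefficients tend to 0
   and the others to the roots of unity in their residue classes. *)
Lemma descent_finite c : N c -> c != 0 -> supp c ->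
  exists c' : V, [/\ N c', c' != 0, supp c' &
    exists D, forall i m, (D <= mdeg m)%N -> c' i 0 m = 0].
Proof.
move=> Nc nc sc; have [i0 [m0 h0]] := vec_neq0P nc.
have [/= i1 _ hi1] := @arg_maxP _ _ _ i0 xpredT (fun i => norm (c i 0)) isT.
have ci1 : c i1 0 != 0.
  rewrite -norm_gt0 (lt_le_trans _ (hi1 i0 isT)) // norm_gt0.
  by apply: contraNneq h0 => ->; rewrite coefT0.
have [m1 [hm1 nm1 _]] := norm_dominant ci1.
(* The division is by a coefficient of largest absolute value in the whole vector: [d] has norm at
   most 1 and a coefficient equal to 1, which keeps the limit nonzero. *)
pose d := cst n (c i1 0 m1)^-1 *: c.
have Nd : N d by exact: NZ.
have dE i m : d i 0 m = (c i1 0 m1)^-1 * c i 0 m by rewrite mxE coefTcstM.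
have d1 i : norm (d i 0) <= 1.
  rewrite mxE norm_cstM absvV hm1 mulrC ler_pdivrMr ?norm_gt0 // mul1r; exact: (hi1 i isT).
have dm1 : d i1 0 m1 = 1 by rewrite dE mulVf.
have sd : supp d by move=> i m; rewrite dE mulf_eq0 negb_or => /andP [_ /sc].
have /choice [D0 hD0] : forall i, exists D, forall m, (D <= mdeg m)%N -> absv (d i 0 m) < 1.
  by move=> i; exact: (tfunP (d i 0) ltr01).
pose D := \max_i D0 i.
have hD i m : (D <= mdeg m)%N -> absv (d i 0 m) < 1.
  by move=> h; apply: hD0; apply: leq_trans h; apply: leq_bigmax.
(* To each coefficient belong a representative of its residue class fixed by a power of Frobenius
   and the exponent of that power. Small coefficients must get 0, so that the representatives form
   Tate series. *)
have tz (p : 'I_r * 'X_{1..n}) : exists ze : K * nat, [/\ absv (d p.1 0 p.2 - ze.1) < 1,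
    (0 < ze.2)%N, ze.1 ^+ (q ^ ze.2) = ze.1 & absv (d p.1 0 p.2) < 1 -> ze.1 = 0].
  case: (ltP (absv (d p.1 0 p.2)) 1) => h.
    by exists (0, 1%N); split; rewrite /= ?subr0 ?frob0.
  have [z hz [e e0 he]] := residue_algebraic (le_trans (norm_coef _ _) (d1 p.1) : absv (d p.1 0 p.2) <= 1).
  by exists (z, e); split=> //; rewrite ltNge h.
have /choice [ze hze] := tz.
have z0 i m : absv (d i 0 m) < 1 -> (ze (i, m)).1 = 0 by case: (hze (i, m)).
have zt i : tate (fun m => (ze (i, m)).1 : K).
  move=> e e0; exists D => m hm; rewrite z0 ?absv0 //; exact: hD.
pose c' : V := \col_i TateAlg (zt i).
(* A common period of the representatives: those in degree at least [D] are 0, so finitely many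
   periods are multiplied. *)
pose e := \prod_(p : 'I_r * 'X_{1..n < D}) (ze (p.1, bmnm p.2)).2.
have e0 : (0 < e)%N by rewrite prodn_gt0 // => p; case: (hze (p.1, bmnm p.2)).
have ez (x : K) a b : (a %| b)%N -> x ^+ (q ^ a) = x -> x ^+ (q ^ b) = x.
  move=> /dvdnP [k ->] hx; elim: k => [|k IH]; first by rewrite mul0n expn0 expr1.
  by rewrite mulSn expnD exprM hx IH.
have hfix i : frob e (c' i 0) = c' i 0.
  rewrite mxE; apply: tateE => m; rewrite coefT_frob /=.
  case: (ltnP (mdeg m) D) => hm; last by rewrite z0 ?frob0 // hD.
  apply: (ez _ (ze (i, m)).2); last by case: (hze (i, m)).
  by rewrite /e (bigD1 (i, BMultinom hm)) //= dvdn_mulr.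
have hlt i : norm (d i 0 - c' i 0) < 1.
  by apply: norm_lt => m; rewrite coefTB [c' i 0]mxE; case: (hze (i, m)).
exists c'; split.
- apply: (NL (u := fun k => map_mx (frob (e * k)) d)) => [k|i]; first exact: frob_iter_mem.
  apply: null_le (null_geom (norm_ge0 _) (hlt i)); exists 0%N => k _ /=.
  have hk : frob (e * k) (c' i 0) = c' i 0.
    elim: k => [|k IH]; first by rewrite muln0 frob_id.
    by rewrite mulnS -frob_comp IH.
  rewrite mxE -{1}hk -rmorphB norm_frob ler_wiXn2l ?norm_ge0 ?(ltW (hlt i)) //.
  by apply: leq_trans (ltnW (ltn_qqX C (e * k))); rewrite leq_pmull.
- apply: contraTneq isT => /matrixP /(_ i1 0); rewrite !mxE => /(congr1 (fun f : T => f m1)).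
  rewrite coefT0 /= => h; have [+ _ _ _] := hze (i1, m1).
  by rewrite h subr0 /= dm1 absv1 ltxx.
- move=> i m; rewrite mxE /= => nz; apply: (sd i); apply: contraNneq nz => h.
  by rewrite z0 // h absv0 ltr01.
- by exists D => i m hm; rewrite mxE /= z0 // hD.
Qed.

(** Once a coefficient of [b] is normalised to 1, the vector [b^(1) - b] lies in [N] and has smaller
    support. If it vanishes, [b] is over [F_q]; otherwise induction on the size of the support
    applies. The predicate [S] keeps track of the permitted exponents, so that remainders stay
    remainders. *)
Lemma descent c : N c -> c != 0 -> supp c ->
  exists c' : V, [/\ N c', c' != 0, supp c' & forall i m, exists x, c' i 0 m = iota C x].
Proof.
move=> Nc nc sc; have [d [Nd nd sd [D hD]]] := descent_finite Nc nc sc.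
pose size_ (b : V) := #|[set p : 'I_r * 'X_{1..n < D} | b p.1 0 p.2 != 0]|.
have [k] := ubnP (size_ d); elim: k d Nd nd sd hD => // k IH d Nd nd sd hD hk.
have [i0 [m0 h0]] := vec_neq0P nd.
pose b := cst n (d i0 0 m0)^-1 *: d.
have bE i m : b i 0 m = (d i0 0 m0)^-1 * d i 0 m by rewrite mxE coefTcstM.
have Nb : N b by exact: NZ.
have sb : supp b by move=> i m; rewrite bE mulf_eq0 negb_or => /andP [_ /sd].
have b0 : b i0 0 m0 = 1 by rewrite bE mulVf.
have hb i m : (D <= mdeg m)%N -> b i 0 m = 0 by move=> h; rewrite bE (hD i m h) mulr0.
pose g := map_mx (frob 1) b - b.
have gE i m : g i 0 m = b i 0 m ^+ q - b i 0 m by rewrite !mxE coefTB coefT_frob expn1.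
have [g0|ng] := eqVneq g 0.
  exists b; split=> //; first by apply: contra_eq_neq b0 => ->; rewrite mxE coefT0 eq_sym oner_neq0.
  move=> i m; apply: frob_fixed; apply/eqP; rewrite -subr_eq0 -gE g0 mxE coefT0.
  exact: eqxx.
have sgb i m : g i 0 m != 0 -> b i 0 m != 0.
  by apply: contraNneq => h; rewrite gE h expr0n gtn_eqF ?qq_gt0 // subrr.
apply: (IH g) => //.
- by apply: ND; [exact: NF | rewrite -scaleN1r -(rmorphN1 (@cst C n)); exact: NZ].
- by move=> i m /sgb /sb.
- by move=> i m hm; rewrite gE hb // expr0n gtn_eqF ?qq_gt0 // subrr.
apply: (@leq_trans (size_ d)); last by rewrite -ltnS.
apply: proper_card.
have m0D : (mdeg m0 < D)%N by rewrite ltnNge; apply: contraNN h0 => /(hD i0) ->.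
apply/properP; split; first apply/subsetP => p.
  by rewrite !inE => /sgb; rewrite bE mulf_eq0 negb_or => /andP [].
exists (i0, BMultinom m0D); rewrite !inE //=.
by rewrite gE b0 expr1n subrr eqxx.
Qed.

End Descent.

Section TateLemmas.
Variables (C : CinfSetting) (n : nat).
Local Notation T := (tate_alg C n).

Lemma null_sum (I : finType) (F : I -> nat -> Rv C) :
  (forall i, null (F i)) -> null (fun k => \sum_i F i k).
Proof.
move=> hF e e0; have n0 : 0 < e / #|I|.+1%:R by rewrite divr_gt0 // ltr0n.
have /choice [M hM] : forall i, exists N, forall k, (N <= k)%N -> F i k < e / #|I|.+1%:R.
  by move=> i; apply: hF.
exists (\max_i M i) => k hk.
apply: (@le_lt_trans _ _ (\sum_(i : I) e / #|I|.+1%:R)).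
  by apply: ler_sum => i _; apply/ltW/hM; apply: leq_trans hk; apply: leq_bigmax.
have -> : \sum_(i : I) e / #|I|.+1%:R = e / #|I|.+1%:R * #|I|%:R.
  by rewrite sumr_const mulr_natr.
rewrite -mulrA gtr_pMr // mulrC ltr_pdivrMr ?ltr0n // mul1r.
by rewrite ltr_nat.
Qed.

(** Multiplicativity of the norm makes the quotients [y_k] a Cauchy sequence; hence the ideal
    generated by [g] is closed. *)
Lemma tends_divide (g : T) (y : nat -> T) l : g != 0 -> tends (fun k => g * y k) l ->
  exists2 y', tends y y' & l = g * y'.
Proof.
move=> ng h; have gp : 0 < norm g by rewrite norm_gt0.
have [y' hy] : exists y', tends y y'.
  apply: tate_complete => e e0; have [N hN] := h (norm g * e) (mulr_gt0 gp e0).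
  exists N => k hk; rewrite -(ltr_pM2l gp) -normM mulrBr.
  rewrite -[g * y k.+1](subrK l) -addrA; apply: norm_ltD; first by apply: hN; rewrite ltnW.
  by rewrite -normN opprB; apply: hN.
by exists y' => //; apply: tends_uniq h _; apply: tendsMl.
Qed.

(* [e] is the infinite product of the [1 + h^(i)]. *)
Lemma frob_product (h : T) : norm h < 1 -> exists2 e : T, e != 0 & frob 1 e * (1 + h) = e.
Proof.
move=> h1; pose p k := \prod_(i < k) (1 + frob i h).
have n1 i : norm (1 + frob i h) = 1.
  rewrite normDr norm1 // norm_frob; apply: le_lt_trans (h1).
  by rewrite -[leRHS]expr1 ler_wiXn2l ?norm_ge0 ?qqX_gt0 ?(ltW h1).
have np k : norm (p k) = 1.
  elim: k => [|k IH]; first by rewrite /p big_ord0 norm1.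
  by rewrite /p big_ord_recr /= normM IH n1 mulr1.
have [e he] : exists e, tends p e.
  apply: tate_complete; apply: (null_expq h1) => k; first exact: norm_ge0.
  by rewrite /p big_ord_recr /= -/(p k) mulrDr mulr1 addrAC subrr add0r normM np mul1r norm_frob.
exists e.
  apply/eqP => e0; have [N hN] := he 1 ltr01; have := hN N (leqnn N).
  by rewrite e0 subr0 np ltxx.
apply: (@tends_uniq _ _ (fun k => p (k + 1)%N)); last exact: tends_shift.
rewrite mulrC; apply: tends_eq (tendsMl _ (tends_frob 1 he)); exists 0%N => k _.
rewrite addn1 /p big_ord_recl frob_id rmorph_prod; congr (_ * _).
apply: eq_bigr => i _; rewrite rmorphD rmorph1 /=; congr (_ + _).
by rewrite frob_comp.
Qed.

Lemma root_qq1 (a : Kc C) : a != 0 -> exists2 b, b != 0 & b ^+ (qq C).-1 = a.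
Proof.
move=> na; have q1 : (0 < (qq C).-1)%N by rewrite -ltnS prednK ?qq_gt1 ?qq_gt0.
have /closed_rootP [b hb] : size ('X^((qq C).-1) - a%:P) != 1%N.
  by rewrite size_XnsubC // eqSS -lt0n.
have e : b ^+ (qq C).-1 = a.
  by move: hb; rewrite /root hornerD hornerN hornerXn hornerC subr_eq0 => /eqP.
by exists b => //; apply: contraNneq na => b0; rewrite -e b0 expr0n gtn_eqF.
Qed.

End TateLemmas.

(** * Evaluation at theta *)

Section Evaluation.
Variables (C : CinfSetting) (s : nat).
Local Notation T := (tate_alg C s).
Local Notation T' := (tate_alg C s.+1).
Local Notation q := (qq C).
Implicit Types f g : T'.

Lemma ev1_conv f : exists l, tends (fun N => \sum_(i < N) slice f i) l.
Proof. exact: series_conv (slice_null f). Qed.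

(* Evaluation at [t = 1]. *)
Definition ev1 f : T := sval (cid (ev1_conv f)).
Lemma ev1P f : tends (fun N => \sum_(i < N) slice f i) (ev1 f).
Proof. by rewrite /ev1; case: cid. Qed.

Lemma ev1D f g : ev1 (f + g) = ev1 f + ev1 g.
Proof.
apply: tends_uniq (ev1P _) _; apply: tends_eq (tendsD (ev1P f) (ev1P g)).
by exists 0%N => N _; rewrite -big_split; apply: eq_bigr => i _; rewrite sliceD.
Qed.

Lemma ev1_0 : ev1 0 = 0.
Proof.
apply: tends_uniq (ev1P _) _; apply: tends_eq (tends_cst 0).
by exists 0%N => N _; rewrite big1 // => i _; rewrite slice0.
Qed.

Lemma ev1_1 : ev1 1 = 1.
Proof.
apply: tends_uniq (ev1P _) _; apply: tends_eq (tends_cst 1).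
exists 1%N => -[|N] // _; rewrite big_ord_recl slice1 big1 ?addr0 // => i _.
by rewrite slice1.
Qed.

(** The partial sum of the Cauchy product differs from [P f N] times [ev1 g] by the sum of the
    [f_i (P g (N - i) - ev1 g)]. In each term either [i] is large, and [f_i] is small, or [N - i] is
    large, and the second factor is small; an ultrametric sum needs no more. *)
Lemma ev1M f g : ev1 (f * g) = ev1 f * ev1 g.
Proof.
pose P h N : T := \sum_(i < N) slice h i.
have hu : tends (fun N => P (f * g) N - P f N * ev1 g) 0.
  have -> : (fun N => P (f * g) N - P f N * ev1 g) =
      fun N => \sum_(i < N) slice f i * (P g (N - i)%N - ev1 g).
    apply/funext => N; rewrite /P mulr_suml.
    under [X in X - _]eq_bigr do rewrite sliceM.
    rewrite (sum_triangle (fun i j => slice f i * slice g j)) -sumrB.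
    by apply: eq_bigr => i _; rewrite mulrBr mulr_sumr.
  have [G G0 hG] : exists2 G : Rv C, 0 < G & forall N, norm (P g N - ev1 g) <= G.
    exists (norm g + norm (ev1 g) + 1); first by rewrite ltr_wpDl ?addr_ge0 ?norm_ge0.
    have g0 := norm_ge0 g; have g1 := norm_ge0 (ev1 g).
    move=> N; apply: norm_leB; last by lra.
    apply: norm_sum_le => [|i _]; first by lra.
    by apply: le_trans (norm_slice_le g i) _; lra.
  apply/tends0P => e e0; have [M hM] := slice_null f (divr_gt0 e0 G0).
  have F0 : 0 < norm f + 1 by rewrite ltr_wpDl ?norm_ge0.
  have [M' hM'] := ev1P g (divr_gt0 e0 F0).
  exists (M + M')%N => N hN; apply: norm_sum_lt => // i _; rewrite normM.
  case: (leqP M i) => hi.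
    apply: le_lt_trans (ler_wpM2l (norm_ge0 _) (hG _)) _.
    by rewrite -ltr_pdivlMr // hM.
  apply: le_lt_trans (ler_wpM2r (norm_ge0 _) (norm_slice_le f i)) _.
  apply: le_lt_trans (_ : (norm f + 1) * norm (P g (N - i)%N - ev1 g) < _).
    by rewrite ler_wpM2r ?norm_ge0 // lerDl.
  by rewrite mulrC -ltr_pdivlMr // hM' //; lia.
apply/eqP; rewrite -subr_eq0; apply/eqP.
apply: tends_uniq hu; apply: tendsB; first exact: ev1P.
by rewrite mulrC; apply: tends_eq (tendsMl (ev1 g) (ev1P f)); exists 0%N => N _; rewrite mulrC.
Qed.

(* [scaled f g] says that [g] is [f(theta t)], so that [ev1 g] is the value of [f] at [t = theta]. *)
Definition scaled f g := forall k, slice g k = cst s (theta C ^+ k) * slice f k.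

Lemma scaled_exists f : null (fun k => q%:R ^+ k * norm (slice f k)) -> exists g, scaled f g.
Proof.
move=> h; have [|g hg] := @unslice _ _ (fun k => cst s (theta C ^+ k) * slice f k).
  by apply: null_le h; exists 0%N => k _; rewrite norm_cstM absvX absv_thetaq.
by exists g.
Qed.

Lemma scaledM f g f' g' : scaled f f' -> scaled g g' -> scaled (f * g) (f' * g').
Proof.
move=> hf hg k; rewrite !sliceM mulr_sumr; apply: eq_bigr => i _.
rewrite hf hg mulrACA -rmorphM -exprD subnKC //; by rewrite -ltnS.
Qed.

Lemma scaled_sum I (r : seq I) (F G : I -> T') : (forall i, scaled (F i) (G i)) ->
  scaled (\sum_(i <- r) F i) (\sum_(i <- r) G i).
Proof. by move=> h k; rewrite !slice_sum mulr_sumr; apply: eq_bigr => i _; rewrite h. Qed.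

Lemma scaled_uniq f g g' : scaled f g -> scaled f g' -> g = g'.
Proof. by move=> h h'; apply: slice_inj => k; rewrite h h'. Qed.

Lemma scaled0 : scaled 0 0.
Proof. by move=> k; rewrite !slice0 mulr0. Qed.
Lemma scaled1 : scaled 1 1.
Proof. by move=> k; rewrite !slice1; case: eqP => [->|]; rewrite ?mulr0 // rmorph1 mulr1. Qed.

(** For small [z] one has [c z^q <= c z^2 <= z / q^2]. Thus [z_(k+1) <= c z_(k+1)^q] forces
    [z_(k+1) = 0], and the other alternative divides [z_k] by [q^2], more than the factor [q] gained
    by [q^k]. *)
Lemma frob_decay (z : nat -> Rv C) (c : Rv C) : 0 < c -> (forall k, 0 <= z k) -> null z ->
  (forall k, z k.+1 <= c * Num.max (z k.+1 ^+ q) (z k ^+ q)) -> null (fun k => q%:R ^+ k * z k).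
Proof.
move=> c0 z0 hz hrec; have Q0 := qR_gt0 C; have Q1 := qR_gt1 C; set Q : Rv C := q%:R in Q0 Q1 *.
have QQ : 0 < Q * Q by rewrite mulr_gt0.
have [|N hN] := hz (Num.min 1 (c * (Q * Q))^-1).
  by rewrite lt_min ltr01 invr_gt0 mulr_gt0.
have small k : (N <= k)%N -> c * z k ^+ q <= z k / (Q * Q).
  move=> /hN; rewrite lt_min => /andP [h1 h2].
  apply: (@le_trans _ _ (c * z k ^+ 2)).
    by rewrite ler_wpM2l ?(ltW c0) // ler_wiXn2l ?qq_gt1 ?(ltW h1).
  rewrite expr2 mulrCA ler_wpM2l // mulrC -ler_pdivlMr //.
  by apply: le_trans (ltW h2) _; rewrite [leLHS]invfM mulrC.
have step k : (N <= k)%N -> z k.+1 <= z k / (Q * Q).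
  move=> hk; have := hrec k; rewrite maxr_pMr ?(ltW c0) // le_max => /orP [h|h].
    have h2 := le_trans h (small k.+1 (leqW hk)).
    have : z k.+1 <= 0.
      rewrite leNgt; apply/negP => zp; move: h2; rewrite ler_pdivlMr //.
      by rewrite ger_pMr // leNgt => /negP; apply; nra.
    by move=> h3; apply: le_trans h3 _; rewrite divr_ge0 // ltW.
  exact: le_trans h (small k hk).
have bound k : Q ^+ (k + N) * z (k + N)%N <= Q ^+ N * z N * Q^-1 ^+ k.
  elim: k => [|k IH]; first by rewrite add0n expr0 mulr1.
  rewrite addSn !exprS; apply: (@le_trans _ _ (Q * Q ^+ (k + N) * (z (k + N)%N / (Q * Q)))).
    by rewrite ler_wpM2l ?step ?leq_addl // mulr_ge0 ?exprn_ge0 ?ltW.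
  have -> : Q * Q ^+ (k + N) * (z (k + N)%N / (Q * Q)) = (Q ^+ (k + N) * z (k + N)%N) / Q.
    by field; rewrite gt_eqF.
  have -> : Q ^+ N * z N * (Q^-1 * Q^-1 ^+ k) = (Q ^+ N * z N * Q^-1 ^+ k) / Q by ring.
  by rewrite ler_wpM2r // invr_ge0 ltW.
have g : null (fun k => Q ^+ N * z N * Q^-1 ^+ k).
  apply: null_cM (null_geom _ _) => [|k||].
  - by rewrite mulr_ge0 ?exprn_ge0 ?(ltW Q0).
  - by rewrite exprn_ge0 // invr_ge0 ltW.
  - by rewrite invr_ge0 ltW.
  by rewrite invf_lt1.
move=> e e0; have [M hM] := g e e0; exists (M + N)%N => k hk.
have -> : k = (k - N + N)%N by lia.
by apply: le_lt_trans (bound _) _; apply: hM; lia.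
Qed.

End Evaluation.

(** * Anderson generating functions and the period matrix *)

Section Lattice.
Variables (C : CinfSetting) (s p : nat).
Local Notation K := (Kc C).
Local Notation T := (tate_alg C s).
Local Notation T' := (tate_alg C s.+1).
Local Notation R := (Rv C).
Local Notation q := (qq C).
Local Notation r := p.+1.
Variables (A E : twist C s) (B : T).
Hypotheses (hA : twist_poly r A) (A0 : A 0%N = thetaT) (hB : A r * B = 1).
Hypotheses (E0 : E 0%N = 1) (hE : E * twist_const thetaT = A * E).

Let Eent : entire E. Proof. exact: exp_entire hA A0 hE. Qed.

Definition thetaVn k : T := cst s ((theta C) ^- k).

Lemma thetaVnS k : thetaT * thetaVn k.+1 = thetaVn k.
Proof.
rewrite /thetaVn -rmorphM /=; congr (cst _ _).
by rewrite exprS invfM mulrA mulfV ?theta_neq0 // mul1r.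
Qed.

Lemma norm_thetaVn k : norm (thetaVn k) = q%:R ^- k.
Proof. by rewrite norm_cst absvV absvX absv_thetaq. Qed.

Lemma thetaVn_neq0 k : thetaVn k != 0.
Proof. by rewrite -norm_eq0 norm_thetaVn invr_eq0 expf_eq0 gt_eqF ?qR_gt0 ?andbF. Qed.

Lemma null_thetaVn (f : T) : null (fun k => norm (thetaVn k * f)).
Proof.
have q1 := qR_gt1 C; have q0 := qR_gt0 C.
apply: null_le (null_cM (norm_ge0 f) _ (@null_geom C q%:R^-1 _ _)) => [|k||].
- by exists 0%N => k _; rewrite normM norm_thetaVn mulrC exprVn.
- by rewrite exprn_ge0 // invr_ge0 ltW.
- by rewrite invr_ge0 ltW.
by rewrite invf_lt1.
Qed.

(** For [f] in the lattice these form a compatible system of division points: [phi_theta] maps each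
    one to its predecessor and the one of index 0 to 0. *)
Definition division_point (f : T) k := op E (thetaVn k.+1 * f).

Lemma division_point_step f k : op A (division_point f k.+1) = division_point f k.
Proof. by rewrite -(op_expM hA A0 hE) mulrA thetaVnS. Qed.

Lemma division_point0 f : op A (division_point f 0) = op E f.
Proof.
by rewrite -(op_expM hA A0 hE) mulrA thetaVnS /thetaVn expr0 invr1 rmorph1 mul1r.
Qed.

Lemma division_point_norm f :
  exists N, forall k, (N <= k)%N -> norm (division_point f k) = norm (thetaVn k.+1 * f).
Proof.
have [d d0 hd] := op_near_id Eent E0.
have [N hN] := null_thetaVn f d0; exists N => k hk.
by apply: (op_isometry hd); apply/ltW/hN; rewrite ltnW.
Qed.

Lemma division_point_null f : null (fun k => norm (division_point f k)).
Proof.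
have [N hN] := division_point_norm f.
apply: null_le (null_shift 1 (null_thetaVn f)); exists N => k /hN ->.
by rewrite addn1.
Qed.

(* The Anderson generating function of [f], in the new variable [t]. *)
Definition agf (f : T) : T' := TateAlg (unslice_tate (division_point_null f)).

Lemma slice_agf f k : slice (agf f) k = division_point f k.
Proof. by apply: tateE => nu; rewrite coef_slice /= mnm_join_max mnm_joinK. Qed.

Lemma agfD f g : agf (f + g) = agf f + agf g.
Proof.
by apply: slice_inj => k; rewrite sliceD !slice_agf /division_point mulrDr opD.
Qed.

Lemma agf0 : agf 0 = 0.
Proof. by apply: slice_inj => k; rewrite slice0 slice_agf /division_point mulr0 op0. Qed.

Lemma agf_embc c f : agf (embcT c * f) = incl (embcT c) * agf f.
Proof.
apply: slice_inj => k; rewrite slice_inclM !slice_agf /division_point mulrCA.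
exact: op_embc.
Qed.

Lemma agf_theta f : op E f = 0 -> agf (thetaT * f) = tvar * agf f.
Proof.
move=> hf; apply: slice_inj => -[|k].
  by rewrite slice_tvarM0 slice_agf /division_point mulrCA mulrA thetaVnS /thetaVn expr0 invr1 rmorph1 mul1r.
by rewrite slice_tvarMS !slice_agf /division_point mulrCA mulrA thetaVnS.
Qed.

Lemma lattice_emb (a : Apoly C s) f : op E f = 0 ->
  op E (embT a * f) = 0 /\ agf (embT a * f) = embt a * agf f.
Proof.
move=> hf; elim/poly_ind: a => [|a c [IH1 IH2]].
  by rewrite !rmorph0 !mul0r op0 agf0.
rewrite !rmorphD !rmorphM /= embTX embTC embtX embtC !mulrDl.
rewrite opD // op_embc // hf mulr0 addr0 agfD agf_embc.
rewrite ![_ * thetaT]mulrC ![_ * tvar]mulrC -!mulrA (op_expM hA A0 hE) IH1 op0.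
by rewrite agf_theta // IH2.
Qed.

Lemma agf_inj0 f : agf f = 0 -> f = 0.
Proof.
move=> h; have [N hN] := division_point_norm f; have := hN N (leqnn N).
rewrite -slice_agf h slice0 norm0 => /esym/eqP; rewrite norm_eq0 mulf_eq0.
by rewrite (negbTE (thetaVn_neq0 _)) => /eqP.
Qed.

Definition agf_equation (y : T') := \sum_(j < r.+1) incl (A j) * frob j y = tvar * y.

Lemma agf_equation_slice y : agf_equation y <->
  (forall k, op A (slice y k) = if k is k'.+1 then slice y k' else 0).
Proof.
have e k : op A (slice y k) = slice (\sum_(j < r.+1) incl (A j) * frob j y) k.
  rewrite (op_poly _ hA) slice_sum; apply: eq_bigr => j _.
  by rewrite slice_inclM slice_frob.
split=> [h k|h]; first by rewrite e h slice_tvarM.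
by apply: slice_inj => k; rewrite -e h slice_tvarM.
Qed.

Lemma agf_solution f : op E f = 0 -> agf_equation (agf f).
Proof.
move=> hf; apply/agf_equation_slice => -[|k]; rewrite !slice_agf.
  by rewrite division_point0.
exact: division_point_step.
Qed.

(* Since [exp] is invertible near 0, the coefficients of high degree of a solution are of the
   form [exp(f / theta^(k+1))]. *)
Lemma agf_solution_inv y : agf_equation y -> exists2 f, op E f = 0 & y = agf f.
Proof.
move=> /agf_equation_slice hy; have [d d0 hd] := op_near_id Eent E0.
have q0 := qR_gt0 C; have q1 := qR_gt1 C.
(* The radius [d / q] leaves room for multiplication by [theta]: [theta l_(k+1)] still lies in the
   ball of radius [d], where [exp] is injective. *)
have [N hN] := slice_null y (divr_gt0 d0 q0).
have dq : d / q%:R <= d by rewrite ler_pdivrMr // ler_peMr ?(ltW d0) ?(ltW q1).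
have /choice [l hl] : forall k, exists l, (N <= k)%N -> norm l <= d / q%:R /\ op E l = slice y k.
  move=> k; case: (leqP N k) => hk; last by exists 0.
  have [l l1 l2] := op_surj Eent d0 hd (le_trans (ltW (hN k hk)) dq).
  exists l => _; split=> //; rewrite -(op_isometry hd l1) l2 ltW // hN //.
have step k : (N <= k)%N -> thetaT * l k.+1 = l k.
  move=> hk; have [a1 a2] := hl k hk; have [b1 b2] := hl k.+1 (leqW hk).
  apply/eqP; rewrite -subr_eq0; apply/eqP; apply: (op_inj0 hd).
    apply: norm_leB; last exact: le_trans a1 dq.
    by rewrite normM norm_theta mulrC -ler_pdivlMr.
  by rewrite opD // opN // (op_expM hA A0 hE) b2 hy a2 subrr.
pose f := cst s (theta C ^+ N.+1) * l N.
have hf k : thetaVn (N + k).+1 * f = l (N + k)%N.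
  elim: k => [|k IH].
    rewrite addn0 /f /thetaVn mulrA -rmorphM /= mulVf ?rmorph1 ?mul1r //.
    by rewrite expf_neq0 // theta_neq0.
  have th0 : (thetaT : T) != 0 by rewrite -norm_eq0 norm_theta gt_eqF.
  apply: (mulfI th0); rewrite mulrA thetaVnS addnS IH step ?leq_addr //.
have hx k : slice y k = division_point f k.
  case: (leqP N k) => hk.
    by rewrite /division_point -(subnKC hk) hf; case: (hl (N + (k - N))%N (leq_addr _ _)).
  (* Below [N] the argument descends from [N]: on both sides, [phi_theta] maps the coefficient of
     index [k + 1] to the one of index [k]. *)
  have [i] : exists i, (k + i = N)%N by exists (N - k)%N; rewrite subnKC // ltnW.
  elim: i k {hk} => [|i IH] k.
    rewrite addn0 => ->; rewrite /division_point -[in RHS](addn0 N) hf addn0.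
    by case: (hl N (leqnn N)).
  by rewrite addnS -addSn => /IH h; rewrite -division_point_step -h hy.
exists f; last by apply: slice_inj => k; rewrite slice_agf hx.
by rewrite -division_point0 -hx hy.
Qed.

(* The companion matrix of the equation [phi_theta y = t y] *)
Definition companion : 'M[T']_r := \matrix_(j, k)
  if (j < p)%N then (k == j.+1 :> nat)%:R
  else incl B * (if k == 0 :> nat then tvar - incl thetaT else - incl (A k)).

Definition frob_vec (y : T') : 'cV[T']_r := \col_j frob j y.

Lemma incl_AB : incl (A r) * incl B = 1.
Proof. by rewrite -rmorphM hB rmorph1. Qed.

Lemma companion_row_last (Y : 'cV[T']_r) :
  (companion *m Y) ord_max 0 = incl B * (tvar * Y 0 0 - \sum_(k < r) incl (A k) * Y k 0).
Proof.
rewrite mxE big_ord_recl [in RHS]big_ord_recl /= !mxE ltnn eqxx /= A0 -mulrA.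
rewrite opprD addrA -mulrBl mulrDr; congr (_ + _).
rewrite -sumrN mulr_sumr; apply: eq_bigr => k _.
by rewrite !mxE ltnn /= -mulrA mulNr.
Qed.

Lemma companion_row_lt (Y : 'cV[T']_r) (j : 'I_r) (jp : (j < p)%N) :
  (companion *m Y) j 0 = Y (Ordinal (jp : (j.+1 < r)%N)) 0.
Proof.
rewrite mxE (bigD1 (Ordinal (jp : (j.+1 < r)%N))) //= !mxE jp eqxx mul1r big1 ?addr0 // => k.
by rewrite -val_eqE /= => /negbTE h; rewrite !mxE jp h mul0r.
Qed.

Lemma frob_vec_companion y : agf_equation y ->
  map_mx (frob 1) (frob_vec y) = companion *m frob_vec y.
Proof.
move=> hy; apply/matrixP => j k; rewrite ord1 {k}.
case: (ltnP j p) => jp.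
  by rewrite (companion_row_lt _ jp) !mxE frob_comp.
have -> : j = ord_max by apply: val_inj => /=; have := ltn_ord j; lia.
rewrite companion_row_last !mxE frob_comp add1n frob_id.
under eq_bigr do rewrite mxE.
move: hy; rewrite /agf_equation big_ord_recr /= => <-.
by rewrite addrAC subrr add0r mulrA [incl B * _]mulrC incl_AB mul1r.
Qed.

Lemma companion_fixed (Y : 'cV[T']_r) : map_mx (frob 1) Y = companion *m Y ->
  agf_equation (Y 0 0) /\ Y = frob_vec (Y 0 0).
Proof.
move=> hY.
have hj j (jr : (j < r)%N) : Y (Ordinal jr) 0 = frob j (Y 0 0).
  elim: j jr => [|j IH] jr.
    by rewrite frob_id; congr (Y _ 0); apply: val_inj.
  have jp : (j < p)%N by [].
  have jr' : (j < r)%N by exact: ltnW.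
  have := congr1 (fun M : 'cV[T']_r => M (Ordinal jr') 0) hY.
  rewrite (@companion_row_lt Y (Ordinal jr') jp) mxE IH frob_comp add1n => ->.
  by congr (Y _ 0); apply: val_inj.
have hv : Y = frob_vec (Y 0 0).
  by apply/matrixP => -[j jr] k; rewrite ord1 hj mxE.
split=> //; have := congr1 (fun M : 'cV[T']_r => M ord_max 0) hY.
rewrite companion_row_last mxE [Y ord_max 0]hj frob_comp add1n => h.
rewrite /agf_equation big_ord_recr /= h mulrA incl_AB mul1r addrC.
rewrite [X in _ - X](eq_bigr (fun k : 'I_r => incl (A k) * frob k (Y 0 0))) ?subrK //.
by move=> [k kr] _; rewrite hj.
Qed.

Lemma det_companion : \det companion = (-1) ^+ p * (incl B * (tvar - incl thetaT)).
Proof.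
rewrite (expand_det_col _ 0) (bigD1 ord_max) //= big1 ?addr0 => [|j jm]; last first.
  have jp : (j < p)%N by have := ltn_ord j; move: jm; rewrite -val_eqE /=; lia.
  by rewrite mxE jp mul0r.
rewrite mxE ltnn eqxx /cofactor addn0 (_ : row' _ _ = 1%:M) ?det1 ?mulr1 1?mulrC //.
apply/matrixP => i j; rewrite !mxE /= /bump leq0n !add1n eqSS.
by rewrite [(p <= i)%N]leqNgt ltn_ord /= add0n ltn_ord eq_sym.
Qed.

(** As [|theta| > 1], the geometric series with terms [- theta^-(k+1) t^k] belongs to [T']. *)
Lemma tvar_theta_unit : exists w : T', (tvar - incl thetaT) * w = 1.
Proof.
have nx : null (fun k => norm (- thetaVn k.+1)).
  apply: null_le (null_shift 1 (null_thetaVn 1)); exists 0%N => k _.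
  by rewrite normN mulr1 addn1.
have [w hw] := unslice nx; exists w; apply: slice_inj => -[|k].
  rewrite mulrBl sliceD sliceN slice_tvarM0 slice_inclM hw slice1 mulrN opprK add0r.
  by rewrite thetaVnS /thetaVn expr0 invr1 rmorph1.
rewrite mulrBl sliceD sliceN slice_tvarMS slice_inclM !hw slice1 mulrN opprK.
by rewrite thetaVnS addNr.
Qed.

Lemma det_companion_unit : exists w, \det companion * w = 1.
Proof.
have [w hw] := tvar_theta_unit; exists ((-1) ^+ p * (incl (A r) * w)).
rewrite det_companion mulrACA -exprMn mulrNN mulr1 expr1n mul1r.
by rewrite mulrACA [incl B * _]mulrC incl_AB mul1r.
Qed.

Lemma companion_unit : companion \in unitmx.
Proof.
have [w hw] := det_companion_unit; rewrite unitmxE; apply/unitrP; exists w.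
by rewrite mulrC hw.
Qed.

(** * The period matrix of a basis of the lattice *)

Variable b : 'I_r -> T.
Hypothesis b_lattice : forall i, op E (b i) = 0.
Hypothesis b_gen : forall f, op E f = 0 -> exists c : 'I_r -> Apoly C s, f = \sum_i embT (c i) * b i.
Hypothesis b_free : forall c : 'I_r -> Apoly C s, \sum_i embT (c i) * b i = 0 -> forall i, c i = 0.

Lemma agf_comb (c : 'I_r -> Apoly C s) :
  agf (\sum_i embT (c i) * b i) = \sum_i embt (c i) * agf (b i).
Proof.
rewrite (big_morph agf agfD agf0); apply: eq_bigr => i _.
by case: (lattice_emb (c i) (b_lattice i)).
Qed.

Definition Upsilon : 'M[T']_r := \matrix_(j, i) frob j (agf (b i)).

Lemma Upsilon_frob : map_mx (frob 1) Upsilon = companion *m Upsilon.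
Proof.
apply/matrixP => j i.
have := congr1 (fun M : 'cV[T']_r => M j 0) (frob_vec_companion (agf_solution (b_lattice i))).
rewrite !mxE => ->; apply: eq_bigr => k _; congr (_ * _).
by rewrite !mxE.
Qed.

Lemma Upsilon_embt (c : 'I_r -> Apoly C s) :
  Upsilon *m (\col_i embt (c i)) = frob_vec (agf (\sum_i embT (c i) * b i)).
Proof.
apply/matrixP => j k; rewrite !mxE agf_comb rmorph_sum; apply: eq_bigr => i _.
by rewrite !mxE rmorphM /= frob_embt mulrC.
Qed.

Lemma tends_mulmx (M : 'M[T']_r) (u : nat -> 'cV[T']_r) (l : 'cV[T']_r) :
  (forall i, tends (fun k => u k i 0) (l i 0)) ->
  forall i, tends (fun k => (M *m u k) i 0) ((M *m l) i 0).
Proof.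
move=> h i; rewrite mxE.
apply: tends_eq (tends_sum _ (fun j _ => tendsMl (M i j) (h j))).
by exists 0%N => k _; rewrite mxE.
Qed.

Lemma Upsilon_map_frob (c : 'cV[T']_r) :
  companion *m (Upsilon *m map_mx (frob 1) c) = map_mx (frob 1) (Upsilon *m c).
Proof. by rewrite mulmxA -Upsilon_frob -map_mxM. Qed.

Lemma rational_embt (x : T') : (forall m, exists a, x m = iota C a) ->
  exists a : Apoly C s, x = embt a.
Proof. by move=> /rational_embc [c ->]; exists (muni c); rewrite embt_muni. Qed.

(** A zero determinant over the domain [T'] yields a kernel vector. The kernel is closed and
    Frobenius-stable, so descent makes the vector polynomial over [F_q], and it becomes an
    [A[t_s]]-linear relation between the [b_i]. *)
Lemma det_Upsilon_neq0 : \det Upsilon != 0.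
Proof.
apply/negP => /eqP; rewrite -det_tr => /eqP /det0P [v nv hv].
pose N (c : 'cV[T']_r) := Upsilon *m c = 0.
have Nv : N v^T by rewrite /N -[Upsilon]trmxK -trmx_mul hv trmx0.
have nv' : v^T != 0 by rewrite -trmx0 (inj_eq trmx_inj).
have [|||||c' [Nc' nc' _ hc']] := @descent C s.+1 r N (fun _ => True) _ _ _ _ v^T Nv nv'.
- by move=> c d hc hd; rewrite /N mulmxDr hc hd addr0.
- by move=> a c hc; rewrite /N -scalemxAr hc scaler0.
- move=> c hc; apply: (can_inj (mulKmx companion_unit)).
  by rewrite Upsilon_map_frob hc map_mx0 mulmx0.
- move=> u l hu hl; apply/matrixP => i j; rewrite ord1 [RHS]mxE.
  apply: (@tends_uniq _ _ (fun k => (Upsilon *m u k) i 0)); first exact: tends_mulmx.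
  by apply: tends_eq (tends_cst 0); exists 0%N => k _; rewrite hu mxE.
- by [].
have /choice [a ha] : forall i, exists a : Apoly C s, c' i 0 = embt a.
  by move=> i; apply: rational_embt.
have ec : c' = \col_i embt (a i) by apply/matrixP => i j; rewrite ord1 mxE ha.
move/eqP: nc'; apply; move: Nc'; rewrite /N ec Upsilon_embt => h.
have a0 : forall i, a i = 0.
  apply: b_free; apply: agf_inj0; have := congr1 (fun M : 'cV[T']_r => M 0 0) h.
  by rewrite !mxE frob_id.
by apply/matrixP => i j; rewrite !mxE a0 rmorph0.
Qed.

Lemma Upsilon_inj (x : 'cV[T']_r) : Upsilon *m x = 0 -> x = 0.
Proof.
move=> h; have := congr1 (mulmx (\adj Upsilon)) h.
rewrite mulmxA mul_adj_mx mulmx0 mul_scalar_mx => e; apply/matrixP => i j.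
have /eqP := congr1 (fun M : 'cV[T']_r => M i j) e.
by rewrite !mxE mulf_eq0 (negbTE det_Upsilon_neq0) => /eqP.
Qed.

(* With [u := det companion = a(1 + h)], [|h| < 1], [be^(q-1) = a] and [e] the infinite product of
   the [1 + h^(i)], the relation [(det Upsilon)^(1) = u det Upsilon] says that
   [be^-1 e det Upsilon] is fixed by Frobenius. *)
Lemma det_Upsilon_rational : exists2 c : {mpoly (Fq C)[s.+1]}, c != 0 &
  exists e : T', embcT c = \det Upsilon * e.
Proof.
have [w hw] := det_companion_unit; have [a na ha] := unit_dominant_const hw.
pose h := cst s.+1 a^-1 * \det companion - 1.
have h1 : norm h < 1.
  have -> : h = cst s.+1 a^-1 * (\det companion - cst s.+1 a).
    by rewrite mulrBr -rmorphM mulVf // rmorph1.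
  by rewrite norm_cstM absvV mulrC ltr_pdivrMr ?mul1r ?absv_gt0.
have [e ne he] := frob_product h1.
have [be nbe hbe] := root_qq1 na.
have [c hc] : exists c, \det Upsilon * (cst s.+1 be^-1 * e) = embcT c.
  apply: frob_fixed_embc; rewrite !rmorphM /= frob_cst -det_map_mx Upsilon_frob det_mulmx.
  have -> : cst s.+1 (be^-1 ^+ (q ^ 1)) = cst s.+1 be^-1 * cst s.+1 a^-1.
    by rewrite -rmorphM -hbe expn1 -invfM -exprS prednK ?qq_gt0 // exprVn.
  rewrite -[in RHS]he /h [1 + _]addrC subrK; ring.
exists c; last by exists (cst s.+1 be^-1 * e).
rewrite -(inj_eq (@embcT_inj C s.+1)) rmorph0 -hc !mulf_neq0 ?det_Upsilon_neq0 //.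
by rewrite -norm_eq0 norm_cst absvV invr_eq0 absv_eq0.
Qed.

(** Since [c] and [x] are fixed by Frobenius, [y] satisfies the same difference equation as the
    columns of [Upsilon]. It therefore comes from a lattice element, and the coordinates of that
    element, which exist because the [b_i] generate, are the quotients. *)
Lemma rational_quotient (c : {mpoly (Fq C)[s.+1]}) (x : 'cV[T']_r) (y : 'cV[T']_r) : c != 0 ->
  (forall i m, exists a, x i 0 m = iota C a) -> Upsilon *m x = embcT c *: y ->
  exists a : 'I_r -> Apoly C s, x = embcT c *: \col_i embt (a i).
Proof.
move=> nc hx hxy.
have nG : embcT c != 0 by rewrite -(rmorph0 (@embcT C s.+1)) (inj_eq (@embcT_inj C s.+1)).
have cancelG (u v : 'cV[T']_r) : embcT c *: u = embcT c *: v -> u = v.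
  move=> e; apply/matrixP => i j; apply: (mulfI nG).
  by have := congr1 (fun M : 'cV[T']_r => M i j) e; rewrite !mxE.
have xfix : map_mx (frob 1) x = x.
  apply/matrixP => i j; rewrite ord1 mxE; apply: tateE => m; rewrite coefT_frob.
  by have [a ->] := hx i m; rewrite iotaX.
have hy : map_mx (frob 1) y = companion *m y.
  apply: cancelG; rewrite scalemxAr -hxy mulmxA -Upsilon_frob -{1}xfix -map_mxM hxy.
  by apply/matrixP => i j; rewrite !mxE rmorphM /= frob_embc.
have [sol ey] := companion_fixed hy.
have [f hf ef] := agf_solution_inv sol; have [a ha] := b_gen hf.
exists a; apply/eqP; rewrite -subr_eq0; apply/eqP; apply: Upsilon_inj.
by rewrite mulmxBr hxy -scalemxAr Upsilon_embt -ha -ef -ey subrr.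
Qed.

(* The saturation of [c T'^r] with respect to [Upsilon] is [c T'^r] itself: otherwise the
   remainders modulo [c] would, by descent, contain a nonzero rational vector. *)
Lemma Upsilon_saturated (c : {mpoly (Fq C)[s.+1]}) (x y : 'cV[T']_r) : c != 0 ->
  Upsilon *m x = embcT c *: y -> exists z, x = embcT c *: z.
Proof.
move=> nc hxy.
have nG : embcT c != 0 by rewrite -(rmorph0 (@embcT C s.+1)) (inj_eq (@embcT_inj C s.+1)).
have /choice [hr hhr] : forall i, exists hr : T' * T', x i 0 = embcT c * hr.1 + hr.2 /\
    forall m, (mlead c <= m)%MM -> hr.2 m = 0.
  by move=> i; have [h [w hw]] := tate_division nc (x i 0); exists (h, w).
pose h : 'cV[T']_r := \col_i (hr i).1; pose w : 'cV[T']_r := \col_i (hr i).2.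
have xE : x = embcT c *: h + w.
  by apply/matrixP => i j; rewrite ord1 !mxE; case: (hhr i).
have [w0|nw] := eqVneq w 0; first by exists h; rewrite xE w0 addr0.
pose N (u : 'cV[T']_r) := exists v : 'cV[T']_r, Upsilon *m u = embcT c *: v.
have Nw : N w.
  exists (y - Upsilon *m h); rewrite scalerBr -hxy {1}xE mulmxDr -scalemxAr.
  by rewrite addrAC subrr add0r.
have sw i m : w i 0 m != 0 -> ~ (mlead c <= m)%MM.
  by rewrite mxE => nz hm; move/eqP: nz; apply; case: (hhr i) => _; apply.
have [||||w' [Nw' nw' sw' hw']] := @descent C s.+1 r N (fun m => ~ (mlead c <= m)%MM) _ _ _ _ w Nw nw sw.
- by move=> u u' [v hv] [v' hv']; exists (v + v'); rewrite mulmxDr hv hv' scalerDr.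
- move=> a u [v hv]; exists (cst s.+1 a *: v).
  by rewrite -scalemxAr hv !scalerA mulrC.
- move=> u [v hv]; exists (invmx companion *m map_mx (frob 1) v).
  apply: (can_inj (mulKmx companion_unit)); rewrite Upsilon_map_frob hv scalemxAr mulKVmx ?companion_unit //.
  by apply/matrixP => i j; rewrite !mxE rmorphM /= frob_embc.
- move=> u l /choice [v hv] hl.
  have /choice [v' hv'] : forall i, exists v', (Upsilon *m l) i 0 = embcT c * v'.
    move=> i; have [|v' _ hv'] := @tends_divide C s.+1 (embcT c) (fun k => v k i 0) ((Upsilon *m l) i 0) nG.
      apply: tends_eq (tends_mulmx Upsilon hl i); exists 0%N => k _.
      by rewrite hv mxE.
    by exists v'.
  by exists (\col_i v' i); apply/matrixP => i j; rewrite ord1 hv' !mxE.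
have [y' hy'] := Nw'; have [a ha] := rational_quotient nc hw' hy'.
have [i [m hm]] := vec_neq0P nw'.
have nai : embt (a i) != 0.
  by apply: contraNneq hm => e; rewrite ha !mxE e mulr0 coefT0.
have [d hd] := rational_embc (embt_rational (a i)).
have nd : d != 0 by apply: contraNneq nai => d0; rewrite hd d0 rmorph0.
(* The product of [c] with the polynomial [d] has a nonzero coefficient at [mlead c + mlead d], an
   exponent from which remainders are excluded. *)
have [c1 c2 c3] := embc_dominant nc; have [d1 d2 d3] := embc_dominant nd.
have := norm_dominantM c2 d2 c1 d1 c3 d3 => e.
case: (sw' i (mlead c + mlead d)%MM); last by apply/mnm_lepP => k; rewrite mnmDE leq_addr.
rewrite -absv_eq0 ha !mxE hd e mulf_eq0 !norm_eq0 (negbTE nG) /=.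
by rewrite -hd.
Qed.

(** [Upsilon] times [e] times its adjugate is the scalar matrix [c]. By saturation each column of
    [e] times the adjugate is divisible by [c], and the quotients form the inverse. *)
Lemma Upsilon_invertible : exists Z, Upsilon *m Z = 1%:M.
Proof.
have [c nc [e he]] := det_Upsilon_rational.
have nG : embcT c != 0 by rewrite -(rmorph0 (@embcT C s.+1)) (inj_eq (@embcT_inj C s.+1)).
have hadj : Upsilon *m (e *: \adj Upsilon) = (embcT c)%:M.
  by rewrite -scalemxAr mul_mx_adj scale_scalar_mx he mulrC.
have /choice [z hz] : forall j, exists z : 'cV[T']_r, col j (e *: \adj Upsilon) = embcT c *: z.
  move=> j; apply: (@Upsilon_saturated c _ (col j 1%:M) nc).
  by rewrite !colE mulmxA hadj mul1mx mul_scalar_mx.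
exists (\matrix_(i, j) z j i 0).
have eZ : e *: \adj Upsilon = embcT c *: \matrix_(i, j) z j i 0.
  apply/matrixP => i j; have := congr1 (fun M : 'cV[T']_r => M i 0) (hz j).
  by rewrite !mxE.
apply/matrixP => i j; apply: (mulfI nG).
have := congr1 (fun M : 'M[T']_r => M i j) hadj.
by rewrite eZ -scalemxAr !mxE => ->; case: eqP; rewrite ?mulr1 ?mulr0.
Qed.

Lemma companion_slice j k i : (1 < i)%N -> slice (companion j k) i = 0.
Proof.
case: i => [|[|i]] // _; rewrite mxE; case: ifP => _.
  by case: (_ == _); rewrite ?slice0 ?slice1.
rewrite slice_inclM; case: ifP => _.
  by rewrite sliceD sliceN slice_tvar slice_incl subr0 mulr0.
by rewrite sliceN slice_incl oppr0 mulr0.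
Qed.

(* The inverse [Z] of [Upsilon] satisfies [Z = Z^(1) Phi], so its entries are entire in [t]. *)
Lemma Upsilon_inverse_entire (Z : 'M[T']_r) : Upsilon *m Z = 1%:M ->
  forall i j, null (fun k => q%:R ^+ k * norm (slice (map_mx (frob 1) Z i j) k)).
Proof.
move=> hZ.
have ZE : Z = map_mx (frob 1) Z *m companion.
  have h1 : map_mx (frob 1) Z *m map_mx (frob 1) Upsilon = 1%:M.
    by rewrite -map_mxM (mulmx1C hZ) map_mx1.
  by rewrite -[LHS]mul1mx -h1 Upsilon_frob -!mulmxA hZ mulmx1.
pose z k : R := \sum_i \sum_j norm (slice (Z i j) k).
have z0 k : 0 <= z k by rewrite sumr_ge0 // => i _; rewrite sumr_ge0 // => j _; apply: norm_ge0.
have zle i j k : norm (slice (Z i j) k) <= z k.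
  rewrite /z (bigD1 i) //= (bigD1 j) //= -addrA lerDl addr_ge0 // sumr_ge0 // => *.
    exact: norm_ge0.
  by rewrite sumr_ge0 // => *; apply: norm_ge0.
have hz : null z.
  by apply: null_sum => i; apply: null_sum => j; apply: slice_null.
pose D := 1 + \sum_i \sum_j norm (companion i j).
have D0 : 0 <= \sum_i \sum_j norm (companion i j).
  by rewrite sumr_ge0 // => i _; rewrite sumr_ge0 // => j _; apply: norm_ge0.
have Dp : 0 < D by rewrite ltr_wpDr.
have Dle i j : norm (companion i j) <= D.
  rewrite /D ler_wpDl // (bigD1 i) //= (bigD1 j) //= -addrA lerDl addr_ge0 // sumr_ge0 // => *.
    exact: norm_ge0.
  by rewrite sumr_ge0 // => *; apply: norm_ge0.
have bound i j k : norm (slice (Z i j) k.+1) <= D * Num.max (z k.+1 ^+ q) (z k ^+ q).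
  have m0 : 0 <= Num.max (z k.+1 ^+ q) (z k ^+ q) by rewrite le_max exprn_ge0.
  rewrite ZE mxE slice_sum; apply: norm_sum_le => [|l _]; first by rewrite mulr_ge0 // ltW.
  rewrite sliceM; apply: norm_sum_le => [|n _]; first by rewrite mulr_ge0 // ltW.
  rewrite normM mxE slice_frob norm_frob expn1.
  (* The companion matrix has degree at most 1 in [t], so only the slices [k] and [k + 1] of [Z^(1)]
     contribute. *)
  have [hn|hn] := leqP (k.+1 - n) 1; last first.
    by rewrite companion_slice // norm0 mulr0 mulr_ge0 // ltW.
  rewrite mulrC ler_pM ?norm_ge0 ?exprn_ge0 ?norm_ge0 //.
    exact: le_trans (norm_slice_le _ _) (Dle l j).
  rewrite le_max; have : (n == k.+1 :> nat) || (n == k :> nat) by have := ltn_ord n; lia.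
  case/orP => /eqP ->.
    by rewrite lerXn2r ?nnegrE ?norm_ge0 ?z0 ?zle.
  by rewrite [X in _ || X]lerXn2r ?nnegrE ?norm_ge0 ?z0 ?zle ?orbT.
pose D' : R := (r * r)%:R * D.
have hrec k : z k.+1 <= D' * Num.max (z k.+1 ^+ q) (z k ^+ q).
  rewrite /D' -mulrA natrM -mulrA.
  apply: (@le_trans _ _ (\sum_(i < r) \sum_(j < r) D * Num.max (z k.+1 ^+ q) (z k ^+ q))).
    by apply: ler_sum => i _; apply: ler_sum => j _.
  by rewrite !sumr_const !card_ord !mulr_natl.
have Dp' : 0 < D' by rewrite mulr_gt0 // ltr0n.
have hd := frob_decay Dp' z0 hz hrec.
move=> i j; apply: null_le hd; have [N hN] := hz 1 ltr01; exists N => k /hN zk.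
rewrite ler_wpM2l ?exprn_ge0 ?ler0n // mxE slice_frob norm_frob expn1.
apply: (@le_trans _ _ (z k ^+ q)); first by rewrite lerXn2r ?nnegrE ?norm_ge0 ?zle.
by rewrite -[leRHS]expr1 ler_wiXn2l ?qq_gt0 // ltW.
Qed.

(** The slices of a generating function decay like [q^-k], and Frobenius raises their norms to a
    power at least 2, which outweighs [|theta|^k = q^k]. *)
Lemma Upsilon_frob_decay i j :
  null (fun k => q%:R ^+ k * norm (slice (map_mx (frob 1) Upsilon i j) k)).
Proof.
have Q0 := qR_gt0 C; have Q1 := qR_gt1 C; set Q : R := q%:R in Q0 Q1 *.
have [N hN] := division_point_norm (b j).
have [M hM] := null_shift 1 (null_thetaVn (b j)) ltr01.
have g : null (fun k => norm (b j) ^+ 2 * Q^-1 ^+ k).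
  apply: null_cM (null_geom _ _) => [|k||].
  - by rewrite exprn_ge0 ?norm_ge0.
  - by rewrite exprn_ge0 // invr_ge0 ltW.
  - by rewrite invr_ge0 ltW.
  by rewrite invf_lt1.
apply: null_le g; exists (maxn N M) => k; rewrite geq_max => /andP [h1 h2].
rewrite !mxE frob_comp slice_frob norm_frob slice_agf hN //.
have h3 : norm (thetaVn k.+1 * b j) <= 1 by have := hM k h2; rewrite addn1 => /ltW.
have e2 : (2 <= q ^ (1 + i))%N.
  by apply: leq_trans (qq_gt1 C) _; rewrite expnD expn1 leq_pmulr // qqX_gt0.
apply: (@le_trans _ _ (Q ^+ k * norm (thetaVn k.+1 * b j) ^+ 2)).
  by rewrite ler_wpM2l ?exprn_ge0 ?(ltW Q0) // ler_wiXn2l ?norm_ge0.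
rewrite normM norm_thetaVn exprMn mulrA [X in X <= _]mulrC.
rewrite ler_wpM2l ?exprn_ge0 ?norm_ge0 // -!exprVn exprAC expr2 exprMn mulrA.
have -> : Q ^+ k * Q^-1 ^+ k.+1 = Q^-1.
  by rewrite exprS mulrCA -exprMn mulfV ?gt_eqF // expr1n mulr1.
rewrite exprS mulrA -[leRHS]mul1r ler_wpM2r ?exprn_ge0 ?invr_ge0 ?(ltW Q0) //.
by rewrite -invfM invf_le1 ?mulr_gt0 // -[leLHS]mul1r ler_pM // ltW.
Qed.

(* [M] is the value at [t = theta] of [Upsilon^(1)]. *)
Lemma period_matrix : exists M W : 'M[T]_r, W *m M = 1%:M /\ forall j i : 'I_r,
  tends (fun N => \sum_(k < N) cst s (theta C ^+ k) * frob j.+1 (division_point (b i) k)) (M j i).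
Proof.
have [Z hZ] := Upsilon_invertible.
have /choice [U hU] : forall ij, exists U, scaled (map_mx (frob 1) Upsilon ij.1 ij.2) U.
  by move=> ij; apply: scaled_exists; apply: Upsilon_frob_decay.
have /choice [V hV] : forall ij, exists V, scaled (map_mx (frob 1) Z ij.1 ij.2) V.
  by move=> ij; apply: scaled_exists; apply: Upsilon_inverse_entire.
exists (\matrix_(i, j) ev1 (U (i, j))), (\matrix_(i, j) ev1 (V (i, j))); split.
  have h1 : map_mx (frob 1) Z *m map_mx (frob 1) Upsilon = 1%:M.
    by rewrite -map_mxM (mulmx1C hZ) map_mx1.
  apply/matrixP => i j; rewrite mxE.
  transitivity (ev1 (\sum_k V (i, k) * U (k, j))).
    rewrite (big_morph (@ev1 C s) (@ev1D C s) (@ev1_0 C s)); apply: eq_bigr => k _.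
    by rewrite ev1M !mxE.
  have hs : scaled ((map_mx (frob 1) Z *m map_mx (frob 1) Upsilon) i j) (\sum_k V (i, k) * U (k, j)).
    rewrite mxE; apply: scaled_sum => k; exact: (scaledM (hV (i, k)) (hU (k, j))).
  move: hs; rewrite h1 mxE [in RHS]mxE; case: eqP => _ hs.
    by rewrite (scaled_uniq hs (@scaled1 C s)) ev1_1.
  by rewrite (scaled_uniq hs (@scaled0 C s)) ev1_0.
move=> j i; rewrite mxE; apply: tends_eq (ev1P _); exists 0%N => N _.
apply: eq_bigr => k _; rewrite (hU (j, i)) /= !mxE frob_comp slice_frob slice_agf.
by rewrite add1n.
Qed.

(** Iterating [F(theta f) = theta F(f) + H(exp f)] gives [F(b) = theta^N F(b / theta^N)] plus the
    terms [theta^k H(exp(b / theta^(k+1)))] for [k < N]. Having no constant term, [F] is at least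
    quadratically small near 0, so the first summand tends to 0. *)
Lemma quasi_periodic_eval (H F : twist C s) (i : 'I_r) (M : 'M[T]_r) :
  (forall j : 'I_r, tends (fun N => \sum_(k < N) cst s (theta C ^+ k) *
    frob j.+1 (division_point (b i) k)) (M j i)) ->
  H 0%N = 0 -> twist_poly r H -> F 0%N = 0 ->
  F * twist_const thetaT - twist_const thetaT * F = H * E ->
  op F (b i) = \sum_(j < r) H j.+1 * M j i.
Proof.
move=> hM H0 hH F0 hF.
have HE := entire_mul hH Eent; have Fent := quasi_periodic_entire F0 hF HE.
have step f := quasi_periodic_theta f hH Eent Fent hF.
have iter N : op F (b i) = cst s (theta C ^+ N) * op F (thetaVn N * b i) +
    \sum_(k < N) cst s (theta C ^+ k) * op H (division_point (b i) k).
  elim: N => [|N ->].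
    by rewrite big_ord0 addr0 /thetaVn expr0 invr1 rmorph1 !mul1r.
  rewrite big_ord_recr /= addrA addrAC; congr (_ + _).
  rewrite -thetaVnS -mulrA step mulrDr mulrA -rmorphM -exprSr; congr (_ + _).
have opH x : op H x = \sum_(j < r) H j.+1 * frob j.+1 x.
  by rewrite (op_poly _ hH) big_ord_recl /= H0 mul0r add0r.
have t1 : tends (fun N => \sum_(k < N) cst s (theta C ^+ k) * op H (division_point (b i) k))
    (\sum_(j < r) H j.+1 * M j i).
  apply: tends_eq (tends_sum (index_enum 'I_r) (P := xpredT) (fun j _ => tendsMl (H j.+1) (hM j))); exists 0%N => N _.
  under [RHS]eq_bigr do rewrite opH mulr_sumr.
  rewrite exchange_big /=; apply: eq_bigr => j _; rewrite mulr_sumr.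
  by apply: eq_bigr => k _; rewrite mulrCA.
have Q0 := qR_gt0 C; have Q1 := qR_gt1 C; set Q : R := q%:R in Q0 Q1 *.
have t2 : tends (fun N => cst s (theta C ^+ N) * op F (thetaVn N * b i)) 0.
  apply/tends0P; have [D D0 hD] := op_small Fent F0.
  have [N hN] := null_thetaVn (b i) ltr01.
  have g : null (fun k => D * norm (b i) ^+ 2 * Q^-1 ^+ k).
    apply: null_cM (null_geom _ _) => [|k||].
    - by rewrite mulr_ge0 ?exprn_ge0 ?norm_ge0.
    - by rewrite exprn_ge0 // invr_ge0 ltW.
    - by rewrite invr_ge0 ltW.
    by rewrite invf_lt1.
  apply: null_le g; exists N => k /hN /ltW h; rewrite norm_cstM absvX absv_thetaq.
  apply: (@le_trans _ _ (Q ^+ k * (D * norm (thetaVn k * b i) ^+ 2))).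
    rewrite ler_wpM2l ?exprn_ge0 ?(ltW Q0) //; apply: le_trans (hD _ h) _.
    by rewrite ler_wpM2l // ler_wiXn2l ?norm_ge0 ?qq_gt1.
  rewrite normM norm_thetaVn -exprVn exprMn mulrCA -mulrA ler_wpM2l //.
  rewrite mulrA mulrC ler_wpM2l ?exprn_ge0 ?norm_ge0 // expr2 mulrA -exprMn mulfV ?gt_eqF //.
  by rewrite expr1n mul1r.
rewrite -[RHS]add0r; apply: (@tends_uniq _ _ (fun _ => op F (b i))); first exact: tends_cst.
by apply: tends_eq (tendsD t2 t1); exists 0%N => N _; rewrite -iter.
Qed.

End Lattice.

(** * Biderivations and the de Rham map *)

Section Biderivations.
Variables (C : CinfSetting) (s r : nat).
Local Notation T := (tate_alg C s).
Local Notation S_ := (twist C s).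
Local Notation q := (qq C).
Variable A : S_.
Hypotheses (hA : twist_poly r A) (A0 : A 0%N = thetaT).

(** The algebraic half of the notion of biderivation. Values are arbitrary twisted power series, so
    that [m] in [inner m] may be infinite. *)
Definition derivation_rule (h : Apoly C s -> S_) :=
  (forall (c : {mpoly (Fq C)[s]}) a b, h (c%:P * a + b) = twist_const (embcT c) * h a + h b) /\
  (forall a b, h (a * b) = twist_const (embT a) * h b + h a * phiT A b).

Lemma derivation_rule_const h c : derivation_rule h -> h c%:P = 0.
Proof.
move=> [lin prod_rule].
have h0 : h 0 = 0.
  have := lin 1 0 0; rewrite mulr0 addr0 !rmorph1 mul1r => e.
  by apply: (@addrI _ (h 0)); rewrite -e addr0.
have h1 : h 1 = 0.
  have := prod_rule 1 1; rewrite mulr1 !rmorph1 mul1r mulr1 => e.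
  by apply: (@addrI _ (h 1)); rewrite -e addr0.
by have := lin c 1 0; rewrite mulr1 addr0 h1 mulr0 h0 addr0.
Qed.

Lemma derivation_rule_MXaddC h a c : derivation_rule h ->
  h (a * 'X + c%:P) = twist_const (embT a) * h 'X + h a * A.
Proof.
move=> hd; have hc := derivation_rule_const c hd; case: hd => [lin prod_rule].
have := lin 1 (a * 'X) c%:P; rewrite !rmorph1 !mul1r => ->.
by rewrite hc addr0 prod_rule phiTX.
Qed.

Lemma derivation_rule_ext h h' : derivation_rule h -> derivation_rule h' ->
  h 'X = h' 'X -> h =1 h'.
Proof.
move=> hd hd' e; elim/poly_ind => [|a c IH].
  by rewrite -[0]/(0%:P) !derivation_rule_const.
by rewrite !derivation_rule_MXaddC // e IH.
Qed.

Definition inner (m : S_) (a : Apoly C s) : S_ := m * phiT A a - twist_const (embT a) * m.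

Lemma inner_rule m : derivation_rule (inner m).
Proof.
split=> [c a b|a b]; rewrite /inner.
  rewrite !rmorphD !rmorphM /= phiTC embTC mulrDr mulrDl.
  rewrite opprD addrACA; congr (_ + _); rewrite mulrBr !mulrA; congr (_ * _ - _).
  by apply/funext => k; rewrite coefScM coefSMc frob_embc mulrC.
by rewrite !rmorphM /= mulrBr mulrBl !mulrA [RHS]addrC addrA subrK.
Qed.

Lemma innerD m m' a : inner (m + m') a = inner m a + inner m' a.
Proof. by rewrite /inner mulrDl mulrDr opprD addrACA. Qed.

Lemma innerX m : inner m 'X = m * A - twist_const thetaT * m.
Proof. by rewrite /inner phiTX embTX. Qed.

Lemma twist_commutator (m : S_) k :
  (m * twist_const thetaT - twist_const thetaT * m) k =
  cst s (theta C ^+ (q ^ k) - theta C) * m k.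
Proof.
by rewrite coefSB coefSMc coefScM frob_cst [m k * _]mulrC -mulrBl -rmorphB.
Qed.

Lemma twist_commutator_inj (m m' : S_) : m 0%N = m' 0%N ->
  m * twist_const thetaT - twist_const thetaT * m =
  m' * twist_const thetaT - twist_const thetaT * m' -> m = m'.
Proof.
move=> h0 h; apply/funext => -[|k] //.
have := congr1 (fun S : S_ => S k.+1) h; rewrite /= !twist_commutator; apply: mulfI.
by rewrite -norm_eq0 norm_cst absv_eq0 thetaXB_neq0.
Qed.

(** The coefficient of [tau^k] in the equation reads [(theta^(q^k) - theta) m_k = H_k] minus terms
    in the earlier [m_i], and is solvable for [k > 0]. Any value at [theta] without constant term is
    thereby extended to a biderivation. *)
Lemma formal_inner (H : S_) : H 0%N = 0 -> exists2 m : S_, m 0%N = 0 & inner m 'X = H.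
Proof.
move=> H0.
pose next (l : seq T) k : T := if k == 0%N then 0 else
  cst s (theta C ^+ (q ^ k) - theta C)^-1 * (H k - \sum_(i < k) l`_i * frob i (A (k - i)%N)).
(* Each coefficient depends on all earlier ones, so the recursion carries the list of them. *)
pose ms := fix ms k := if k is k'.+1 then rcons (ms k') (next (ms k') k') else [::].
have sms k : size (ms k) = k by elim: k => //= k IH; rewrite size_rcons IH.
pose m : S_ := fun k => (ms k.+1)`_k.
have nms k i : (i < k)%N -> (ms k)`_i = m i.
  elim: k => // k IH; rewrite ltnS leq_eqVlt => /orP [/eqP ->//|ik] /=.
  by rewrite nth_rcons sms ik IH.
have mE k : m k = next (ms k) k by rewrite /m /= nth_rcons sms ltnn eqxx.
have m0 : m 0%N = 0 by rewrite mE /next.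
exists m => //; rewrite innerX; apply/funext => k; rewrite coefSB coefScM coefSM big_ord_recr /=.
rewrite subnn A0 frob_cst; case: (posnP k) => [->|k0].
  by rewrite big_ord0 m0 mul0r mulr0 subr0 addr0 H0.
have -> : m k * cst s (theta C ^+ (q ^ k)) =
    cst s (theta C ^+ (q ^ k) - theta C) * m k + thetaT * m k.
  by rewrite -mulrDl -rmorphD subrK mulrC.
rewrite addrA addrK mE /next gtn_eqF // mulrA -rmorphM mulfV ?thetaXB_neq0 // rmorph1 mul1r.
rewrite addrC -addrA -[RHS]addr0; congr (_ + _); rewrite addrC; apply/eqP; rewrite subr_eq0.
by apply/eqP; apply: eq_bigr => i _; rewrite nms.
Qed.

Lemma twist_poly_le d d' (S : S_) : (d <= d')%N -> twist_poly d S -> twist_poly d' S.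
Proof. by move=> dd h i hi; apply: h; apply: leq_ltn_trans dd hi. Qed.

Lemma twist_polyM d d' (S U : S_) : twist_poly d S -> twist_poly d' U -> twist_poly (d + d') (S * U).
Proof.
move=> hS hU k hk; rewrite coefSM big1 // => i _.
case: (ltnP d i) => hi; first by rewrite hS // mul0r.
by rewrite hU ?rmorph0 ?mulr0 //; lia.
Qed.

Lemma twist_polyD d d' (S U : S_) : twist_poly d S -> twist_poly d' U ->
  twist_poly (maxn d d') (S + U).
Proof.
by move=> hS hU k; rewrite gtn_max => /andP [h1 h2]; rewrite coefSD hS ?hU ?addr0.
Qed.

Lemma twist_poly_const (f : T) : twist_poly 0 (twist_const f).
Proof. by case. Qed.

(** Even for infinite [m], the product rule expresses every value through the value at [theta] and
    [phi_theta], both polynomial. *)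
Lemma inner_poly d m : twist_poly d (inner m 'X) -> forall a, exists d', twist_poly d' (inner m a).
Proof.
move=> hm; elim/poly_ind => [|a c [d' IH]].
  by exists 0%N => k _; rewrite -[0]/(0%:P) (derivation_rule_const _ (inner_rule m)).
rewrite (derivation_rule_MXaddC _ _ (inner_rule m)); eexists; apply: twist_polyD.
  by apply: twist_polyM hm; apply: twist_poly_const.
by apply: twist_polyM IH hA.
Qed.

Lemma inner0 (m : S_) a : m 0%N = 0 -> inner m a 0%N = 0.
Proof.
by move=> m0; rewrite /inner coefSB coefScM coefSM big_ord1 m0 mulr0 mul0r subrr.
Qed.

Definition twist_mono i (f : T) : S_ := fun k => if k == i then f else 0.

Lemma twist_monoM i f (S : S_) k : (i <= k)%N -> (twist_mono i f * S) k = f * frob i (S (k - i)%N).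
Proof.
move=> ik; rewrite coefSM (bigD1 (Ordinal (ik : (i < k.+1)%N))) //= /twist_mono eqxx.
rewrite big1 ?addr0 // => j; rewrite -val_eqE /= => /negbTE ->.
by rewrite mul0r.
Qed.

Variable B : T.
Hypotheses (hB : A r * B = 1) (r0 : (0 < r)%N).

(** Subtracting the inner biderivation of [H_(r+d+1) B^(d+1) tau^(d+1)] cancels the top term, as [B]
    is inverse to [A_r]. The corrections need an exponent at least 1 to have no constant term, so
    the reduction stops in degree [r]. *)
Lemma inner_reduction d (H : S_) : twist_poly (r + d) H -> H 0%N = 0 ->
  exists (m : S_) d', [/\ m 0%N = 0, twist_poly d' m, twist_poly r (H - inner m 'X)
    & (H - inner m 'X) 0%N = 0].
Proof.
elim: d H => [|d IH] H hH H0.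
  exists 0, 0%N; split=> // [|]; rewrite innerX mul0r mulr0 subr0 subr0 //.
  by move=> k hk; apply: hH; rewrite addn0.
pose m1 := twist_mono d.+1 (H (r + d.+1)%N * frob d.+1 B).
have m10 : m1 0%N = 0 by [].
have i0 : inner m1 'X 0%N = 0 by exact: inner0.
have [||m [d' [m0 hm h1 h2]]] := IH (H - inner m1 'X).
- move=> k hk; rewrite coefSB innerX coefSB coefScM twist_monoM; last by lia.
  rewrite [m1 k]/m1 /twist_mono ifN; last by lia.
  rewrite mulr0 subr0; have [kr|kr] := ltnP (r + d.+1) k.
    have -> : A (k - d.+1)%N = 0 by apply: hA; lia.
    by rewrite hH // rmorph0 mulr0 subrr.
  have -> : k = (r + d.+1)%N by lia.
  by rewrite addnK -mulrA -rmorphM [B * _]mulrC hB rmorph1 mulr1 subrr.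
- by rewrite coefSB i0 H0 subrr.
have e : H - inner (m + m1) 'X = H - inner m1 'X - inner m 'X.
  by rewrite innerD opprD addrA addrAC.
exists (m + m1), (maxn d' d.+1); split; rewrite ?e //.
  by rewrite coefSD m0 m10 addr0.
apply: twist_polyD => // k hk; rewrite /m1 /twist_mono gtn_eqF //.
Qed.

End Biderivations.

(** * Kernel and image of the de Rham map *)

Section DeRham.
Variables (C : CinfSetting) (s p : nat).
Local Notation T := (tate_alg C s).
Local Notation S_ := (twist C s).
Local Notation r := p.+1.
Variables (A E : S_) (B : T) (b : 'I_r -> T).
Hypotheses (hA : twist_poly r A) (A0 : A 0%N = thetaT) (hB : A r * B = 1).
Hypotheses (E0 : E 0%N = 1) (hE : E * twist_const thetaT = A * E).
Hypothesis b_lattice : forall i, op E (b i) = 0.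
Hypothesis b_gen : forall f, op E f = 0 -> exists c : 'I_r -> Apoly C s, f = \sum_i embT (c i) * b i.
Hypothesis b_free : forall c : 'I_r -> Apoly C s, \sum_i embT (c i) * b i = 0 -> forall i, c i = 0.

Let Eent : entire E. Proof. exact: exp_entire hA A0 hE. Qed.

Definition quasi_periodic (H F : S_) :=
  F 0%N = 0 /\ F * twist_const thetaT - twist_const thetaT * F = H * E.

(** The relation [exp theta = phi_theta exp] carries [theta] across [m exp]; this works for
    polynomial and infinite [m] alike. *)
Lemma quasi_periodic_inner (m : S_) : m 0%N = 0 -> quasi_periodic (inner A m 'X) (m * E).
Proof.
move=> m0; split; first by rewrite coefSM big_ord1 m0 mul0r.
by rewrite innerX -mulrA hE !mulrA mulrBl.
Qed.

Lemma quasi_periodic_uniq H F F' : quasi_periodic H F -> quasi_periodic H F' -> F = F'.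
Proof.
by move=> [F0 hF] [F'0 hF']; apply: twist_commutator_inj; rewrite ?F0 // hF hF'.
Qed.

Lemma quasi_periodicB (H F H' F' : S_) : quasi_periodic H F -> quasi_periodic H' F' ->
  quasi_periodic (H - H') (F - F').
Proof.
move=> [F0 hF] [F'0 hF']; split; first by rewrite coefSB F0 F'0 subrr.
rewrite mulrBl mulrBr mulrBl -hF -hF' !opprB addrACA [RHS]addrACA; congr (_ + _).
exact: addrC.
Qed.

Lemma quasi_periodic_ent d H F : twist_poly d H -> quasi_periodic H F -> entire F.
Proof.
by move=> hH [F0 hF]; apply: quasi_periodic_entire F0 hF _; apply: entire_mul hH Eent.
Qed.

Lemma quasi_periodic_linear d H F a f : twist_poly d H -> quasi_periodic H F -> op E f = 0 ->
  op F (embT a * f) = embT a * op F f.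
Proof.
move=> hH hF hf; have Fent := quasi_periodic_ent hH hF; case: hF => F0 hF.
have step g : op E g = 0 -> op F (thetaT * g) = thetaT * op F g.
  by move=> hg; rewrite (quasi_periodic_theta g hH Eent Fent hF) hg op0 addr0.
elim/poly_ind: a => [|a c IH]; first by rewrite rmorph0 !mul0r op0.
rewrite rmorphD rmorphM /= embTX embTC !mulrDl opD // op_embc //; congr (_ + _).
rewrite [_ * thetaT]mulrC -!mulrA step ?IH //.
by case: (lattice_emb hA A0 E0 hE a hf).
Qed.

(** By uniqueness [F = m exp]. For polynomial [m] this operator is [m] applied after [exp], which
    kills the lattice. *)
Lemma strictly_inner_vanishes d (m : S_) F : m 0%N = 0 -> twist_poly d m ->
  quasi_periodic (inner A m 'X) F -> forall f, op E f = 0 -> op F f = 0.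
Proof.
move=> m0 hm hF f hf.
rewrite (quasi_periodic_uniq hF (quasi_periodic_inner m0)).
by rewrite (op_mul _ hm Eent) hf op0.
Qed.

(** After reduction to degree at most [r], the coefficients of [tau, ..., tau^r] form a row vector
    whose product with the period matrix [M] is the vector of periods. All periods vanish and [M] is
    invertible, so nothing remains besides the inner part. *)
Lemma vanishing_strictly_inner d (H F : S_) : twist_poly d H -> H 0%N = 0 -> quasi_periodic H F ->
  (forall i, op F (b i) = 0) ->
  exists (m : S_) d', [/\ m 0%N = 0, twist_poly d' m & H = inner A m 'X].
Proof.
move=> hH H0 hF hv; have [M [W [hWM hM]]] := period_matrix hA A0 hB E0 hE b_lattice b_gen b_free.
have [m [d' [m0 hm h1 h2]]] := inner_reduction hA hB (ltn0Sn p) (twist_poly_le (leq_addl r d) hH) H0.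
have hF' := quasi_periodicB hF (quasi_periodic_inner m0).
set H' := H - _ in h1 h2 hF'; set F' := F - _ in hF'.
have hmE := entire_mul hm Eent.
have Fent := quasi_periodic_ent hH hF.
have v i : op F' (b i) = 0.
  rewrite (op_plus _ Fent (entire_opp hmE)).
  by rewrite op_opp // hv (op_mul _ hm Eent) b_lattice op0 subr0.
pose x : 'rV[T]_r := \row_j H' j.+1.
have xM : x *m M = 0.
  apply/matrixP => i' i; rewrite !mxE -[RHS](v i).
  rewrite (quasi_periodic_eval hA A0 hE (hM^~ i) h2 h1 (proj1 hF') (proj2 hF')).
  by apply: eq_bigr => j _; rewrite mxE.
have x0 : x = 0 by rewrite -[x]mulmx1 -(mulmx1C hWM) mulmxA xM mul0mx.
exists m, d'; split=> //; apply/eqP; rewrite -subr_eq0 -/H'; apply/eqP.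
apply/funext => -[|k]; first exact: h2.
case: (ltnP k r) => hk; last exact: h1.
by have := congr1 (fun y : 'rV[T]_r => y 0 (Ordinal hk)) x0; rewrite !mxE.
Qed.

(** The row [w W] supplies the coefficients of [tau, ..., tau^r] in the value at [theta]. The series
    [m] solving the formal equation is infinite unless all [w_i] vanish: for polynomial [m], [m exp]
    would be 0 on the lattice. *)
Lemma prescribed_periods (w : 'I_r -> T) : exists m : S_,
  [/\ m 0%N = 0, twist_poly r (inner A m 'X) & forall i, op (m * E) (b i) = w i].
Proof.
have [M [W [hWM hM]]] := period_matrix hA A0 hB E0 hE b_lattice b_gen b_free.
pose x : 'rV[T]_r := (\row_i w i) *m W.
pose H : S_ := fun k => if k is k'.+1 then if insub k' is Some j then x 0 j else 0 else 0.
have hH : twist_poly r H.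
  by case=> // k hk; rewrite /H insubN // -leqNgt.
have [m m0 hm] := formal_inner A0 (erefl : H 0%N = 0).
exists m; split; rewrite ?hm // => i.
have [F0 hF] := quasi_periodic_inner m0; rewrite hm in hF.
rewrite (quasi_periodic_eval hA A0 hE (hM^~ i) (erefl : H 0%N = 0) hH F0 hF).
transitivity ((x *m M) 0 i); last by rewrite /x -mulmxA hWM mulmx1 mxE.
by rewrite mxE; apply: eq_bigr => j _; rewrite /H valK.
Qed.

End DeRham.

(** * Dictionary between coefficient functions and the ring structures *)

Section Translation.
Variables (C : CinfSetting) (s : nat).
Local Notation T := (tate_alg C s).
Local Notation S_ := (twist C s).

Lemma tfun_inj (f g : T) : tfun f = tfun g -> f = g.
Proof. by move=> h; apply: tateE => m; rewrite h. Qed.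

Lemma tzeroE : tzero C s = tfun (0 : T).
Proof. by apply/funext => m; rewrite coefT0. Qed.

Lemma LambdaP (E : S_) (l : Tfun C s) : entire E ->
  Lambda (raw E) l <-> exists2 f : T, l = tfun f & op E f = 0.
Proof.
move=> hE; rewrite /Lambda tzeroE; split=> [[hl]|[f -> hf]].
  by rewrite -[l]/(tfun (TateAlg hl)) (tapp_op _ _ hE) => h; exists (TateAlg hl).
by rewrite (tapp_op _ _ hE) hf; split=> //; apply: tfunP.
Qed.

Lemma lattice_comb r (c : 'I_r -> Apoly C s) (b : 'I_r -> T) :
  (fun nu => \sum_(i < r) tmul (emb (c i)) (b i) nu) = tfun (\sum_i embT (c i) * b i).
Proof.
apply/funext => m; rewrite coefT_sum; apply: eq_bigr => i _.
by rewrite coefTM raw_emb.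
Qed.

Lemma Ahom_comb r (E : S_) (Om : Tfun C s -> Tfun C s) (b w : 'I_r -> T) (c : 'I_r -> Apoly C s) :
  entire E -> is_Ahom (raw E) Om -> (forall i, op E (b i) = 0) ->
  (forall a f, op E f = 0 -> op E (embT a * f) = 0) ->
  (forall i, Om (b i) = w i) -> Om (\sum_i embT (c i) * b i : T) = (\sum_i embT (c i) * w i : T).
Proof.
move=> hE [_ [addOm linOm]] hb hlin hw.
have L (f : T) : op E f = 0 -> Lambda (raw E) f by move=> hf; apply/LambdaP => //; exists f.
have Om0 : Om (0 : T) = (0 : T).
  have := addOm _ _ (L 0 (op0 E)) (L 0 (op0 E)).
  rewrite -[tadd (0 : T) (0 : T)]/(tfun (0 + 0 : T)) addr0 => h.
  apply/funext => m; rewrite coefT0; apply: (@addrI _ (Om (0 : T) m)).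
  by rewrite addr0 [in RHS]h.
suff [] : op E (\sum_i embT (c i) * b i) = 0 /\
  Om (\sum_i embT (c i) * b i : T) = (\sum_i embT (c i) * w i : T) by [].
elim: (index_enum _) => [|i l [IH1 IH2]]; first by rewrite !big_nil op0.
rewrite !big_cons; have h1 := hlin (c i) _ (hb i); split; first by rewrite opD // h1 IH1 addr0.
rewrite -[tfun (_ + _)]/(tadd (tfun (embT (c i) * b i)) (tfun _)) addOm; try exact: L.
rewrite IH2 -[tfun (embT (c i) * b i)]/(tmul (embT (c i)) (b i)) -raw_emb linOm ?hw; last exact: L.
by rewrite raw_emb.
Qed.

Lemma tmul_raw (f : T) (S : S_) i nu : tmul f (raw S i) nu = (twist_const f * S) i nu.
Proof. by rewrite coefScM coefTM. Qed.

Lemma raw_bider (A : S_) (eta : Apoly C s -> TS C s) : is_bider (raw A) eta ->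
  exists h : Apoly C s -> S_, [/\ forall a, eta a = raw (h a), derivation_rule A h,
    exists d, twist_poly d (h 'X) & h 'X 0%N = 0].
Proof.
move=> [heta [lin prod_rule]].
have /choice [h hh] : forall a, exists S, eta a = raw S.
  by move=> a; apply: rawP; case: (heta a).
exists h; split=> //.
- split=> [c a b|a b]; apply: raw_inj; rewrite -hh ?lin ?prod_rule; apply/funext => i; apply/funext => m.
    by rewrite !hh -[embc c]/(tfun (embcT c)) tmul_raw.
  by rewrite !hh raw_emb tmul_raw raw_phi raw_mul.
- have [_ [[d hd] _]] := heta 'X; exists d => i /hd; rewrite hh tzeroE.
  exact: tfun_inj.
- have [_ [_]] := heta 'X; rewrite /ts_tau0 hh => e.
  by apply: tfun_inj; rewrite -tzeroE -e.
Qed.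

Lemma raw_inner (A m : S_) a :
  (fun i nu => tsmul (raw m) (phi (raw A) a) i nu - tmul (emb a) (raw m i) nu) = raw (inner A m a).
Proof.
by apply/funext => i; apply/funext => nu; rewrite raw_phi raw_mul raw_emb tmul_raw.
Qed.

Lemma raw_quasi_periodic (E : S_) (eta : Apoly C s -> TS C s) (H F : S_) : eta 'X = raw H ->
  is_quasi_periodic (raw E) eta (raw F) <-> quasi_periodic E H F.
Proof.
move=> hH; rewrite /is_quasi_periodic /quasi_periodic hH raw_mul.
have -> : (fun i nu => tsmul (raw F) (ts_const (tcst s (theta C))) i nu -
    tmul (tcst s (theta C)) (raw F i) nu) = raw (F * twist_const thetaT - twist_const thetaT * F).
  apply/funext => i; apply/funext => nu.
  by rewrite -[tcst s (theta C)]/(tfun (thetaT : T)) raw_const raw_mul tmul_raw.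
rewrite /ts_tau0 tzeroE; split=> [[_ [h1 h2]]|[h1 h2]].
  by split; [exact: tfun_inj | exact: raw_inj].
by rewrite h2; split; [exact: raw_tate | rewrite /raw h1].
Qed.

End Translation.

(** The quotient by [Der_si] is not formed: injectivity says that the classes killed by restriction
    to the lattice are those of strictly inner biderivations, and [F_eta] enters through its
    defining equation. *)
Theorem theorem5p8 (C : CinfSetting) (s r : nat) (Acoef : TS C s) (E : TS C s) :
  (0 < s)%N -> (0 < r)%N ->
  (* phi_theta = theta + A_1 tau + ... + A_r tau^r, A_i in T_s *)
  ts_tate Acoef -> Acoef 0%N = tcst s (theta C) ->
  (forall i : nat, (r < i)%N -> Acoef i = tzero C s) ->
  (* (i) A_r is a unit of T_s *)
  tunit (Acoef r) ->
  (* E is exp_phi *)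
  is_exp Acoef E ->
  (* (ii) Lambda_phi is free of rank r over A[t_s] *)
  lattice_free_rank E r ->
  (* DR is injective on H_DR^* (its kernel on Der(phi) is exactly Der_si(phi)) *)
  (forall eta : Apoly C s -> TS C s, is_bider Acoef eta ->
     forall F : TS C s, is_quasi_periodic E eta F ->
       ((forall l, Lambda E l -> tapp F l (tzero C s)) <-> strictly_inner Acoef eta)) /\
  (* DR is surjective *)
  (forall Om : Tfun C s -> Tfun C s, is_Ahom E Om ->
     exists eta : Apoly C s -> TS C s, is_bider Acoef eta /\
       exists F : TS C s, is_quasi_periodic E eta F /\
         (forall l, Lambda E l -> tapp F l (Om l))).
Proof.
move=> _; case: r => // p _ /rawP [A ->] hA0 hAr [B' [hB' hAB]] [/rawP [E' ->]] [hE0 hEphi].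
set B := TateAlg hB'; have {}hE0 : E' 0%N = 1 by exact: tfun_inj.
have {}hA0 : A 0%N = thetaT by exact: tfun_inj.
have hA : twist_poly p.+1 A by move=> i /hAr; rewrite tzeroE; exact: tfun_inj.
have hB : A p.+1 * B = 1 by exact: tfun_inj.
have hE : E' * twist_const thetaT = A * E'.
  by apply: raw_inj; rewrite -!raw_mul -raw_const -embTX -raw_emb hEphi raw_phi phiTX.
have Eent : entire E' := exp_entire hA hA0 hE.
have op_emb a f : op E' f = 0 -> op E' (embT a * f) = 0.
  by move=> hf; case: (lattice_emb hA hA0 hE0 hE a hf).
case=> b' [hb' [gen' free']].
have /choice [b hb] : forall i, exists f : tate_alg C s, b' i = f /\ op E' f = 0.
  by move=> i; have /(LambdaP _ Eent) [f h1 h2] := hb' i; exists f.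
have {hb'} bE : b' = fun i => tfun (b i) by apply/funext => i; case: (hb i).
have b_lattice i : op E' (b i) = 0 by case: (hb i).
have b_gen f : op E' f = 0 -> exists c : 'I_p.+1 -> Apoly C s, f = \sum_i embT (c i) * b i.
  move=> hf; have [|c hc] := gen' (tfun f); first by apply/LambdaP => //; exists f.
  by exists c; apply: tfun_inj; rewrite hc bE lattice_comb.
have b_free (c : 'I_p.+1 -> Apoly C s) : \sum_i embT (c i) * b i = 0 -> forall i, c i = 0.
  move=> hc; have := free' c (fun _ => 0); rewrite bE !lattice_comb hc => h i.
  by rewrite h // big1 // => j _; rewrite rmorph0 mul0r.
have vanish (F : twist C s) : entire F ->
    (forall l, Lambda (raw E') l -> tapp (raw F) l (tzero C s)) <->
    (forall f, op E' f = 0 -> op F f = 0).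
  move=> Fent; rewrite tzeroE; split=> [h f hf|h l /(LambdaP _ Eent) [f -> hf]].
    by apply: tfun_inj; congr tfun; apply/(tapp_op _ _ Fent)/h/LambdaP => //; exists f.
  by apply/(tapp_op _ _ Fent); apply: h.
split=> [eta /raw_bider [h [etaE hrule [d hd] h0]] F hF|Om hOm].
  have /rawP [F' FE] : ts_tate F by case: hF.
  rewrite {F}FE in hF *; have {}hF := proj1 (raw_quasi_periodic E' F' (etaE 'X)) hF.
  have Fent : entire F' := quasi_periodic_ent hA hA0 hE hd hF.
  rewrite (vanish _ Fent); split=> [hv|[m' [hm' [[d' hd'] [hm0 hm]]]]].
    have [|m [d' [m0 hm hX]]] :=
      vanishing_strictly_inner hA hA0 hB hE0 hE b_lattice b_gen b_free hd h0 hF.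
      by move=> i; apply: hv.
    exists (raw m); split; first exact: raw_tate.
    split; first by exists d' => i /hm e; rewrite /raw e -tzeroE.
    split; first by rewrite /ts_tau0 /raw m0 -tzeroE.
    by move=> a; rewrite raw_inner etaE (derivation_rule_ext hrule (inner_rule A m) hX).
  have [m mE] := rawP hm'; rewrite {m'}mE in hm' hd' hm0 hm.
  have m0 : m 0%N = 0 by apply: tfun_inj; rewrite -tzeroE -hm0.
  have hX : h 'X = inner A m 'X by apply: raw_inj; rewrite -etaE hm raw_inner.
  rewrite hX in hF; apply: (strictly_inner_vanishes hA hA0 hE m0 (d := d')) hF.
  by move=> i /hd'; rewrite tzeroE; exact: tfun_inj.
have /choice [w hw] : forall i, exists w : tate_alg C s, Om (b i) = w.
  move=> i; have /hOm.1 hT : Lambda (raw E') (b i) by apply/LambdaP => //; exists (b i).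
  by exists (TateAlg hT).
have [m [m0 hmp hmw]] := prescribed_periods hA hA0 hB hE0 hE b_lattice b_gen b_free w.
have hqp := quasi_periodic_inner hE m0.
have Fent := quasi_periodic_ent hA hA0 hE hmp hqp.
(* The series [m] may be infinite, but the value at [theta] is polynomial, hence so are all values
   of this biderivation. *)
exists (fun a => raw (inner A m a)); split; [split; [|split]|].
- move=> a; split; first exact: raw_tate.
  split; last by rewrite /ts_tau0 /raw inner0 // -tzeroE.
  have [d hd] := inner_poly hA hmp a.
  by exists d => i /hd e; rewrite /raw e -tzeroE.
- move=> c a a'; rewrite (proj1 (inner_rule A m)).
  apply/funext => i; apply/funext => nu.
  by rewrite -[embc c]/(tfun (embcT c)) tmul_raw.
- move=> a a'; rewrite (proj2 (inner_rule A m)).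
  by apply/funext => i; apply/funext => nu; rewrite raw_emb tmul_raw raw_phi raw_mul.
exists (raw (m * E')); split.
  exact/(@raw_quasi_periodic _ _ E' (fun a => raw (inner A m a)) (inner A m 'X) (m * E') (erefl _)).
move=> l /(LambdaP _ Eent) [f -> hf]; have [c hc] := b_gen f hf.
(* Both [Om] and the quasi-periodic operator are [A[t_s]]-linear on the lattice, so agreement on the
   basis suffices. *)
rewrite hc (Ahom_comb c Eent hOm b_lattice op_emb hw).
apply/(tapp_op _ _ Fent); rewrite op_sum //; apply: eq_bigr => i _.
by rewrite (quasi_periodic_linear hA hA0 hE0 hE _ hmp hqp) // hmw.
Qed.
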